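(* Let $n\ge1$, let $Q,B\in M_n(\mathbb{R})$ with $Q$ symmetric positive semi-definite, and let $P=\frac12\mathrm{Tr}(Q\nabla_x^2)+\langle Bx,\nabla_x\rangle$, $x\in\mathbb{R}^n$, be a hypoelliptic Ornstein-Uhlenbeck operator which admits an invariant measure $d\mu(x)=\rho(x)\,dx$. Set $$\tau_0=\inf_{\lambda\in\sigma(B)}\mathrm{Re}(-\lambda)=-\sup_{\lambda\in\sigma(B)}\mathrm{Re}\,\lambda>0.$$ Then for all $0\le\tau<\tau_0$ there exists a constant $C>0$ such that $$\forall t\ge0,\ \forall v\in L^2_\mu,\qquad \Big\|e^{tP}v-\Big(\int_{\mathbb{R}^n}v(x)\rho(x)\,dx\Big)\Big\|_{L^2_\mu}\le Ce^{-\tau t}\|v\|_{L^2_\mu}.$$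
   Context: Notation: $\mathrm{Tr}(Q\nabla_x^2)=\sum_{i,j}q_{i,j}\partial^2_{x_i,x_j}$ and $\langle Bx,\nabla_x\rangle=\sum_{i,j}b_{i,j}x_j\partial_{x_i}$. Hypoellipticity of $P$ is known to be equivalent to the Kalman rank condition $\mathrm{Rank}[Q^{1/2},BQ^{1/2},\dots,B^{n-1}Q^{1/2}]=n$ (the $n\times n^2$ matrix obtained by juxtaposing these blocks), and also to $\det Q_t>0$ for some (equivalently all) $t>0$, where $Q_t=\int_0^te^{sB}Qe^{sB^T}ds$. Invariant measure: when hypoelliptic, $P$ generates the Markov semigroup $(T(t)f)(x)=\frac{1}{(2\pi)^{n/2}\sqrt{\det Q_t}}\int_{\mathbb{R}^n}e^{-\frac12\langle Q_t^{-1}y,y\rangle}f(e^{tB}x-y)\,dy$, $t>0$; an invariant measure is a probability measure $\mu$ with $\int T(t)f\,d\mu=\int f\,d\mu$ for all $t\ge0$ and all bounded continuous $f$. It is known that existence of an invariant measure is equivalent to $\sigma(B)\subset\{z\in\mathbb{C}:\mathrm{Re}\,z<0\}$, and then it is unique and given by $d\mu=\rho\,dx$ with $\rho(x)=\frac{1}{(2\pi)^{n/2}\sqrt{\det Q_\infty}}e^{-\frac12\langle Q_\infty^{-1}x,x\rangle}$, $Q_\infty=\int_0^{+\infty}e^{sB}Qe^{sB^T}ds$. $L^2_\mu=L^2(\mathbb{R}^n,d\mu)$ (complex valued functions). $(e^{tP})_{t\ge0}$ is the strongly continuous semigroup on $L^2_\mu$ generated by $P$ with domain $D(P)=\{u\in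 L^2_\mu:Pu\in L^2_\mu\}$ (the extension of $(T(t))_{t\ge0}$ to $L^2_\mu$). The number $\int v\rho\,dx$ is viewed as a constant function. *)

(* Defs.v *)
From HB Require Import structures.
From mathcomp Require Import all_boot all_order all_algebra.
From mathcomp Require Import complex.
From mathcomp Require Import all_classical all_reals all_analysis.

Set Implicit Arguments.
Unset Strict Implicit.
Unset Printing Implicit Defensive.
Import Order.TTheory GRing.Theory Num.Theory numFieldNormedType.Exports.
Import ComplexField.Normc.
Local Open Scope classical_set_scope.
Local Open Scope ring_scope.

(* Vectors of R^n are columns 'cV[R]_n, so that B acts by x |-> B *m x. *)
Definition measure_cV_display : measure_display.
Proof. exact: default_measure_display. Qed.

(* The sigma-algebra of R^n generated by the coordinates, i.e. the Borel one. *)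
Section measurable_cV.
Context {R : realType}.
Variable n : nat.

Let coors : 'I_n -> 'cV[R]_n -> R := fun i x => x i 0.

Let cV_set0 : g_sigma_preimage coors set0.
Proof. exact: sigma_algebra0. Qed.

Let cV_setC A : g_sigma_preimage coors A -> g_sigma_preimage coors (~` A).
Proof. exact: sigma_algebraC. Qed.

Let cV_bigcup (F : _^nat) : (forall i, g_sigma_preimage coors (F i)) ->
  g_sigma_preimage coors (\bigcup_i (F i)).
Proof. exact: sigma_algebra_bigcup. Qed.

HB.instance Definition _ := @isMeasurable.Build measure_cV_display
  'cV[R]_n (g_sigma_preimage coors) cV_set0 cV_setC cV_bigcup.

End measurable_cV.

Lemma measurable_coord (R : realType) (n : nat) (i : 'I_n) :
  measurable_fun [set: 'cV[R]_n] (fun x : 'cV[R]_n => x i 0).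
Proof.
move=> _ Y mY; rewrite setTI; apply: sub_sigma_algebra => /=.
rewrite -bigcup_seq/=; exists i => /=; first by rewrite mem_index_enum.
by exists Y => //; rewrite setTI.
Qed.

Lemma measurable_fun_cV d (T : measurableType d) (R : realType) (n : nat)
    (f : T -> 'cV[R]_n) :
  (forall i, measurable_fun [set: T] (fun x => f x i 0)) ->
  measurable_fun [set: T] f.
Proof.
move=> mf _ Y mY; rewrite setTI.
suff : measurable `<=` [set A : set 'cV[R]_n | measurable (f @^-1` A)] by exact.
apply: smallest_sub.
  split=> [|A mA|F mF] /=.
  - by rewrite preimage_set0; exact: measurable0.
  - by rewrite setTD -preimage_setC; exact: measurableC.
  - by rewrite preimage_bigcup; apply: bigcup_measurable => k _; exact: mF.
move=> A; rewrite -bigcup_seq => -[i _ [B mB <-]] /=.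
rewrite setTI.
by have := mf i measurableT B mB; rewrite setTI.
Qed.

Section lebesgue_cV.
Context {R : realType}.

Definition cons_cV (n : nat) (p : R * 'cV[R]_n) : 'cV[R]_n.+1 :=
  col_mx (p.1%:M : 'cV[R]_1) p.2.

Definition uncons_cV (n : nat) (x : 'cV[R]_n.+1) : R * 'cV[R]_n :=
  (x 0 0, dsubmx (x : 'cV[R]_(1 + n))).

Lemma cons_cVK n : cancel (@cons_cV n) (@uncons_cV n).
Proof.
move=> [a x]; rewrite /uncons_cV /cons_cV; congr pair; last exact: col_mxKd.
by rewrite mxE; case: splitP => // j _; rewrite mxE ord1 eqxx mulr1n.
Qed.

Lemma measurable_cons_cV n : measurable_fun setT (@cons_cV n).
Proof.
apply: measurable_fun_cV => i.
have [j|j] := @split_ordP 1 n i => ->.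
- apply: (eq_measurable_fun fst) => [p _|]; last exact: measurable_fst.
  by rewrite [RHS](@col_mxEu _ 1 n 1) mxE !ord1 eqxx mulr1n.
- apply: (eq_measurable_fun ((fun x : 'cV[R]_n => x j 0) \o snd)) => [p _|].
    by rewrite [RHS](@col_mxEd _ 1 n 1).
  by apply: measurableT_comp; [exact: measurable_coord|exact: measurable_snd].
Qed.

Lemma measurable_uncons_cV n : measurable_fun setT (@uncons_cV n).
Proof.
apply: measurable_fun_pair => /=; first exact: measurable_coord.
apply: measurable_fun_cV => i; under eq_fun do rewrite mxE.
exact: measurable_coord.
Qed.

Section step.
Variable n : nat.
Variable m : {sigma_finite_measure set 'cV[R]_n -> \bar R}.

Definition lebesgue_step : set 'cV[R]_n.+1 -> \bar R :=
  pushforward (lebesgue_measure \x m)%E (@cons_cV n).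

Let lebesgue_step0 : lebesgue_step set0 = 0%E.
Proof. by rewrite /lebesgue_step /pushforward preimage_set0 measure0. Qed.

Let lebesgue_step_ge0 A : (0 <= lebesgue_step A)%E.
Proof. by rewrite /lebesgue_step /pushforward measure_ge0. Qed.

Let lebesgue_step_sigma_additive : semi_sigma_additive lebesgue_step.
Proof.
exact: (@measure_semi_sigma_additive _ _ _
  (measure_function_pushforward__canonical__measure_function_Measure
    (lebesgue_measure \x m)%E (@measurable_cons_cV n))).
Qed.

HB.instance Definition _ := isMeasure.Build _ _ _ lebesgue_step
  lebesgue_step0 lebesgue_step_ge0 lebesgue_step_sigma_additive.

Let lebesgue_step_sigma_finite : sigma_finite setT lebesgue_step.
Proof.
have /sigma_finiteP[F [TF ndF Foo]] := sigma_finiteT (@lebesgue_measure R).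
have /sigma_finiteP[G [TG ndG Goo]] := sigma_finiteT m.
exists (fun k => @uncons_cV n @^-1` (F k `*` G k)).
  rewrite -preimage_bigcup (_ : \bigcup_k _ = setT) ?preimage_setT//.
  apply/seteqP; split => // -[a x] _.
  have [k _ Fka] : (\bigcup_k F k) a by rewrite -TF.
  have [l _ Glx] : (\bigcup_k G k) x by rewrite -TG.
  exists (maxn k l) => //; split => /=.
  - by move: a Fka; exact/subsetPset/ndF/leq_maxl.
  - by move: x Glx; exact/subsetPset/ndG/leq_maxr.
move=> k; have [mF Fk] := Foo k; have [mG Gk] := Goo k; split.
  rewrite -[X in measurable X]setTI; apply: measurable_uncons_cV => //.
  exact: measurableX.
rewrite /lebesgue_step /pushforward (_ : _ @^-1` _ = F k `*` G k); last first.
  by apply/seteqP; split => p; rewrite /preimage /mkset cons_cVK.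
by rewrite product_measure1E// lte_mul_pinfty// ge0_fin_numE.
Qed.

HB.instance Definition _ := Measure_isSigmaFinite.Build _ _ _ lebesgue_step
  lebesgue_step_sigma_finite.

End step.

(* Lebesgue measure on R^n, as the n-fold product of the one on R. *)
Fixpoint lebesgue (n : nat) : {sigma_finite_measure set 'cV[R]_n -> \bar R} :=
  match n with
  | 0 => \d_(0 : 'cV[R]_0)
  | k.+1 => lebesgue_step (lebesgue k)
  end.

End lebesgue_cV.

Section complex_L2.
Context d (T : measurableType d) (R : realType).
Variable mu : {measure set T -> \bar R}.
Implicit Types v : T -> R[i].

Definition cintegral v : R[i] :=
  Complex (\int[mu]_x complex.Re (v x)) (\int[mu]_x complex.Im (v x)).

Definition L2norm v : \bar R := 'N[mu]_2[(fun x => (normc (v x))%:E)]%E.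

(* Functions rather than classes: equality in L^2 is %[ae mu]. *)
Definition L2 : set (T -> R[i]) :=
  [set v | [/\ measurable_fun setT (fun x => complex.Re (v x)),
               measurable_fun setT (fun x => complex.Im (v x)) &
               (L2norm v < +oo)%E]].

End complex_L2.

Section differential_calculus.
Context {R : realType} {n : nat}.
Implicit Types (f g phi : 'cV[R]_n -> R) (U : set 'cV[R]_n).

Definition partial (i : 'I_n) f : 'cV[R]_n -> R := 'D_(delta_mx i 0) f.

Definition partials (s : seq 'I_n) f : 'cV[R]_n -> R := foldr partial f s.

(* Meaningful for U open: all iterated partial derivatives exist and are
   continuous at the points of U. *)
Definition smooth_on U f : Prop :=
  forall s : seq 'I_n, forall x, U x ->
    {for x, continuous (partials s f)} /\
    (forall i, derivable (partials s f) x (delta_mx i 0)).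

Definition test_function U phi : Prop :=
  smooth_on setT phi /\
  exists K, [/\ compact K, K `<=` U & forall x, ~ K x -> phi x = 0].

(* Real distributions on U; the values of u outside the test functions on U
   are irrelevant. The last clause bounds |u phi| by a C^N norm of phi on each
   compact set. *)
Definition distribution_on U (u : ('cV[R]_n -> R) -> R) : Prop :=
  (forall a phi psi, test_function U phi -> test_function U psi ->
     u (fun x => a * phi x + psi x) = a * u phi + u psi) /\
  (forall K, compact K -> K `<=` U -> exists (C : R) (N : nat),
     forall phi M, test_function U phi -> (forall x, ~ K x -> phi x = 0) ->
       (forall s x, (size s <= N)%N -> `|partials s phi x| <= M) ->
       `|u phi| <= C * M).

End differential_calculus.

Section ornstein_uhlenbeck.
Context {R : realType} {n : nat}.
Variables Q B : 'M[R]_n.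

(* The formal transpose of P = (1/2) Tr (Q D^2) + <B x, D>, obtained by
   integrating by parts: phi |-> (1/2) Tr (Q D^2 phi) - div (phi(x) B x). *)
Definition ou_transpose (phi : 'cV[R]_n -> R) (x : 'cV[R]_n) : R :=
  2^-1 * (\sum_i \sum_j Q i j * partial i (partial j phi) x)
  - \sum_i partial i (fun y => (B *m y) i 0 * phi y) x.

(* P is hypoelliptic: if P u is smooth on U, in the sense of distributions,
   then so is u. *)
Definition hypoelliptic : Prop :=
  forall (U : set 'cV[R]_n) (u : ('cV[R]_n -> R) -> R) (g : 'cV[R]_n -> R),
    open U -> distribution_on U u -> smooth_on U g ->
    (forall phi, test_function U phi ->
       u (ou_transpose phi) = \int[lebesgue n]_(x in U) (g x * phi x)) ->
    exists2 f : 'cV[R]_n -> R, smooth_on U f &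
      forall phi, test_function U phi ->
        u phi = \int[lebesgue n]_(x in U) (f x * phi x).

Definition expmx (A : 'M[R]_n) : 'M[R]_n :=
  limn (series (fun k => (k`!%:R)^-1 *: A ^+ k)).

(* Q_t *)
Definition ou_cov (t : R) : 'M[R]_n :=
  \matrix_(i, j) \int[lebesgue_measure]_(s in `[0, t])
    ((expmx (s *: B) *m Q *m (expmx (s *: B))^T) i j).

Definition quad_form (A : 'M[R]_n) (x : 'cV[R]_n) : R := (x^T *m A *m x) 0 0.

(* T(t) f for real f, with T(0) = id. For t > 0 the formula requires
   det Q_t > 0, which holds when P is hypoelliptic. *)
Definition ou_markov (t : R) (f : 'cV[R]_n -> R) (x : 'cV[R]_n) : R :=
  if 0 < t then
    ((2 * pi) `^ (n%:R / 2) * Num.sqrt (\det (ou_cov t)))^-1 *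
    \int[lebesgue n]_y (expR (- 2^-1 * quad_form (invmx (ou_cov t)) y) *
                        f (expmx (t *: B) *m x - y))
  else f x.

Definition invariant_measure (mu : probability 'cV[R]_n R) : Prop :=
  forall (t : R) (f : 'cV[R]_n -> R), 0 <= t -> continuous f ->
    (exists M : R, forall x, `|f x| <= M) ->
    \int[mu]_x ou_markov t f x = \int[mu]_x f x.

(* P u = w on R^n in the sense of distributions. *)
Definition weak_ou (u w : 'cV[R]_n -> R[i]) : Prop :=
  forall phi, test_function setT phi ->
    cintegral (lebesgue n) (fun x => u x * (ou_transpose phi x)%:C%C) =
    cintegral (lebesgue n) (fun x => w x * (phi x)%:C%C).

(* S is the semigroup (e^{tP}) on L^2(mu): strongly continuous, with generator
   u |-> P u on {u in L^2(mu) : P u in L^2(mu)}, and extending the Markov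
   semigroup. *)
Record ou_semigroup (mu : probability 'cV[R]_n R)
    (S : R -> ('cV[R]_n -> R[i]) -> 'cV[R]_n -> R[i]) : Prop := {
  ou_semigroup_L2 : forall t v, 0 <= t -> L2 mu v -> L2 mu (S t v);
  ou_semigroup_linear : forall t (a : R[i]) v w,
    0 <= t -> L2 mu v -> L2 mu w ->
    S t (fun x => a * v x + w x) = (fun x => a * S t v x + S t w x) %[ae mu];
  ou_semigroup_bounded : forall t, 0 <= t ->
    exists M : R, forall v, L2 mu v ->
      (L2norm mu (S t v) <= M%:E * L2norm mu v)%E;
  ou_semigroup0 : forall v, L2 mu v -> S 0 v = v %[ae mu];
  ou_semigroupD : forall s t v, 0 <= s -> 0 <= t -> L2 mu v ->
    S (s + t) v = S s (S t v) %[ae mu];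
  ou_semigroup_continuous : forall v, L2 mu v ->
    L2norm mu (fun x => S h v x - v x) @[h --> 0^'+] --> 0%E;
  ou_semigroup_generator : forall u w, L2 mu u -> L2 mu w ->
    (L2norm mu (fun x => (h^-1)%:C%C * (S h u x - u x) - w x) @[h --> 0^'+]
       --> 0%E) <-> weak_ou u w;
  ou_semigroup_markov : forall t (f : 'cV[R]_n -> R), 0 <= t -> continuous f ->
    (exists M : R, forall x, `|f x| <= M) ->
    S t (fun x => (f x)%:C%C) = (fun x => (ou_markov t f x)%:C%C) %[ae mu]
}.

End ornstein_uhlenbeck.

(* sigma(B): the eigenvalues of B in C; those of B and of B^T coincide, so
   the row-vector convention of eigenvalue is harmless. *)
Definition spectrum (R : realType) (n : nat) (B : 'M[R]_n) : set R[i] :=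
  [set l | eigenvalue (map_mx (real_complex R) B) l].

(* tau_0 *)
Definition spectral_gap (R : realType) (n : nat) (B : 'M[R]_n) : R :=
  inf [set complex.Re (- l) | l in spectrum B].

Definition has_density (R : realType) (n : nat)
    (mu : probability 'cV[R]_n R) (rho : 'cV[R]_n -> R) : Prop :=
  [/\ measurable_fun setT rho, forall x, 0 <= rho x &
      forall A, measurable A ->
        (mu A = \int[lebesgue n]_(x in A) (rho x)%:E)%E].

(* Main.v *)
(** Invariance tested on the constant 1 forces [det Q_t > 0] and the Gaussian
normalisation, so that T(t) maps the cosine of <xi, x> + th to
[exp (- <xi, Q_t xi> / 2)] times the cosine of <e^{tB^T} xi, x> + th.
Continuity at 0 of the characteristic function of mu bounds [<xi, Q_t xi>] in t;
on the real and imaginary parts of an eigenvector of B^T this bound and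
[det Q_1 > 0] give Re lambda < 0, and letting t go to infinity identifies mu as
the centred Gaussian of some covariance S, with S = Q_t + e^{tB} S e^{tB^T}.

The variance under mu of a sum of cosines is a power series whose terms are
squares for the entrywise powers of the Gram kernel <xi_j, S xi_k>, and applying
T(t) replaces S by A = e^{tB} S e^{tB^T} in it. Since S dominates Q_1, hence a
multiple of the identity, the decay of e^{tB} gives A <= K e^{-2 tau t} S;
together with A <= S and the Schur product theorem, every term contracts by
K e^{-2 tau t}. Sums of cosines are dense in L^2(mu), and for fixed t the
operator is bounded, so the contraction extends to L^2(mu). *)

Require Import Defs.
From HB Require Import structures.
From mathcomp Require Import all_boot all_order all_algebra.
From mathcomp Require Import complex ring lra.
From mathcomp Require Import all_classical all_reals all_analysis measurable_realfun.
Import Order.TTheory GRing.Theory Num.Theory numFieldNormedType.Exports.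
Import HBSimple HBNNSimple.
Local Open Scope classical_set_scope.
Local Open Scope ring_scope.

(** * Translation invariance *)

(** The power series of the variance is the chaos expansion in disguise: the term of degree p is the
    share of the Hermite polynomials of degree p, and degree 0 is the mean, so subtracting the mean
    removes the only term that does not decay. Two bounds on A are needed because K e^{-2 tau t} may
    exceed 1 for small t, and its p-th power is then worse than itself. An entrywise power therefore
    pays K e^{-2 tau t} for one factor only, and A <= S takes care of the others. The strict
    inequality tau < tau_0 leaves room for the polynomial factors of e^{tB}. No Jordan form is used:
    the linear factors of the characteristic polynomial are removed one at a time. No Gaussian
    integral is evaluated: Fourier transforms come from translation invariance of Lebesgue measure,
    up to a total mass that the invariance of mu normalises. Norms are handled squared, with |a +
    b|^2 <= 2 |a|^2 + 2 |b|^2 as triangle inequality; the factors lost go into C. *)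

Lemma ge0_integral_shift (R : realType) (a : R) (f : R -> \bar R) :
  measurable_fun setT f -> (forall x, (0 <= f x)%E) ->
  (\int[lebesgue_measure]_x f (x + a)%R = \int[lebesgue_measure]_x f x)%E.
Proof.
move=> mf f0.
have ma : measurable_fun [set: measurableTypeR R] (fun x : measurableTypeR R => (x + a)%R : measurableTypeR R).
  exact: measurable_funD.
(* Uniqueness of Lebesgue measure: the pushforward by the translation gives half-open intervals
   their length. *)
have E : forall A : set (measurableTypeR R), measurable A -> lebesgue_measure A = pushforward (@lebesgue_measure R) (fun x : measurableTypeR R => (x + a)%R : measurableTypeR R) A.
  pose nu : {measure set (measurableTypeR R) -> \bar R} := measure_function_pushforward__canonical__measure_function_Measure lebesgue_measure ma.
  apply: (@lebesgue_measure_unique R nu) => X [[x y] _ <-] /=.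
  rewrite /nu /pushforward /= lebesgue_measure_itv/=.
  rewrite (_ : _ @^-1` _ = `]x - a, y - a]%classic); last first.
    by apply/seteqP; split => z /=; rewrite !in_itv /= ltrBlDr lerBrDr.
  rewrite lebesgue_measure_itv/= !lte_fin ltrD2r -!EFinD; congr (if _ then _%:E else _); lra.
rewrite [RHS](eq_measure_integral (pushforward (@lebesgue_measure R) (fun x : measurableTypeR R => (x + a)%R : measurableTypeR R))); last by move=> A mA _; exact: E.
by rewrite ge0_integral_pushforward//.
Qed.

(** Tonelli's theorem read through the recursion that defines [lebesgue]; it serves the induction on
    the dimension. *)
Lemma ge0_integral_lebesgue_step (R : realType) (n : nat)
    (f : 'cV[R]_n.+1 -> \bar R) :
  measurable_fun setT f -> (forall x, (0 <= f x)%E) ->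
  (\int[lebesgue n.+1]_x f x =
   \int[lebesgue_measure]_s \int[lebesgue n]_y f (cons_cV (s, y)))%E.
Proof.
move=> mf f0.
transitivity (\int[pushforward (lebesgue_measure \x (lebesgue n))%E (@cons_cV R n)]_x f x)%E; first by [].
rewrite ge0_integral_pushforward//; last exact: measurable_cons_cV.
rewrite preimage_setT fubini_tonelli1//.
  by apply: measurableT_comp => //; exact: measurable_cons_cV.
by move=> x; exact: f0.
Qed.

Lemma cons_cVD (R : realType) (n : nat) (s : R) (y : 'cV[R]_n) (a : 'cV[R]_n.+1) :
  cons_cV (s, y) + a = cons_cV (s + a 0 0, y + dsubmx (a : 'cV[R]_(1 + n))).
Proof.
apply/matrixP => i j; rewrite ord1 mxE /cons_cV /=.
have [k|k] := @split_ordP 1 n i => ->.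
- rewrite [X in X + _](@col_mxEu _ 1 n 1) [RHS](@col_mxEu _ 1 n 1) !mxE !ord1 !mulr1n.
  by congr (_ + a _ _); apply: val_inj.
- rewrite [X in X + _](@col_mxEd _ 1 n 1) [RHS](@col_mxEd _ 1 n 1) !mxE.
  by [].
Qed.

Lemma measurable_shift_cV (R : realType) (n : nat) (b : 'cV[R]_n) :
  measurable_fun setT (fun x : 'cV[R]_n => x + b).
Proof.
apply: measurable_fun_cV => i; under eq_fun do rewrite mxE.
by apply: measurable_funD => //; exact: measurable_coord.
Qed.

(** Induction on the dimension: the tail is shifted inside the inner integral, the first coordinate
    in the outer one by the case of the line. *)
Lemma ge0_integral_shift_cV (R : realType) (n : nat) (a : 'cV[R]_n)
    (f : 'cV[R]_n -> \bar R) :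
  measurable_fun setT f -> (forall x, (0 <= f x)%E) ->
  (\int[lebesgue n]_x f (x + a)%R = \int[lebesgue n]_x f x)%E.
Proof.
elim: n a f => [|n IH] a f mf f0.
  by apply: eq_integral => x _; rewrite [a]flatmx0 addr0.
rewrite (ge0_integral_lebesgue_step _ _ _ (measurableT_comp mf (measurable_shift_cV _ _ a)) (fun x => f0 (x + a))).
rewrite (ge0_integral_lebesgue_step _ _ _ mf f0).
have -> : (\int[lebesgue_measure]_s \int[lebesgue n]_y f (cons_cV (s, y) + a)%R
  = \int[lebesgue_measure]_s \int[lebesgue n]_y f (cons_cV ((s + a 0 0)%R, y)))%E.
  apply: eq_integral => s _.
  rewrite -[RHS](IH (dsubmx (a : 'cV[R]_(1 + n)))) => [||//].
  - by apply: eq_integral => y _; rewrite cons_cVD.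
  - apply: measurableT_comp => //; apply: measurableT_comp; first exact: measurable_cons_cV.
    by apply: measurable_fun_pair.
pose g s := (\int[lebesgue n]_y f (cons_cV (s, y)))%E.
apply: (@ge0_integral_shift R (a 0 0) g).
- apply: (@measurable_fun_fubini_tonelli_F _ _ _ _ _ (lebesgue n) (fun p => f (cons_cV p))) => //.
  by apply: measurableT_comp => //; exact: measurable_cons_cV.
- by move=> s; apply: integral_ge0.
Qed.

Lemma integral_shift_cV (R : realType) (n : nat) (a : 'cV[R]_n)
    (f : 'cV[R]_n -> \bar R) :
  measurable_fun setT f ->
  (\int[lebesgue n]_x f (x + a)%R = \int[lebesgue n]_x f x)%E.
Proof.
move=> mf; rewrite [LHS]integralE [RHS]integralE.
congr (_ - _)%E.
- rewrite -[RHS](ge0_integral_shift_cV _ _ a (f^\+)%E (measurable_funepos mf)).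
    by apply: eq_integral => x _; rewrite -[RHS](congr1 (@^~ x) (funepos_comp f (fun x => x + a))).
  by move=> x; exact: funepos_ge0.
- rewrite -[RHS](ge0_integral_shift_cV _ _ a (f^\-)%E (measurable_funeneg mf)).
    by apply: eq_integral => x _; rewrite -[RHS](congr1 (@^~ x) (funeneg_comp f (fun x => x + a))).
  by move=> x; exact: funeneg_ge0.
Qed.

Lemma integrable_shift_cV (R : realType) (n : nat) (a : 'cV[R]_n)
    (f : 'cV[R]_n -> \bar R) :
  (lebesgue n).-integrable setT f ->
  (lebesgue n).-integrable setT (fun x => f (x + a)).
Proof.
move=> /integrableP[mf foo]; apply/integrableP; split.
  exact: (measurableT_comp mf (measurable_shift_cV _ _ a)).
rewrite (integral_shift_cV _ _ a (fun x => `|f x|)%E)//.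
exact: measurableT_comp.
Qed.

(** * Inner product and quadratic forms *)

Definition dot {R : realType} {n : nat} (x y : 'cV[R]_n) : R := (x^T *m y) 0 0.

Lemma dotE (R : realType) (n : nat) (x y : 'cV[R]_n) :
  dot x y = \sum_i x i 0 * y i 0.
Proof. by rewrite /dot mxE; apply: eq_bigr => i _; rewrite mxE. Qed.

Lemma dotC (R : realType) (n : nat) (x y : 'cV[R]_n) : dot x y = dot y x.
Proof. by rewrite !dotE; apply: eq_bigr => i _; rewrite mulrC. Qed.

Lemma dotDr (R : realType) (n : nat) (x y z : 'cV[R]_n) :
  dot x (y + z) = dot x y + dot x z.
Proof. by rewrite /dot mulmxDr mxE. Qed.

Lemma dotDl (R : realType) (n : nat) (x y z : 'cV[R]_n) :
  dot (x + y) z = dot x z + dot y z.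
Proof. by rewrite dotC dotDr !(dotC _ _ z). Qed.

Lemma dotZr (R : realType) (n : nat) (a : R) (x y : 'cV[R]_n) :
  dot x (a *: y) = a * dot x y.
Proof. by rewrite /dot -scalemxAr mxE. Qed.

Lemma dotZl (R : realType) (n : nat) (a : R) (x y : 'cV[R]_n) :
  dot (a *: x) y = a * dot x y.
Proof. by rewrite dotC dotZr dotC. Qed.

Lemma dotNl (R : realType) (n : nat) (x y : 'cV[R]_n) :
  dot (- x) y = - dot x y.
Proof. by rewrite -scaleN1r dotZl mulN1r. Qed.

Lemma dotNr (R : realType) (n : nat) (x y : 'cV[R]_n) :
  dot x (- y) = - dot x y.
Proof. by rewrite dotC dotNl dotC. Qed.

Lemma dot_mulmx (R : realType) (n : nat) (A : 'M[R]_n) (x y : 'cV[R]_n) :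
  dot x (A *m y) = dot (A^T *m x) y.
Proof. by rewrite /dot trmx_mul trmxK mulmxA. Qed.

Lemma dot_ge0 (R : realType) (n : nat) (x : 'cV[R]_n) : 0 <= dot x x.
Proof. by rewrite dotE sumr_ge0// => i _; rewrite -expr2 sqr_ge0. Qed.

Lemma dot_eq0 (R : realType) (n : nat) (x : 'cV[R]_n) : dot x x = 0 -> x = 0.
Proof.
move=> x0; apply/matrixP => i j; rewrite ord1 [RHS]mxE; apply/eqP; rewrite -sqrf_eq0.
move/eqP: x0; rewrite dotE psumr_eq0 => [|k _]; last by rewrite -expr2 sqr_ge0.
by move/allP/(_ i); rewrite mem_index_enum -expr2 => /(_ isT).
Qed.

Lemma dot_cauchy_schwarz (R : realType) (n : nat) (x y : 'cV[R]_n) :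
  dot x y ^+ 2 <= dot x x * dot y y.
Proof.
have := dot_ge0 _ _ y; rewrite le_eqVlt => /predU1P[/esym/dot_eq0->|y0].
  by rewrite /dot !mulmx0 mxE expr0n mulr0.
(* This squared norm expands to <y, y> times the defect in the inequality. *)
have := dot_ge0 _ _ (dot y y *: x + (- dot x y) *: y).
rewrite dotDl !dotDr !dotZl !dotZr (dotC _ _ y x).
rewrite (_ : _ + _ = dot y y * (dot x x * dot y y - dot x y ^+ 2)); last by ring.
by rewrite pmulr_rge0// subr_ge0.
Qed.

Lemma measurable_dot (R : realType) (n : nat) (x : 'cV[R]_n) :
  measurable_fun setT (dot x).
Proof.
rewrite (_ : dot x = fun y => \sum_(i <- enum 'I_n) (x i 0 * y i 0)); last first.
  by apply/funext => y; rewrite dotE big_enum.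
apply: measurable_sum => i; apply: measurable_funM => //.
exact: measurable_coord.
Qed.

Lemma quad_form_dot (R : realType) (n : nat) (A : 'M[R]_n) (y : 'cV[R]_n) :
  quad_form A y = dot y (A *m y).
Proof. by rewrite /quad_form /dot mulmxA. Qed.

Lemma measurable_quad_form (R : realType) (n : nat) (A : 'M[R]_n) :
  measurable_fun setT (quad_form A).
Proof.
rewrite (_ : quad_form A = fun y => \sum_(i <- enum 'I_n) (y i 0 * dot (row i A)^T y)); last first.
  apply/funext => y; rewrite quad_form_dot dotE big_enum/=; apply: eq_bigr => i _.
  by rewrite /dot trmxK -row_mul !mxE.
apply: measurable_sum => i; apply: measurable_funM.
  exact: measurable_coord.
exact: measurable_dot.
Qed.

(** * Fourier transform of a Gaussian *)

(** The bound is asked only for parameters near [a]: tilted Gaussians are dominated locally in the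
    tilt, not uniformly. *)
Lemma is_derive_under_integral d (Y : measurableType d) (R : realType)
    (mu : {measure set Y -> \bar R}) (f f' : R -> Y -> R) (a e : R) (G : Y -> R) :
  0 < e ->
  (forall x, `|x - a| < e -> mu.-integrable setT (EFin \o f x)) ->
  (forall x y, `|x - a| < e -> is_derive x 1 (f ^~ y) (f' x y)) ->
  mu.-integrable setT (EFin \o G) ->
  (forall x y, `|x - a| < e -> `|f' x y| <= G y) ->
  is_derive a 1 (fun x => \int[mu]_y f x y) (\int[mu]_y f' a y).
Proof.
move=> e0 intf df intG fG.
have Ia : `]a - e, a + e[%classic a by rewrite /= in_itv /=; apply/andP; split; lra.
have II x : `]a - e, a + e[%classic x -> `|x - a| < e.
  by rewrite /= in_itv /= => /andP[? ?]; rewrite ltr_norml; apply/andP; split; lra.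
have G0 y : 0 <= G y.
  by apply: le_trans (fG a y _) => //; rewrite subrr normr0.
have d1f x y : `]a - e, a + e[%classic x -> partial1of2 f x y = f' x y.
  by move=> /II xa; rewrite partial1of2E; exact: (@derive_val _ _ _ _ _ _ _ (df x y xa)).
have H1 x : `]a - e, a + e[%classic x -> mu.-integrable setT (EFin \o f x).
  by move=> /II; exact: intf.
have H2 x y : `]a - e, a + e[%classic x -> setT y -> derivable (f ^~ y) x 1.
  by move=> /II xa _; exact: (@ex_derive _ _ _ _ _ _ _ (df x y xa)).
have H3 x y : `]a - e, a + e[%classic x -> setT y -> `|partial1of2 f x y| <= G y.
  by move=> xI _; rewrite d1f//; exact/fG/II.
apply: DeriveDef.
  exact: (derivable_under_integral measurableT Ia H1 H2 G0 intG H3).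
rewrite -derive1E (differentiation_under_integral measurableT Ia H1 H2 G0 intG H3).
by apply: eq_Rintegral => y _; rewrite d1f.
Qed.

Lemma integrable_le_EFin d (Y : measurableType d) (R : realType)
    (mu : {measure set Y -> \bar R}) (f g : Y -> R) :
  measurable_fun setT f -> (forall x, `|f x| <= g x) ->
  mu.-integrable setT (EFin \o g) -> mu.-integrable setT (EFin \o f).
Proof.
move=> mf fg; apply: le_integrable => //; first exact/measurable_EFinP.
by move=> x _ /=; rewrite lee_fin (le_trans (fg x))// ler_norm.
Qed.

(** Here [A] is the inverse of the covariance, and the normalising factor is left out. *)
Definition gauss {R : realType} {n : nat} (A : 'M[R]_n) (y : 'cV[R]_n) : R :=
  expR (- 2^-1 * quad_form A y).

Lemma measurable_gauss (R : realType) (n : nat) (A : 'M[R]_n) :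
  measurable_fun setT (gauss A).
Proof.
apply: measurableT_comp => //; apply: measurable_funM => //.
exact: measurable_quad_form.
Qed.

Lemma quad_form_shift (R : realType) (n : nat) (A : 'M[R]_n) (xi eta y : 'cV[R]_n) (h : R) :
  A^T = A -> A *m eta = xi ->
  quad_form A (y + h *: eta) = quad_form A y + 2 * h * dot xi y + h ^+ 2 * dot xi eta.
Proof.
move=> As Ae; rewrite !quad_form_dot mulmxDr !dotDl !dotDr -scalemxAr Ae !dotZr !dotZl.
by rewrite (dotC _ _ y xi) (dot_mulmx _ _ _ eta) As Ae (dotC _ _ eta xi); ring.
Qed.

(** The Cameron-Martin formula: when A eta = xi, a translation along eta tilts the Gaussian by an
    exponential of <xi, y>, up to a constant. *)
Lemma gauss_shift (R : realType) (n : nat) (A : 'M[R]_n) (xi eta y : 'cV[R]_n) (h : R) :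
  A^T = A -> A *m eta = xi ->
  gauss A (y + h *: eta) =
  gauss A y * expR (- (h * dot xi y)) * expR (- (h ^+ 2 * dot xi eta / 2)).
Proof.
move=> As Ae; rewrite /gauss (quad_form_shift _ _ _ _ _ _ _ As Ae) -!expRD.
by congr expR; field.
Qed.

(** Both factors are at most e^{|u|}. The factor 1 + |u| makes room for the u that a derivative
    brings down, and the bound is free of h. *)
Lemma expR_dom (R : realType) (h u : R) : `|h| < 1 ->
  expR (- (h * u)) * (1 + `|u|) <= expR (2 * u) + expR (- (2 * u)).
Proof.
move=> h1; apply: (@le_trans _ _ (expR `|u| * expR `|u|)).
  apply: ler_pM; rewrite ?expR_ge0 ?addr_ge0 ?expR_ge1Dx// ler_expR.
  rewrite (le_trans (ler_norm _))// normrN normrM ler_piMl// ltW//.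
rewrite -expRD; have [u0|u0] := ger0P u.
  by rewrite (_ : u + u = 2 * u); [rewrite lerDl expR_ge0|ring].
by rewrite (_ : - u - u = - (2 * u)); [rewrite lerDr expR_ge0|ring].
Qed.

(** The tilted Gaussian is a constant multiple of a translate of the Gaussian, so its integrability
    follows by translation, without any coercivity of A. *)
Lemma integrable_gauss_exp (R : realType) (n : nat) (A : 'M[R]_n) (xi eta : 'cV[R]_n) (k : R) :
  A^T = A -> A *m eta = xi -> (lebesgue n).-integrable setT (EFin \o gauss A) ->
  (lebesgue n).-integrable setT (fun y => (gauss A y * expR (k * dot xi y))%:E).
Proof.
move=> As Ae intA.
rewrite (_ : (fun y => _) = (fun y => (expR (k ^+ 2 * dot xi eta / 2))%:E * (EFin \o gauss A) (y + (- k) *: eta)%R)%E).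
  apply: integrableZl => //; exact: integrable_shift_cV.
apply/funext => y /=; rewrite (gauss_shift _ _ _ _ _ _ _ As Ae) -EFinM; congr EFin.
rewrite sqrrN mulrCA -[X in _ = _ * X]expRD subrr expR0 mulr1.
by congr (_ * expR _); ring.
Qed.

Lemma integrable_gauss_dom (R : realType) (n : nat) (A : 'M[R]_n) (xi eta : 'cV[R]_n) (K : R) :
  A^T = A -> A *m eta = xi -> (lebesgue n).-integrable setT (EFin \o gauss A) ->
  (lebesgue n).-integrable setT (EFin \o (fun y =>
    K * (gauss A y * (expR (2 * dot xi y) + expR (- (2 * dot xi y)))))).
Proof.
move=> As Ae intA.
rewrite (_ : _ \o _ = (fun y => K%:E * ((gauss A y * expR (2 * dot xi y))%:E + (gauss A y * expR (- 2 * dot xi y))%:E)))%E; last first.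
  by apply/funext => y /=; rewrite -EFinD -EFinM mulNr mulrDr.
apply: integrableZl => //; apply: integrableD => //; exact: integrable_gauss_exp As Ae _.
Qed.

Lemma measurable_cos (R : realType) : measurable_fun [set: R] cos.
Proof. by apply: continuous_measurable_fun; exact: continuous_cos. Qed.

Lemma measurable_sin (R : realType) : measurable_fun [set: R] sin.
Proof. by apply: continuous_measurable_fun; exact: continuous_sin. Qed.

Section gauss_fourier.
Context (R : realType) (n : nat) (A : 'M[R]_n) (xi eta : 'cV[R]_n) (th : R).
Hypotheses (As : A^T = A) (Ae : A *m eta = xi).
Hypothesis intA : (lebesgue n).-integrable setT (EFin \o gauss A).

Let u := dot xi.
Let c := dot xi eta.
Let mu : measurable_fun setT u := measurable_dot _ _ xi.
Let mA := measurable_gauss _ _ A.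

Let mwave s (p : R) : measurable_fun setT (fun y => s * u y + p).
Proof. by apply: measurable_funD => //; apply: measurable_funM. Qed.

Let mcos s p : measurable_fun setT (fun y => cos (s * u y + p)).
Proof. by apply: measurableT_comp => //; exact: measurable_cos. Qed.

Let msin s p : measurable_fun setT (fun y => sin (s * u y + p)).
Proof. by apply: measurableT_comp => //; exact: measurable_sin. Qed.

Let le_dom (K h x : R) : `|h| < 1 -> 0 <= K ->
  forall y, `|x| <= K * (1 + `|u y|) ->
  `|gauss A y * expR (- (h * u y)) * x| <=
     K * (gauss A y * (expR (2 * u y) + expR (- (2 * u y)))).
Proof.
move=> h1 K0 y xK; rewrite !normrM !(ger0_norm (expR_ge0 _)).
rewrite (_ : K * _ = gauss A y * (K * (expR (2 * u y) + expR (- (2 * u y))))); last by ring.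
rewrite -mulrA ler_wpM2l ?expR_ge0//.
apply: (@le_trans _ _ (expR (- (h * u y)) * (K * (1 + `|u y|)))).
  by rewrite ler_wpM2l ?expR_ge0.
by rewrite mulrCA ler_wpM2l// expR_dom.
Qed.

Let normcos (x : R) : `|cos x| <= 1.
Proof. by rewrite ler_norml cos_geN1 cos_le1. Qed.

Let normsin (x : R) : `|sin x| <= 1.
Proof. by rewrite ler_norml sin_geN1 sin_le1. Qed.

Let norm1 : `|0 : R| < 1. Proof. by rewrite normr0. Qed.

Let intdom (f : 'cV[R]_n -> R) (h K : R) : measurable_fun setT f -> `|h| < 1 -> 0 <= K ->
  (forall y, `|f y| <= K * (1 + `|u y|)) ->
  (lebesgue n).-integrable setT (EFin \o (fun y => gauss A y * expR (- (h * u y)) * f y)).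
Proof.
move=> mf h1 K0 fK.
apply: integrable_le_EFin (integrable_gauss_dom _ _ _ _ _ K As Ae intA).
  apply: measurable_funM => //; apply: measurable_funM => //.
  apply: measurableT_comp => //; rewrite [X in measurable_fun _ X](_ : _ = fun y => - h * u y).
    exact: measurable_funM.
  by apply/funext => y; rewrite mulNr.
by move=> y; apply: le_dom.
Qed.

Let C (s : R) := \int[lebesgue n]_y (gauss A y * cos (s * u y + th)).

Let intdom0 (f : 'cV[R]_n -> R) (K : R) : measurable_fun setT f -> 0 <= K ->
  (forall y, `|f y| <= K * (1 + `|u y|)) ->
  (lebesgue n).-integrable setT (EFin \o (fun y => gauss A y * f y)).
Proof.
move=> mf K0 fK; have := intdom f 0 K mf norm1 K0 fK.
rewrite (_ : (fun y => _ * _ * _) = (fun y => gauss A y * f y))//.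
by apply/funext => y; rewrite mul0r oppr0 expR0 mulr1.
Qed.

Let derC (s : R) : is_derive s 1 C (- \int[lebesgue n]_y (gauss A y * (u y * sin (s * u y + th)))).
Proof.
have bs x y : `|u y * sin (x * u y + th)| <= 1 * (1 + `|u y|).
  rewrite mul1r normrM (@le_trans _ _ `|u y|) ?lerDr//.
  by rewrite ler_piMr.
have -> : - (\int[lebesgue n]_y (gauss A y * (u y * sin (s * u y + th)))) =
   \int[lebesgue n]_y (gauss A y * - (u y * sin (s * u y + th))).
  rewrite -mulN1r -RintegralZl//; last first.
    apply: (@intdom0 _ 1) => //; apply: measurable_funM => //.
  by apply: eq_Rintegral => y _; ring.
apply: (@is_derive_under_integral _ _ _ (lebesgue n) (fun s y => gauss A y * cos (s * u y + th))
  (fun s y => gauss A y * - (u y * sin (s * u y + th))) s 1 _ ltr01 _ _ (integrable_gauss_dom _ _ _ _ _ 1 As Ae intA)).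
- move=> x _; apply: (@intdom0 _ 1) => // y.
  by rewrite mul1r (le_trans (normcos _))// lerDl.
- move=> x y _.
  apply: is_derive_eq; rewrite /GRing.scale /=; ring.
- move=> x y _; have := le_dom 1 0 (- (u y * sin (x * u y + th))) norm1 ler01 y.
  by rewrite mul0r oppr0 expR0 mulr1; apply; rewrite normrN.
Qed.

(* Integration by parts in the direction eta, as the derivative at h = 0 of
   the integral after the translation by h eta. *)
Let gauss_by_parts (s : R) :
  \int[lebesgue n]_y (gauss A y * (u y * sin (s * u y + th))) =
  s * c * \int[lebesgue n]_y (gauss A y * cos (s * u y + th)).
Proof.
pose S := \int[lebesgue n]_y (gauss A y * sin (s * u y + th)).
pose F (h : R) := \int[lebesgue n]_y
  (gauss A y * expR (- (h * u y)) * sin (s * u y + (th + s * h * c))).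
(* Up to e^{h^2 c / 2}, the integrand of F is that of S translated by h eta: the tilt comes from the
   Gaussian and the phase s h c from the sine. *)
have FE h : F h = expR (h ^+ 2 * c / 2) * S.
  have intS : (lebesgue n).-integrable setT (EFin \o (fun y => gauss A y * sin (s * u y + th))).
    apply: (intdom0 _ 1) => // y.
    by rewrite mul1r (le_trans (normsin _))// lerDl.
  rewrite /S /Rintegral -(integral_shift_cV _ _ (h *: eta)); last first.
    by case/integrableP: intS.
  rewrite -[fine _]/(\int[lebesgue n]_y (gauss A (y + h *: eta) * sin (s * u (y + h *: eta) + th))).
  rewrite -RintegralZl//; last exact: (integrable_shift_cV _ _ _ _ intS).
  apply: eq_Rintegral => y _.
  rewrite (gauss_shift _ _ _ _ _ _ _ As Ae) /u dotDr dotZr -/c.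
  have E : expR (h ^+ 2 * c / 2) * expR (- (h ^+ 2 * c / 2)) = 1.
    by rewrite -expRD subrr expR0.
  rewrite (_ : s * (dot xi y + h * c) + th = s * dot xi y + (th + s * h * c)); last by ring.
  rewrite [RHS](_ : _ = expR (h ^+ 2 * c / 2) * expR (- (h ^+ 2 * c / 2)) *
    (gauss A y * expR (- (h * dot xi y)) * sin (s * dot xi y + (th + s * h * c)))).
    by rewrite E mul1r.
  ring.
(* The closed form is even in h, so its derivative at 0 vanishes. Differentiating the integral gives
   instead the difference of the two sides of the claim. *)
have dF1 : is_derive (0 : R) 1 F 0.
  rewrite (_ : F = fun h => expR (h ^+ 2 * c / 2) * S); last exact/funext.
  apply: is_derive_eq; rewrite /GRing.scale /=; ring.
have dF2 : is_derive (0 : R) 1 F (\int[lebesgue n]_y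
   (gauss A y * (- (u y * sin (s * u y + th)) + s * c * cos (s * u y + th)))).
  pose f' (h : R) y := gauss A y * expR (- (h * u y)) *
    (- (u y * sin (s * u y + (th + s * h * c))) + s * c * cos (s * u y + (th + s * h * c))).
  have -> : \int[lebesgue n]_y (gauss A y * (- (u y * sin (s * u y + th)) + s * c * cos (s * u y + th)))
    = \int[lebesgue n]_y (f' 0 y).
    by apply: eq_Rintegral => y _; rewrite /f' mulr0 !mul0r addr0 oppr0 expR0 mulr1.
  have bf h y : `|- (u y * sin (s * u y + (th + s * h * c))) + s * c * cos (s * u y + (th + s * h * c))|
      <= (1 + `|s * c|) * (1 + `|u y|).
    rewrite (le_trans (ler_normD _ _))// normrN !normrM.
    rewrite (@le_trans _ _ (`|u y| + `|s| * `|c|))//.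
      by apply: lerD; rewrite ler_piMr// mulr_ge0.
    have : 0 <= `|s| * `|c| * `|u y| by rewrite !mulr_ge0.
    by rewrite mulrDr mulr1 mulrDl mul1r; lra.
  apply: (@is_derive_under_integral _ _ _ (lebesgue n)
    (fun (h : R) y => gauss A y * expR (- (h * u y)) * sin (s * u y + (th + s * h * c)))
    f' 0 1 _ ltr01 _ _ (integrable_gauss_dom _ _ _ _ _ (1 + `|s * c|) As Ae intA)).
  - move=> x; rewrite subr0 => x1; apply: (@intdom _ _ 1) => // y.
    by rewrite mul1r (le_trans (normsin _))// lerDl.
  - move=> x y _.
    apply: is_derive_eq; rewrite /f' /GRing.scale /=; ring.
  - move=> x y; rewrite subr0 => x1; apply: le_dom; [exact: x1|by rewrite addr_ge0|exact: bf].
have := @derive_val _ _ _ _ _ _ _ dF1; rewrite (@derive_val _ _ _ _ _ _ _ dF2).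
have i1 : (lebesgue n).-integrable setT (EFin \o (fun y => gauss A y * (u y * sin (s * u y + th)))).
  apply: (@intdom0 _ 1) => [|//|y]; first exact: measurable_funM.
  rewrite mul1r normrM (@le_trans _ _ `|u y|) ?lerDr//.
  by rewrite ler_piMr.
have i2 : (lebesgue n).-integrable setT (EFin \o (fun y => gauss A y * cos (s * u y + th))).
  apply: (@intdom0 _ 1) => // y.
  by rewrite mul1r (le_trans (normcos _))// lerDl.
rewrite (_ : Rintegral _ _ _ = \int[lebesgue n]_y
  (s * c * (gauss A y * cos (s * u y + th)) - gauss A y * (u y * sin (s * u y + th)))); last first.
  by apply: eq_Rintegral => y _; ring.
have i3 : (lebesgue n).-integrable setT (EFin \o (fun y => s * c * (gauss A y * cos (s * u y + th)))).
  rewrite (_ : _ \o _ = fun y => (s * c)%:E * (EFin \o (fun y => gauss A y * cos (s * u y + th))%R) y)%E.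
    exact: integrableZl.
  by apply/funext => y /=; rewrite EFinM.
by rewrite RintegralB// RintegralZl// => /subr0_eq.
Qed.

(** By parts, C' = - s c C, so C(s) e^{s^2 c / 2} is constant; comparing s = 1 with s = 0 gives the
    formula. The total mass remains as an unknown factor. *)
Lemma gauss_fourier : \int[lebesgue n]_y (gauss A y * cos (dot xi y + th)) =
  expR (- 2^-1 * dot xi eta) * cos th * \int[lebesgue n]_y gauss A y.
Proof.
have dC (s : R) : is_derive s 1 C (- (s * c * C s)).
  by rewrite -gauss_by_parts; exact: derC.
have dCE (s : R) : is_derive s 1 (fun s => C s * expR (s ^+ 2 * c / 2)) 0.
  have := dC s => ?.
  by apply: is_derive_eq; rewrite /GRing.scale /=; field.
have := @is_derive_0_is_cst R _ 1 0 dCE.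
rewrite expr0n expr1n !mul0r expR0 mulr1 mul1r.
rewrite [X in X * _](_ : C 1 = \int[lebesgue n]_y (gauss A y * cos (dot xi y + th))); last first.
  by apply: eq_Rintegral => y _; rewrite mul1r.
rewrite [X in _ = X](_ : C 0 = \int[lebesgue n]_y gauss A y * cos th); last first.
  rewrite -RintegralZr//.
  by apply: eq_Rintegral => y _; rewrite mul0r add0r.
move=> H; have Ep : expR (- 2^-1 * dot xi eta) * expR (c / 2) = 1.
  by rewrite -expRD (_ : _ + _ = 0) ?expR0// /c; field.
apply: (@mulIf _ (expR (c / 2))); first by rewrite gt_eqF// expR_gt0.
by rewrite H; move: Ep => /(congr1 (fun x => x * (\int[lebesgue n]_y gauss A y * cos th))); rewrite mul1r => <-; ring.
Qed.

End gauss_fourier.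

(** * Decay of the matrix exponential *)

Lemma cvg_sum_ord (R : realType) (n : nat) (f : 'I_n -> nat -> R) (l : 'I_n -> R) :
  (forall i, f i k @[k --> \oo] --> l i) ->
  (\sum_i f i k) @[k --> \oo] --> \sum_i l i.
Proof.
by move=> fl; apply: cvg_big => //; exact: add_continuous.
Qed.

Lemma cvg_mx_entry (R : realType) (m n : nat) (u : nat -> 'M[R]_(m, n)) (L : 'M[R]_(m, n)) :
  (forall i j, u k i j @[k --> \oo] --> L i j) -> u k @[k --> \oo] --> L.
Proof.
move=> uL; apply/cvg_ballP => e e0.
suff : \forall k \near \oo, forall i j, ball (L i j) e (u k i j).
  by apply: filterS => k Hk; split.
apply: filter_forall => i; apply: filter_forall => j.
by move/cvg_ballP : (uL i j) => /(_ e e0).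
Qed.

Lemma mx_exprZn (R : realType) (n : nat) (t : R) (A : 'M[R]_n) k :
  (t *: A) ^+ k = t ^+ k *: A ^+ k.
Proof.
elim: k => [|k IH]; first by rewrite !expr0 scale1r.
by rewrite !exprS IH -!mulmxE -scalemxAl -scalemxAr scalerA.
Qed.

Lemma mx_expr_entry_le (R : realType) (n : nat) (A : 'M[R]_n) :
  exists2 K : R, 0 <= K & forall k i j, `|(A ^+ k) i j| <= K ^+ k.
Proof.
pose K := \sum_i \sum_j `|A i j|.
have K0 : 0 <= K by rewrite sumr_ge0// => i _; rewrite sumr_ge0.
exists K => //; elim=> [|k IH] i j.
  by rewrite !expr0 mxE; case: eqVneq => _; rewrite ?normr1 ?normr0.
rewrite exprS -mulmxE mxE (le_trans (ler_norm_sum _ _ _))//.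
apply: (@le_trans _ _ (\sum_l `|A i l| * K ^+ k)).
  by apply: ler_sum => l _; rewrite normrM ler_wpM2l.
rewrite -mulr_suml exprS ler_wpM2r ?exprn_ge0//.
by rewrite /K [leRHS](bigD1 i)//= lerDl sumr_ge0// => l _; rewrite sumr_ge0.
Qed.

Lemma is_cvg_exp_pseries (R : realType) (a : nat -> R) (M K x : R) :
  0 <= K -> (forall k, `|a k| <= M * K ^+ k) ->
  cvgn (pseries (fun k => (k`!%:R)^-1 * a k) x).
Proof.
move=> K0 aK; apply: normed_cvg.
have M0 : 0 <= M by have := le_trans (normr_ge0 _) (aK 0); rewrite expr0 mulr1.
apply: (@series_le_cvg _ _ (fun k => M * exp_coeff (K * `|x|) k)) => [k|k|k|].
- exact: normr_ge0.
- by rewrite mulr_ge0// exp_coeff_ge0// mulr_ge0.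
- rewrite /= /exp_coeff /= !normrM normrX (ger0_norm (_ : 0 <= (k`!%:R)^-1)) ?invr_ge0//.
  rewrite exprMn mulrA mulrA -mulrA [leRHS](_ : _ = k`!%:R^-1 * (M * K ^+ k * `|x| ^+ k)); last by ring.
  by rewrite ler_wpM2l ?invr_ge0// ler_wpM2r ?exprn_ge0.
- apply: is_cvg_seriesZ; exact: is_cvg_series_exp_coeff.
Qed.

(** Reduces e^{tB} to scalar power series in t, one per entry, so that termwise differentiation
    applies. *)
Lemma expmx_cvg (R : realType) (n : nat) (B : 'M[R]_n) (t : R) i j :
  pseries (fun k => (k`!%:R)^-1 * (B ^+ k) i j) t @ \oo --> expmx (t *: B) i j.
Proof.
have [K K0 BK] := mx_expr_entry_le _ _ B.
have cv i' j' : cvgn (pseries (fun k => (k`!%:R)^-1 * (B ^+ k) i' j') t).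
  by apply: (@is_cvg_exp_pseries _ _ 1 K) => // k; rewrite mul1r.
pose L : 'M[R]_n := \matrix_(i', j') limn (pseries (fun k => (k`!%:R)^-1 * (B ^+ k) i' j') t).
suff -> : expmx (t *: B) = L by rewrite mxE; exact: cv.
apply: cvg_lim => //; apply: cvg_mx_entry => i' j'; rewrite mxE.
rewrite [X in X @ _ --> _](_ : _ = pseries (fun k => (k`!%:R)^-1 * (B ^+ k) i' j') t); first exact: cv.
apply/funext => k; rewrite /pseries /series /= summxE; apply: eq_bigr => l _.
by rewrite mx_exprZn !mxE; ring.
Qed.

Lemma expmx0 (R : realType) (n : nat) (B : 'M[R]_n) : expmx (0 *: B) = 1%:M.
Proof.
apply/matrixP => i j.
apply: (cvg_unique _ (expmx_cvg _ _ B 0 i j)) => //.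
apply: (@cvg_near_cst _ _ _ _ _) => //; exists 1 => // k /= k0.
rewrite /pseries /series /= (big_ltn k0) !expr0 fact0 invr1 mul1r mulr1.
rewrite big1_seq ?addr0//= => l.
rewrite mem_index_iota => /andP[l0 _].
by rewrite expr0n gtn_eqF// mulr0.
Qed.

(** The derivative, B e^{tB} and e^{tB} B are all entrywise sums of the series with coefficients
    B^{k+1} / k!, hence the joint statement. *)
Lemma is_derive_expmx (R : realType) (n : nat) (B : 'M[R]_n) (t : R) i j :
  is_derive t 1 (fun s => expmx (s *: B) i j) ((B *m expmx (t *: B)) i j) /\
  B *m expmx (t *: B) = expmx (t *: B) *m B.
Proof.
have [K K0 BK] := mx_expr_entry_le _ _ B.
have lim2 i' j' : pseries (fun k => (k`!%:R)^-1 * (B ^+ k.+1) i' j') t @ \oo --> (B *m expmx (t *: B)) i' j'.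
  rewrite mxE [X in X @ _ --> _](_ : _ = fun N => \sum_l B i' l * pseries (fun k => (k`!%:R)^-1 * (B ^+ k) l j') t N).
    apply: cvg_sum_ord => l; apply: cvgMr; exact: expmx_cvg.
  apply/funext => N; rewrite /pseries /series /=; under [RHS]eq_bigr do rewrite mulr_sumr.
  rewrite exchange_big/=; apply: eq_bigr => k _.
  rewrite exprS -mulmxE mxE mulr_sumr mulr_suml; apply: eq_bigr => l _; ring.
have lim3 i' j' : pseries (fun k => (k`!%:R)^-1 * (B ^+ k.+1) i' j') t @ \oo --> (expmx (t *: B) *m B) i' j'.
  rewrite mxE [X in X @ _ --> _](_ : _ = fun N => \sum_l pseries (fun k => (k`!%:R)^-1 * (B ^+ k) i' l) t N * B l j').
    apply: cvg_sum_ord => l; apply: cvgMl; exact: expmx_cvg.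
  apply/funext => N; rewrite /pseries /series /=; under [RHS]eq_bigr do rewrite mulr_suml.
  rewrite exchange_big/=; apply: eq_bigr => k _.
  rewrite exprSr -mulmxE mxE mulr_sumr mulr_suml; apply: eq_bigr => l _; ring.
split; last by apply/matrixP => i' j'; exact: (cvg_unique _ (lim2 i' j') (lim3 i' j')).
have E (c : nat -> R) : pseries_diffs (fun l => (l`!%:R)^-1 * c l) = fun k => (k`!%:R)^-1 * c k.+1.
  by apply/funext => k; rewrite /pseries_diffs factS natrM invfM -mulrA mulVKf// pnatr_eq0.
have H := @pseries_snd_diffs R (fun k => (k`!%:R)^-1 * (B ^+ k) i j) (`|t| + 1) t.
rewrite (_ : (fun s => expmx (s *: B) i j) = fun s => limn (pseries (fun k => (k`!%:R)^-1 * (B ^+ k) i j) s)); last first.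
  by apply/funext => s; apply/esym/cvg_lim => //; exact: expmx_cvg.
rewrite (_ : (B *m _) i j = limn (pseries (pseries_diffs (fun k => (k`!%:R)^-1 * (B ^+ k) i j)) t)); last first.
  by apply/esym/cvg_lim => //; rewrite E; exact: lim2.
apply: H.
- by apply: (@is_cvg_exp_pseries _ _ 1 K) => // k; rewrite mul1r.
- by rewrite E; apply: (@is_cvg_exp_pseries _ _ K K) => // k; rewrite -exprS.
- by rewrite !E; apply: (@is_cvg_exp_pseries _ _ (K ^+ 2) K) => // k; rewrite -exprD.
- by rewrite [ltRHS]ger0_norm ?addr_ge0// ltrDl.
Qed.

Lemma is_derive_mul_expmx (R : realType) (n m : nat) (X : 'M[R]_(m, n)) (B : 'M[R]_n) (t : R) i j :
  is_derive t 1 (fun s => (X *m expmx (s *: B)) i j) ((X *m B *m expmx (t *: B)) i j).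
Proof.
rewrite (_ : (fun s => _) = \sum_l (fun s => X i l * expmx (s *: B) l j)); last first.
  by apply/funext => s; rewrite mxE fct_sumE.
have D l : is_derive t 1 (fun s => X i l * expmx (s *: B) l j) (X i l * (B *m expmx (t *: B)) l j).
  have [H _] := is_derive_expmx _ _ B t l j.
  by apply: is_derive_eq; rewrite /GRing.scale /=; ring.
rewrite -mulmxA mxE; exact: is_derive_sum.
Qed.

Lemma le_of_derive_le0 (R : realType) (f df : R -> R) (t : R) :
  (forall x : R, is_derive x 1 f (df x)) -> (forall x : R, 0 <= x -> df x <= 0) ->
  0 <= t -> f t <= f 0.
Proof.
move=> dff df0; rewrite le_eqVlt => /predU1P[<-//|t0].
have [c] : exists2 c, c \in `]0, t[ & f t - f 0 = df c * (t - 0).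
  apply: MVT => // x; apply: derivable_within_continuous => y _.
  exact: (@ex_derive _ _ _ _ _ _ _ (dff y)).
rewrite in_itv /= subr0 => /andP[c0 _] E.
by rewrite -subr_le0 E mulr_le0_ge0 ?df0// ltW.
Qed.

(* The system is z' = (al + i be) z + (f + i g) for z = a + i b. *)
Lemma planar_decay (R : realType) (al be tau C : R) (a b f g : R -> R) :
  al < - tau ->
  (forall t : R, is_derive t 1 a (al * a t - be * b t + f t)) ->
  (forall t : R, is_derive t 1 b (be * a t + al * b t + g t)) ->
  (forall t, 0 <= t -> f t ^+ 2 + g t ^+ 2 <= C * expR (- 2 * tau * t)) ->
  exists C' : R, forall t, 0 <= t -> a t ^+ 2 + b t ^+ 2 <= C' * expR (- 2 * tau * t).
Proof.
move=> altau da db fg.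
pose de := - al - tau; have de0 : 0 < de by rewrite /de; lra.
(* [ta'] is halfway between tau and - al. Young's inequality with weight [de] gives N' <= - 2 ta' N
   + (f^2 + g^2) / de. Hence N e^{2 ta' t} has derivative at most D e^{de t}, and [Phi] subtracts a
   primitive of that bound. *)
pose ta' := tau + de / 2.
pose N t := a t ^+ 2 + b t ^+ 2.
pose D := C / de.
pose Phi t := N t * expR (2 * ta' * t) - (D / de) * expR (de * t).
pose dPhi t := expR (2 * ta' * t) *
  (2 * (a t * (al * a t - be * b t + f t) + b t * (be * a t + al * b t + g t)) + 2 * ta' * N t)
  - D * expR (de * t).
have dP (t : R) : is_derive t 1 Phi (dPhi t).
  have := da t => ?; have := db t => ?.
  apply: is_derive_eq; rewrite /GRing.scale /= /dPhi /N /D.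
  by field; rewrite gt_eqF.
exists (N 0 + D / de) => t t0.
have P0 : Phi t <= Phi 0.
  apply: le_of_derive_le0 dP _ t0 => x x0; rewrite /dPhi subr_le0.
  have E : expR (de * x) = expR (2 * ta' * x) * expR (- 2 * tau * x).
    by rewrite -expRD /ta'; congr expR; field.
  rewrite E mulrCA ler_wpM2l ?expR_ge0//.
  apply: (@le_trans _ _ ((f x ^+ 2 + g x ^+ 2) / de)); last first.
    by rewrite /D mulrAC ler_pM2r ?invr_gt0//; exact: fg.
  rewrite ler_pdivlMr// /N /ta' -subr_ge0.
  rewrite (_ : _ - _ = (f x - de * a x) ^+ 2 + (g x - de * b x) ^+ 2).
    by rewrite addr_ge0 ?sqr_ge0.
  by rewrite (_ : al = - de - tau); [field|rewrite /de; ring].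
have D0 : 0 <= D.
  have := fg 0 (lexx _); rewrite mulr0 expR0 mulr1 => H.
  by rewrite divr_ge0 ?(ltW de0)//; apply: le_trans H; rewrite addr_ge0 ?sqr_ge0.
have P1 : N t * expR (2 * ta' * t) <= N 0 + (D / de) * expR (de * t).
  have : Phi 0 <= N 0.
    by rewrite /Phi !mulr0 expR0 !mulr1 gerBl divr_ge0// ltW.
  by move: P0; rewrite /Phi; lra.
have N0 : 0 <= N 0 by rewrite addr_ge0 ?sqr_ge0.
rewrite -(@ler_pM2r _ (expR (2 * ta' * t))) ?expR_gt0//.
apply: (le_trans P1).
have E : expR (- 2 * tau * t) * expR (2 * ta' * t) = expR (de * t).
  by rewrite -expRD /ta'; congr expR; field.
rewrite -[leRHS]mulrA E [leRHS]mulrDl lerD2r ler_peMr//.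
by rewrite -expR0 ler_expR mulr_ge0// ltW.
Qed.

Lemma ReD (R : realType) : {morph (@complex.Re R) : x y / x + y}.
Proof. by move=> [a b] [c d]. Qed.

Lemma ImD (R : realType) : {morph (@complex.Im R) : x y / x + y}.
Proof. by move=> [a b] [c d]. Qed.

Lemma map_Re_mulmx (R : realType) m n p (N : 'M[R[i]]_(m, n)) (B : 'M[R]_(n, p)) :
  map_mx (@complex.Re R) (N *m map_mx (real_complex R) B) = map_mx (@complex.Re R) N *m B.
Proof.
apply/matrixP => i j; rewrite !mxE (big_morph _ (@ReD R) (erefl _)).
apply: eq_bigr => l _; rewrite !mxE; case: (N i l) => a b /=; ring.
Qed.

Lemma map_Im_mulmx (R : realType) m n p (N : 'M[R[i]]_(m, n)) (B : 'M[R]_(n, p)) :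
  map_mx (@complex.Im R) (N *m map_mx (real_complex R) B) = map_mx (@complex.Im R) N *m B.
Proof.
apply/matrixP => i j; rewrite !mxE (big_morph _ (@ImD R) (erefl _)).
apply: eq_bigr => l _; rewrite !mxE; case: (N i l) => a b /=; ring.
Qed.

(* By Cayley-Hamilton the factors B - l can be peeled off one at a time: if
   N (B - l) e^{tB} decays, it is the forcing term of an equation for N e^{tB}. *)
Lemma expmx_decay_factor (R : realType) (n : nat) (B : 'M[R]_n) (tau : R) i j
    (s : seq R[i]) (N : 'M[R[i]]_n) :
  (forall l, l \in s -> complex.Re l < - tau) ->
  N *m (\prod_(l <- s) (map_mx (real_complex R) B - l%:M)) = 0 ->
  exists C : R, forall t, 0 <= t ->
    (map_mx (@complex.Re R) N *m expmx (t *: B)) i j ^+ 2 +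
    (map_mx (@complex.Im R) N *m expmx (t *: B)) i j ^+ 2 <= C * expR (- 2 * tau * t).
Proof.
elim: s N => [|l s IH] N sl.
  rewrite big_nil mulmx1 => ->; exists 0 => t t0; rewrite mul0r.
  by rewrite !mxE !big1 ?expr0n ?addr0// => k _; rewrite !mxE mul0r.
rewrite big_cons -mulmxE mulmxA => N0.
have [k ks|C HC] := IH _ _ N0; first by apply: sl; rewrite inE ks orbT.
have la : complex.Re l < - tau by apply: sl; rewrite inE eqxx.
have ReE : map_mx (@complex.Re R) (N *m (map_mx (real_complex R) B - l%:M)) =
  map_mx (@complex.Re R) N *m B - (complex.Re l *: map_mx (@complex.Re R) N
   - complex.Im l *: map_mx (@complex.Im R) N).
  rewrite mulmxBr -map_Re_mulmx mul_mx_scalar; apply/matrixP => p q; rewrite !mxE.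
  by case: l {N0 sl HC la} => x y; case: (N p q) => z w; case: (\sum_(_ < _) _) => v u /=; ring.
have ImE : map_mx (@complex.Im R) (N *m (map_mx (real_complex R) B - l%:M)) =
  map_mx (@complex.Im R) N *m B - (complex.Im l *: map_mx (@complex.Re R) N
   + complex.Re l *: map_mx (@complex.Im R) N).
  rewrite mulmxBr -map_Im_mulmx mul_mx_scalar; apply/matrixP => p q; rewrite !mxE.
  by case: l {N0 sl HC la ReE} => x y; case: (N p q) => z w; case: (\sum_(_ < _) _) => v u /=; ring.
apply: (planar_decay _ _ (complex.Im l) _ C _ _ _ _ la _ _ HC) => t.
- apply: is_derive_eq (is_derive_mul_expmx _ _ _ _ _ _ _ _) _.
  rewrite ReE [in RHS]mulmxBl [in RHS]mulmxBl -!scalemxAl !mxE; ring.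
- apply: is_derive_eq (is_derive_mul_expmx _ _ _ _ _ _ _ _) _.
  rewrite ImE [in RHS]mulmxBl [in RHS]mulmxDl -!scalemxAl !mxE; ring.
Qed.

(** The peeling starts from N = 1, where Cayley-Hamilton makes the product of all factors vanish.
    The constants of the entries are then summed into one. *)
Lemma expmx_decay (R : realType) (n : nat) (B : 'M[R]_n) (tau : R) :
  (1 <= n)%N -> (forall l, spectrum B l -> complex.Re l < - tau) ->
  exists2 C : R, 0 <= C & forall t i j, 0 <= t -> expmx (t *: B) i j ^+ 2 <= C * expR (- 2 * tau * t).
Proof.
case: n B => // n B _ sB.
pose Bc := map_mx (real_complex R) B.
have [r pr] := closed_field_poly_normal (char_poly Bc).
have rB l : l \in r -> complex.Re l < - tau.
  move=> lr; apply: sB; rewrite /spectrum /= eigenvalue_root_char pr.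
  by rewrite (monicP (char_poly_monic Bc)) scale1r root_prod_XsubC.
have CH : 1%:M *m (\prod_(l <- r) (Bc - l%:M)) = 0.
  rewrite mul1mx -(Cayley_Hamilton Bc) pr (monicP (char_poly_monic Bc)) scale1r.
  rewrite rmorph_prod; apply: eq_bigr => l _.
  by rewrite rmorphB /= horner_mx_X horner_mx_C.
have H i j : exists C : R, forall t, 0 <= t -> expmx (t *: B) i j ^+ 2 <= C * expR (- 2 * tau * t).
  have [C HC] := expmx_decay_factor _ _ B tau i j r _ rB CH.
  exists C => t t0; apply: le_trans (HC t t0).
  rewrite (_ : map_mx (@complex.Re R) 1%:M = 1%:M) ?mul1mx ?lerDl ?sqr_ge0//.
  by apply/matrixP => p q; rewrite !mxE; case: eqP.
pose C i j := projT1 (cid (H i j)).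
have HC i j : forall t, 0 <= t -> expmx (t *: B) i j ^+ 2 <= C i j * expR (- 2 * tau * t).
  exact: projT2 (cid (H i j)).
exists (\sum_i \sum_j `|C i j|); first by rewrite sumr_ge0// => i _; rewrite sumr_ge0.
move=> t i j t0; apply: (le_trans (HC i j t t0)); rewrite ler_wpM2r ?expR_ge0//.
rewrite (le_trans (ler_norm _))// (bigD1 i)//= (bigD1 j)//= -addrA lerDl.
by rewrite addr_ge0// sumr_ge0// => k _; rewrite sumr_ge0.
Qed.

(** * The Schur product theorem *)

(** Symmetry is imposed separately: over the reals it does not follow from the sign of the quadratic
    form. *)
Definition psd {R : realType} {n : nat} (A : 'M[R]_n) : Prop :=
  A^T = A /\ forall x : 'cV[R]_n, 0 <= quad_form A x.

Lemma quad_form_block (R : realType) (n : nat) (a : R) (b : 'cV[R]_n) (C : 'M[R]_n)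
    (s : R) (y : 'cV[R]_n) :
  quad_form (block_mx a%:M b^T b C : 'M[R]_(1 + n)) (col_mx s%:M y) =
  a * s ^+ 2 + 2 * s * dot b y + quad_form C y.
Proof.
rewrite quad_form_dot mul_block_col /dot tr_col_mx mul_row_col mxE.
rewrite -scalar_mxM [b *m _]mul_mx_scalar tr_scalar_mx mul_scalar_mx.
rewrite -[X in _ + X]/(dot y (s *: b + C *m y)) dotDr dotZr -quad_form_dot.
rewrite mxE [X in s * X]mxE -[X in s * (_ + X)]/(dot b y) mxE eqxx mulr1n.
by rewrite (dotC _ _ y b) /dot; ring.
Qed.

(** Cholesky factorisation by induction on the size. A positive corner a reduces A to its Schur
    complement C - b b^T / a; a zero corner forces b = 0 and leaves C. *)
Lemma psd_factor (R : realType) (n : nat) (A : 'M[R]_n) :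
  psd A -> exists W : 'M[R]_n, A = W *m W^T.
Proof.
elim: n A => [|n IH] A [As A0].
  by exists 0; rewrite [A]flatmx0 [RHS]flatmx0.
pose a := (A : 'M[R]_(1 + n)) 0 0.
pose b := dlsubmx (A : 'M[R]_(1 + n)).
pose C := drsubmx (A : 'M[R]_(1 + n)).
have AE : A = block_mx a%:M b^T b C :> 'M[R]_(1 + n).
  rewrite -[LHS](@submxK _ 1 n 1 n) -/b -/C; congr block_mx.
    apply/matrixP => i j; rewrite !ord1 !mxE eqxx mulr1n.
    by congr (A _ _); apply: val_inj.
  by rewrite /b trmx_dlsub As.
have Cs : C^T = C by rewrite /C trmx_drsub As.
have Q0 s y : 0 <= a * s ^+ 2 + 2 * s * dot b y + quad_form C y.
  by rewrite -quad_form_block -AE.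
have C0 y : 0 <= quad_form C y.
  by have := Q0 0 y; rewrite expr0n !mulr0 mul0r !add0r.
have a0 : 0 <= a.
  by have := Q0 1 0; rewrite expr1n !quad_form_dot !mulmx0 /dot !mulmx0 mxE mulr0 !addr0 mulr1.
move: a0; rewrite le_eqVlt => /predU1P[a0|a0].
  have b0 : b = 0.
    apply: dot_eq0; apply/eqP; rewrite eq_le dot_ge0 andbT leNgt; apply/negP => bb.
    (* With a = 0 the form is affine in the first coordinate; this value makes it equal to -1. *)
    have := Q0 (- (quad_form C b + 1) / (2 * dot b b)) b.
    rewrite -a0 mul0r add0r (_ : 2 * _ * _ = - (quad_form C b + 1)); last first.
      by field; rewrite gt_eqF.
    lra.
  have [W CW] := IH C (conj Cs C0).
  exists (block_mx 0 0 0 W : 'M[R]_(1 + n)).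
  rewrite [LHS]AE -a0 b0 CW (@tr_block_mx _ 1 n 1 n) (@mulmx_block _ 1 n 1 n 1 n) !trmx0 !mul0mx !mulmx0 !addr0 add0r.
  rewrite (_ : 0%:M = 0 :> 'M[R]_1)//.
  by apply/matrixP => i j; rewrite !mxE mul0rn.
pose S := C - a^-1 *: (b *m b^T).
have S0 : psd S.
  split; first by rewrite /S linearB /= linearZ /= trmx_mul trmxK Cs.
  move=> y; have := Q0 (- dot b y / a) y.
  rewrite (_ : quad_form S y = quad_form C y - a^-1 * dot b y ^+ 2).
    by rewrite (_ : a * _ + _ = - (a^-1 * dot b y ^+ 2)) 1?addrC//; field; rewrite gt_eqF.
  rewrite !quad_form_dot /S mulmxBl dotDr -scalemxAl dotNr.
  rewrite dotZr -mulmxA (_ : b^T *m y = (dot b y)%:M); last first.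
    by apply/matrixP => i j; rewrite !ord1 [RHS]mxE eqxx mulr1n.
  by rewrite mul_mx_scalar dotZr (dotC _ _ y b) expr2.
have [W SW] := IH S S0.
have sa : Num.sqrt a != 0 by rewrite gt_eqF// sqrtr_gt0.
exists (block_mx (Num.sqrt a)%:M 0 ((Num.sqrt a)^-1 *: b) W : 'M[R]_(1 + n)).
rewrite [LHS]AE (@tr_block_mx _ 1 n 1 n) (@mulmx_block _ 1 n 1 n 1 n) !trmx0 !mul0mx !mulmx0 !addr0.
rewrite -SW tr_scalar_mx -scalar_mxM -expr2 sqr_sqrtr ?ltW// mul_scalar_mx mul_mx_scalar.
rewrite linearZ /= !scalerA mulfV// !scale1r.
rewrite -scalemxAr -scalemxAl scalerA -invfM -expr2 sqr_sqrtr ?ltW// /S.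
by rewrite addrC subrK.
Qed.

Definition psd_kernel {R : realType} {N : nat} (M : 'I_N -> 'I_N -> R) : Prop :=
  forall x : 'I_N -> R, 0 <= \sum_j \sum_k x j * x k * M j k.

Lemma psd_kernel1 (R : realType) (N : nat) : @psd_kernel R N (fun _ _ => 1).
Proof.
move=> x; rewrite (_ : \sum_j _ = (\sum_j x j) ^+ 2) ?sqr_ge0//.
rewrite expr2 mulr_suml; apply: eq_bigr => j _; rewrite mulr_sumr.
by apply: eq_bigr => k _; rewrite mulr1.
Qed.

Lemma psd_kernelD (R : realType) (N : nat) (M1 M2 : 'I_N -> 'I_N -> R) :
  psd_kernel M1 -> psd_kernel M2 -> psd_kernel (fun j k => M1 j k + M2 j k).
Proof.
move=> M10 M20 x; rewrite (_ : \sum_j _ = \sum_j \sum_k x j * x k * M1 j k +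
  \sum_j \sum_k x j * x k * M2 j k) ?addr_ge0//.
rewrite -big_split; apply: eq_bigr => j _; rewrite -big_split /=.
by apply: eq_bigr => k _; rewrite mulrDr.
Qed.

(** Writing A = W W^T splits the Gram kernel into a sum over l of rank-one kernels w_jl w_kl, and
    each of these is absorbed into the test vector x. *)
Lemma schur_product (R : realType) (n N : nat) (A : 'M[R]_n) (xi : 'I_N -> 'cV[R]_n)
    (M : 'I_N -> 'I_N -> R) :
  psd A -> psd_kernel M -> psd_kernel (fun j k => dot (xi j) (A *m xi k) * M j k).
Proof.
move=> /psd_factor[W ->] M0 x.
pose w j l := (W^T *m xi j) l 0.
rewrite (_ : \sum_j _ = \sum_l \sum_j \sum_k (x j * w j l) * (x k * w k l) * M j k).
  by apply: sumr_ge0 => l _; exact: M0.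
rewrite [RHS]exchange_big; apply: eq_bigr => j _ /=.
rewrite [RHS]exchange_big; apply: eq_bigr => k _ /=.
rewrite -mulmxA dot_mulmx dotE mulr_suml mulr_sumr; apply: eq_bigr => l _.
by rewrite /w; ring.
Qed.

Lemma psd_kernel_exp (R : realType) (n N : nat) (A : 'M[R]_n) (xi : 'I_N -> 'cV[R]_n) p :
  psd A -> psd_kernel (fun j k => dot (xi j) (A *m xi k) ^+ p).
Proof.
move=> A0; elim: p => [|p IH]; first exact: psd_kernel1.
rewrite (_ : (fun _ _ => _) = fun j k => dot (xi j) (A *m xi k) * dot (xi j) (A *m xi k) ^+ p).
  exact: schur_product.
by apply/funext => j; apply/funext => k; rewrite exprS.
Qed.

(** With entrywise powers, kappa S^{p+2} - A^{p+2} = S (kappa S^{p+1} - A^{p+1}) + (S - A) A^{p+1},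
    so kappa is spent once, in the base case. Degree 0 must be left out: there the difference is the
    constant kappa - 1. *)
Lemma psd_kernel_exp_le (R : realType) (n N : nat) (A S : 'M[R]_n) (kappa : R)
    (xi : 'I_N -> 'cV[R]_n) p :
  psd A -> psd S -> psd (S - A) -> psd (kappa *: S - A) ->
  psd_kernel (fun j k => kappa * dot (xi j) (S *m xi k) ^+ p.+1 - dot (xi j) (A *m xi k) ^+ p.+1).
Proof.
move=> A0 S0 SA kSA; elim: p => [|p IH].
  rewrite (_ : (fun _ _ => _) = fun j k => dot (xi j) ((kappa *: S - A) *m xi k) * 1).
    exact/schur_product/psd_kernel1.
  apply/funext => j; apply/funext => k; rewrite !expr1 mulmxBl dotDr -scalemxAl dotZr.
  by rewrite dotNr; ring.
rewrite (_ : (fun _ _ => _) = fun j k =>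
  dot (xi j) (S *m xi k) * (kappa * dot (xi j) (S *m xi k) ^+ p.+1 - dot (xi j) (A *m xi k) ^+ p.+1) +
  dot (xi j) ((S - A) *m xi k) * dot (xi j) (A *m xi k) ^+ p.+1).
  apply: psd_kernelD; apply: schur_product => //; exact: psd_kernel_exp.
apply/funext => j; apply/funext => k; rewrite mulmxBl dotDr.
rewrite dotNr [_ ^+ p.+2]exprS [dot _ (A *m _) ^+ p.+2]exprS; ring.
Qed.

(* The variance of [sum_j a_j cos(<xi_j, x> + th_j)] under the centred Gaussian
   of covariance S, for [d_j = a_j exp(- <xi_j, S xi_j> / 2)] and
   [M j k = <xi_j, S xi_k>]. *)
Definition wave_variance {R : realType} {N : nat} (d th : 'I_N -> R)
    (M : 'I_N -> 'I_N -> R) : R :=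
  \sum_j \sum_k d j * d k *
    (2^-1 * (cos (th j - th k) * (expR (M j k) - 1) + cos (th j + th k) * (expR (- M j k) - 1))).

(** In degree p the two exponentials contribute cos(th_j - th_k) + (-1)^p cos(th_j + th_k), which is
    2 cos cos for even p and 2 sin sin for odd p. The phases thus factor into the weights, each
    degree is a quadratic form in the entrywise p-th power of the kernel, and the comparison passes
    from partial sums to the limit. *)
Lemma le_wave_variance (R : realType) (n N : nat) (A S : 'M[R]_n) (kappa : R)
    (xi : 'I_N -> 'cV[R]_n) (d th : 'I_N -> R) :
  psd A -> psd S -> psd (S - A) -> psd (kappa *: S - A) ->
  wave_variance d th (fun j k => dot (xi j) (A *m xi k)) <=
  kappa * wave_variance d th (fun j k => dot (xi j) (S *m xi k)).
Proof.
move=> A0 S0 SA kSA.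
(* The shift to [K.+1] makes [E K] the sum of the terms of degree 1 to K, so that [E 0] vanishes. *)
pose E K (x : R) := series (exp_coeff x) K.+1 - 1.
pose V (M : 'I_N -> 'I_N -> R) K := \sum_j \sum_k d j * d k *
    (2^-1 * (cos (th j - th k) * E K (M j k) + cos (th j + th k) * E K (- M j k))).
have cE x : E K x @[K --> \oo] --> expR x - 1.
  apply: cvgB; last exact: cvg_cst.
  by rewrite (cvg_shiftS (series (exp_coeff x))); exact: is_cvg_series_exp_coeff.
have cV M : V M K @[K --> \oo] --> wave_variance d th M.
  apply: cvg_sum_ord => j; apply: cvg_sum_ord => k.
  apply: cvgMr; apply: cvgMr; apply: cvgD; apply: cvgMr; exact: cE.
have VS M K : V M K.+1 = V M K + (K.+1`!%:R)^-1 * \sum_j \sum_k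
    (if odd K.+1 then (d j * sin (th j)) * (d k * sin (th k)) * M j k ^+ K.+1
     else (d j * cos (th j)) * (d k * cos (th k)) * M j k ^+ K.+1).
  rewrite mulr_sumr -big_split; apply: eq_bigr => j _ /=.
  rewrite mulr_sumr -big_split; apply: eq_bigr => k _ /=.
  have ES x : E K.+1 x = E K x + K.+1`!%:R^-1 * x ^+ K.+1.
    by rewrite /E /series /= big_nat_recr//= /exp_coeff/=; ring.
  rewrite !ES exprNn cosB cosD -signr_odd.
  move: (K.+1`!%:R^-1 : R) (M j k ^+ K.+1) (E K (M j k)) (E K (- M j k)) => f m e1 e2.
  rewrite /=; case: (~~ odd K) => /=.
    by rewrite expr1; field.
  by rewrite expr0; field.
have le_V K : V (fun j k => dot (xi j) (A *m xi k)) K <=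
     kappa * V (fun j k => dot (xi j) (S *m xi k)) K.
  elim: K => [|K IH].
    have V0 M : V M 0 = 0.
      rewrite /V big1// => j _; rewrite big1// => k _.
      have E0 x : E 0 x = 0 by rewrite /E /series /= big_nat1 /exp_coeff /= expr0 fact0 divr1 subrr.
      by rewrite !E0 !mulr0 addr0 !mulr0.
    by rewrite !V0 mulr0.
  rewrite !VS mulrDr lerD// mulrCA ler_wpM2l ?invr_ge0//.
  rewrite -subr_ge0 mulr_sumr -sumrB.
  case: (odd K.+1).
  - rewrite (_ : \sum_j _ = \sum_j \sum_k (d j * sin (th j)) * (d k * sin (th k)) *
     (kappa * dot (xi j) (S *m xi k) ^+ K.+1 - dot (xi j) (A *m xi k) ^+ K.+1)).
      exact: psd_kernel_exp_le.
    apply: eq_bigr => j _; rewrite mulr_sumr -sumrB; apply: eq_bigr => k _; ring.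
  - rewrite (_ : \sum_j _ = \sum_j \sum_k (d j * cos (th j)) * (d k * cos (th k)) *
     (kappa * dot (xi j) (S *m xi k) ^+ K.+1 - dot (xi j) (A *m xi k) ^+ K.+1)).
      exact: psd_kernel_exp_le.
    apply: eq_bigr => j _; rewrite mulr_sumr -sumrB; apply: eq_bigr => k _; ring.
apply: ler_cvg_to (cV _) _ _; first by apply: cvgMr; exact: cV.
exact: nearW.
Qed.

(** * The covariance matrices Q_t *)

Lemma Rintegral_sum d (T : measurableType d) (R : realType) (mu : {measure set T -> \bar R})
    (D : set T) (I : Type) (r : seq I) (f : I -> T -> R) :
  measurable D -> (forall i, mu.-integrable D (EFin \o f i)) ->
  mu.-integrable D (EFin \o (fun x => \sum_(i <- r) f i x)) /\
  \int[mu]_(x in D) (\sum_(i <- r) f i x) = \sum_(i <- r) \int[mu]_(x in D) f i x.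
Proof.
move=> mD intf; elim: r => [|i r [IH1 IH2]].
  rewrite big_nil; split.
    apply: (eq_integrable mD (cst 0%E)); last exact: integrable0.
    by move=> x _ /=; rewrite big_nil.
  under eq_Rintegral do rewrite big_nil.
  by rewrite Rintegral_cst// mul0r.
rewrite big_cons -IH2 -RintegralD//; split.
  apply: (eq_integrable mD (fun x => (f i x)%:E + (\sum_(i <- r) f i x)%R%:E)%E).
    by move=> x _ /=; rewrite big_cons EFinD.
  exact: (integrableD mD (intf i) IH1).
by apply: eq_Rintegral => x _; rewrite big_cons.
Qed.

Lemma dot_mulmx_le (R : realType) (n : nat) (L : 'M[R]_n) (e : R) (x : 'cV[R]_n) :
  (forall i j, L i j ^+ 2 <= e) ->
  dot (L *m x) (L *m x) <= (n%:R * n%:R * e) * dot x x.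
Proof.
move=> Le; rewrite [leLHS]dotE.
apply: (@le_trans _ _ (\sum_(i < n) (n%:R * e * dot x x))); last first.
  by rewrite sumr_const card_ord -[leLHS]mulr_natl !mulrA.
apply: ler_sum => i _; rewrite -expr2.
have -> : (L *m x) i 0 = dot (row i L)^T x.
  by rewrite /dot trmxK -row_mul [RHS]mxE.
rewrite (le_trans (dot_cauchy_schwarz _ _ _ _))// ler_wpM2r ?dot_ge0//.
rewrite dotE (@le_trans _ _ (\sum_(i < n) e))//.
  by apply: ler_sum => j _; rewrite !mxE -expr2.
by rewrite sumr_const card_ord -[leLHS]mulr_natl.
Qed.

Lemma dot_mulmx_bounded (R : realType) (n : nat) (L : 'M[R]_n) :
  exists2 K : R, 0 < K & forall x : 'cV[R]_n, dot (L *m x) (L *m x) <= K * dot x x.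
Proof.
pose e := \sum_i \sum_j L i j ^+ 2.
have e0 : 0 <= e by rewrite sumr_ge0// => i _; rewrite sumr_ge0// => j _; rewrite sqr_ge0.
exists (n%:R * n%:R * e + 1); first by rewrite ltr_wpDl// !mulr_ge0.
move=> x; rewrite mulrDl mul1r ler_wpDr ?dot_ge0//.
apply: dot_mulmx_le => i j; rewrite /e (bigD1 i)//= (bigD1 j)//= -addrA lerDl.
rewrite addr_ge0// sumr_ge0// => k _; rewrite ?sqr_ge0//.
by rewrite sumr_ge0// => l _; rewrite sqr_ge0.
Qed.

(** With A = W W^T, the form is |W^T x|^2, and x is recovered by the inverse of W^T, which is
    bounded. *)
Lemma psd_unit_coercive (R : realType) (n : nat) (A : 'M[R]_n) :
  psd A -> A \in unitmx ->
  exists2 K : R, 0 < K & forall x : 'cV[R]_n, dot x x <= K * quad_form A x.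
Proof.
move=> /psd_factor[W AW] Au.
have Wu : W^T \in unitmx.
  by move: Au; rewrite AW unitmx_mul => /andP[].
have [K K0 HK] := dot_mulmx_bounded _ _ (invmx W^T).
exists K => // x; rewrite quad_form_dot AW -mulmxA dot_mulmx.
by have := HK (W^T *m x); rewrite mulKmx.
Qed.

Lemma psd_bounded (R : realType) (n : nat) (A : 'M[R]_n) :
  psd A -> exists2 K : R, 0 < K & forall x : 'cV[R]_n, quad_form A x <= K * dot x x.
Proof.
move=> /psd_factor[W AW]; have [K K0 HK] := dot_mulmx_bounded _ _ W^T.
by exists K => // x; rewrite quad_form_dot AW -mulmxA dot_mulmx.
Qed.

Lemma continuous_sum_ord (R : realType) (T : topologicalType) (n : nat) (f : 'I_n -> T -> R) :
  (forall i, continuous (f i)) -> continuous (fun x => \sum_i f i x).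
Proof.
move=> cf x; apply: cvg_big => //; first exact: add_continuous.
by move=> i _; exact: cf.
Qed.

Lemma continuous_expmx (R : realType) (n : nat) (B : 'M[R]_n) i j :
  continuous (fun s : R => expmx (s *: B) i j).
Proof.
move=> s; have [H _] := is_derive_expmx _ _ B s i j.
by apply: differentiable_continuous; apply/derivable1_diffP; exact: (@ex_derive _ _ _ _ _ _ _ H).
Qed.

Lemma quad_formE (R : realType) (n : nat) (A : 'M[R]_n) (x : 'cV[R]_n) :
  quad_form A x = \sum_i \sum_j x i 0 * x j 0 * A i j.
Proof.
rewrite quad_form_dot dotE; apply: eq_bigr => i _; rewrite mxE mulr_sumr.
by apply: eq_bigr => j _; ring.
Qed.

Lemma continuous_ou_cov_integrand (R : realType) (n : nat) (Q B : 'M[R]_n) i j :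
  continuous (fun s : R => (expmx (s *: B) *m Q *m (expmx (s *: B))^T) i j).
Proof.
rewrite (_ : (fun s => _) = fun s : R => \sum_k (\sum_l expmx (s *: B) i l * Q l k) * expmx (s *: B) j k); last first.
  by apply/funext => s; rewrite mxE; apply: eq_bigr => k _; rewrite !mxE.
have C1 k : continuous (fun s : R => \sum_l expmx (s *: B) i l * Q l k).
  apply: continuous_sum_ord => l s.
  by apply: cvgM; [exact: continuous_expmx|exact: cvg_cst].
apply: continuous_sum_ord => k s; apply: cvgM; first exact: C1.
exact: continuous_expmx.
Qed.

Lemma integrable_itv_continuous (R : realType) (f : R -> R) (a b : R) :
  continuous f -> lebesgue_measure.-integrable `[a, b] (EFin \o f).
Proof.
move=> cf; apply: continuous_compact_integrable; first exact: segment_compact.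
exact: continuous_subspaceT.
Qed.

Lemma quad_form_ou_cov (R : realType) (n : nat) (Q B : 'M[R]_n) (t : R) (x : 'cV[R]_n) :
  quad_form (ou_cov Q B t) x =
  \int[lebesgue_measure]_(s in `[0, t]) quad_form Q ((expmx (s *: B))^T *m x).
Proof.
rewrite quad_formE.
transitivity (\int[lebesgue_measure]_(s in `[0, t])
  (\sum_i \sum_j x i 0 * x j 0 * (expmx (s *: B) *m Q *m (expmx (s *: B))^T) i j)); last first.
  apply: eq_Rintegral => s _; rewrite -quad_formE !quad_form_dot -!mulmxA.
  by rewrite [LHS]dot_mulmx.
have int1 i j : lebesgue_measure.-integrable `[0, t] (EFin \o (fun s : R => x i 0 * x j 0 * (expmx (s *: B) *m Q *m (expmx (s *: B))^T) i j)).
  apply: integrable_itv_continuous => s; apply: cvgMr; exact: continuous_ou_cov_integrand.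
have mI : measurable (`[0, t]%classic : set (measurableTypeR R)) by [].
have int2 i := Rintegral_sum _ _ _ (@lebesgue_measure R) _ _ (index_enum 'I_n)
  (fun j s => x i 0 * x j 0 * (expmx (s *: B) *m Q *m (expmx (s *: B))^T) i j) mI (int1 i).
have int3 := Rintegral_sum _ _ _ (@lebesgue_measure R) _ _ (index_enum 'I_n)
  (fun i s => \sum_j x i 0 * x j 0 * (expmx (s *: B) *m Q *m (expmx (s *: B))^T) i j) mI
  (fun i => (int2 i).1).
rewrite int3.2; apply: eq_bigr => i _; rewrite (int2 i).2; apply: eq_bigr => j _.
rewrite mxE -RintegralZl//.
apply: integrable_itv_continuous; exact: continuous_ou_cov_integrand.
Qed.

Lemma continuous_quad_form_expmx (R : realType) (n : nat) (Q B : 'M[R]_n) (x : 'cV[R]_n) :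
  continuous (fun s : R => quad_form Q ((expmx (s *: B))^T *m x)).
Proof.
rewrite (_ : (fun s => _) = fun s : R => \sum_i \sum_j x i 0 * x j 0 * (expmx (s *: B) *m Q *m (expmx (s *: B))^T) i j); last first.
  apply/funext => s; rewrite -quad_formE !quad_form_dot -!mulmxA.
  by rewrite [RHS]dot_mulmx.
apply: continuous_sum_ord => i; apply: continuous_sum_ord => j s.
apply: cvgMr; exact: continuous_ou_cov_integrand.
Qed.

Lemma psd_ou_cov (R : realType) (n : nat) (Q B : 'M[R]_n) (t : R) :
  psd Q -> psd (ou_cov Q B t).
Proof.
move=> [Qs Q0]; split; last first.
  by move=> x; rewrite quad_form_ou_cov; apply: Rintegral_ge0.
apply/matrixP => i j; rewrite !mxE; apply: eq_Rintegral => s _.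
have : (expmx (s *: B) *m Q *m (expmx (s *: B))^T)^T = expmx (s *: B) *m Q *m (expmx (s *: B))^T.
  by rewrite !trmx_mul trmxK Qs mulmxA.
by move/matrixP => /(_ i j); rewrite [X in X = _ -> _]mxE.
Qed.

(** * The invariant measure *)

(** The phase replaces complex exponentials: sines are included, the family spans an algebra, and
    all integrals stay real. *)
Definition wave {R : realType} {n : nat} (xi : 'cV[R]_n) (th : R) (x : 'cV[R]_n) : R :=
  cos (dot xi x + th).

Lemma measurable_wave (R : realType) (n : nat) (xi : 'cV[R]_n) (th : R) :
  measurable_fun setT (wave xi th).
Proof.
apply: measurableT_comp; first exact: measurable_cos.
by apply: measurable_funD => //; exact: measurable_dot.
Qed.

Lemma continuous_wave (R : realType) (n : nat) (xi : 'cV[R]_n) (th : R) :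
  continuous (wave xi th).
Proof.
have cd : continuous (dot xi).
  rewrite (_ : dot xi = fun y => \sum_i xi i 0 * y i 0); last first.
    by apply/funext => y; rewrite dotE.
  apply: continuous_sum_ord => i y.
  apply: (@continuousM R _ (cst (xi i 0)) (fun z : 'cV[R]_n => z i 0)).
    exact: cst_continuous.
  exact: coord_continuous.
move=> x; apply: (@continuous_comp _ _ _ (fun x => dot xi x + th) cos); last exact: continuous_cos.
by apply: continuousD; [exact: cd|exact: cst_continuous].
Qed.

Lemma wave_le1 (R : realType) (n : nat) (xi : 'cV[R]_n) (th : R) x : `|wave xi th x| <= 1.
Proof. by rewrite ler_norml cos_geN1 cos_le1. Qed.

Lemma bounded_integrable d (T : measurableType d) (R : realType) (mu : probability T R)
    (f : T -> R) (M : R) :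
  measurable_fun setT f -> (forall x, `|f x| <= M) -> mu.-integrable setT (EFin \o f).
Proof.
move=> mf fM; apply: (integrable_le_EFin _ _ _ mu f (cst M)) => //.
exact: finite_measure_integrable_cst.
Qed.

Lemma integrable_wave (R : realType) (n : nat) (mu : probability 'cV[R]_n R) (xi : 'cV[R]_n) (th : R) :
  mu.-integrable setT (EFin \o wave xi th).
Proof.
by apply: (bounded_integrable _ _ _ _ _ 1); [exact: measurable_wave|exact: wave_le1].
Qed.

Lemma Rintegral_cst_probability d (T : measurableType d) (R : realType)
    (mu : probability T R) (r : R) : \int[mu]_x r = r.
Proof.
rewrite Rintegral_cst//; transitivity (r * fine (1%E : \bar R)); last by rewrite mulr1.
by congr (_ * fine _); exact: probability_setT.
Qed.

Lemma invariant_normalization (R : realType) (n : nat) (Q B : 'M[R]_n)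
    (mu : probability 'cV[R]_n R) (t : R) :
  invariant_measure Q B mu -> 0 < t ->
  [/\ 0 < \det (ou_cov Q B t),
      (lebesgue n).-integrable setT (EFin \o gauss (invmx (ou_cov Q B t))) &
      ((2 * pi) `^ (n%:R / 2) * Num.sqrt (\det (ou_cov Q B t)))^-1 *
      \int[lebesgue n]_y gauss (invmx (ou_cov Q B t)) y = 1].
Proof.
move=> muI t0.
have N1 : ((2 * pi) `^ (n%:R / 2) * Num.sqrt (\det (ou_cov Q B t)))^-1 *
    \int[lebesgue n]_y gauss (invmx (ou_cov Q B t)) y = 1.
  have c1 : continuous (cst 1 : 'cV[R]_n -> R) by exact: cst_continuous.
  have := muI t (cst 1) (ltW t0) c1.
  have -> : ou_markov Q B t (cst 1) = fun=>
    ((2 * pi) `^ (n%:R / 2) * Num.sqrt (\det (ou_cov Q B t)))^-1 *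
    \int[lebesgue n]_y gauss (invmx (ou_cov Q B t)) y.
    apply/funext => x; rewrite /ou_markov t0; congr (_ * _).
    by apply: eq_Rintegral => y _; rewrite /= mulr1.
  rewrite !Rintegral_cst_probability; apply.
  by exists 1 => x; rewrite normr1.
split => //.
(* If the determinant were not positive, its square root would be 0, and so would the inverse of the
   normalisation: T(t) 1 would be 0 instead of 1. *)
- rewrite ltNge; apply/negP => det0; move: N1.
  by rewrite ler0_sqrtr// mulr0 invr0 mul0r => /eqP; rewrite eq_sym oner_eq0.
- have mg := measurable_gauss _ _ (invmx (ou_cov Q B t)).
  apply/integrableP; split; first exact/measurable_EFinP.
  (* An infinite integral is turned into 0 by [fine], again contradicting T(t) 1 = 1. *)
  rewrite ltNge leye_eq; apply/negP => /eqP Ioo; move: N1.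
  rewrite /Rintegral (_ : integral _ _ _ = +oo%E) ?mulr0; last first.
    rewrite -Ioo; apply: eq_integral => y _ /=.
    by rewrite ger0_norm// /gauss expR_ge0.
  by move/eqP; rewrite eq_sym oner_eq0.
Qed.

Lemma ou_markov_wave (R : realType) (n : nat) (Q B : 'M[R]_n)
    (mu : probability 'cV[R]_n R) (t : R) (xi : 'cV[R]_n) (th : R) :
  psd Q -> invariant_measure Q B mu -> 0 < t ->
  ou_markov Q B t (wave xi th) =
  (fun x => expR (- 2^-1 * quad_form (ou_cov Q B t) xi) * wave ((expmx (t *: B))^T *m xi) th x).
Proof.
move=> Q0 muI t0; apply/funext => x.
have [det0 intG norm1] := invariant_normalization _ _ _ _ _ _ muI t0.
have Qu : ou_cov Q B t \in unitmx by rewrite unitmxE unitfE gt_eqF.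
have [Qs _] := psd_ou_cov _ _ Q B t Q0.
have As : (invmx (ou_cov Q B t))^T = invmx (ou_cov Q B t) by rewrite trmx_inv Qs.
(* The frequency is - xi because T(t) evaluates at e^{tB} x - y. *)
have Ae : invmx (ou_cov Q B t) *m (ou_cov Q B t *m - xi) = - xi by rewrite mulKmx.
rewrite /ou_markov t0.
have -> : \int[lebesgue n]_y (expR (- 2^-1 * quad_form (invmx (ou_cov Q B t)) y) *
    wave xi th (expmx (t *: B) *m x - y)) =
  \int[lebesgue n]_y (gauss (invmx (ou_cov Q B t)) y *
    cos (dot (- xi) y + (dot ((expmx (t *: B))^T *m xi) x + th))).
  apply: eq_Rintegral => y _; congr (_ * cos _).
  by rewrite dotDr dot_mulmx dotNl dotNr; ring.
rewrite (gauss_fourier _ _ _ _ _ _ As Ae intG) mulrCA norm1 mulr1; congr (expR _ * _).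
by rewrite quad_form_dot dotNl mulmxN dotNr; ring.
Qed.

(** Phases 0 and - pi / 2 give the real and imaginary parts of the characteristic function of mu. *)
Definition char_wave {R : realType} {n : nat} (mu : probability 'cV[R]_n R)
    (xi : 'cV[R]_n) (th : R) : R := \int[mu]_x wave xi th x.

Lemma char_wave_invariant (R : realType) (n : nat) (Q B : 'M[R]_n)
    (mu : probability 'cV[R]_n R) (t : R) (xi : 'cV[R]_n) (th : R) :
  psd Q -> invariant_measure Q B mu -> 0 < t ->
  char_wave mu xi th = expR (- 2^-1 * quad_form (ou_cov Q B t) xi) *
    char_wave mu ((expmx (t *: B))^T *m xi) th.
Proof.
move=> Q0 muI t0; rewrite /char_wave -RintegralZl//; last exact: integrable_wave.
rewrite -(muI t (wave xi th) (ltW t0) (@continuous_wave _ _ xi th)); last first.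
  by exists 1; exact: wave_le1.
by rewrite (ou_markov_wave _ _ _ _ _ _ _ _ Q0 muI t0).
Qed.

Lemma char_wave_le1 (R : realType) (n : nat) (mu : probability 'cV[R]_n R)
    (xi : 'cV[R]_n) (th : R) : `|char_wave mu xi th| <= 1.
Proof.
rewrite (le_trans (le_normr_Rintegral _ _))//; first exact: integrable_wave.
rewrite (@le_trans _ _ (\int[mu]_x 1))//; last first.
  by rewrite Rintegral_cst_probability.
apply: le_Rintegral => //.
- apply: (bounded_integrable _ _ _ _ _ 1) => [|x]; last by rewrite normr_id wave_le1.
  by apply: measurableT_comp => //; exact: measurable_wave.
- exact: finite_measure_integrable_cst.
- by move=> x _; exact: wave_le1.
Qed.

Lemma cvg_char_wave (R : realType) (n : nat) (mu : probability 'cV[R]_n R)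
    (xi : nat -> 'cV[R]_n) (th : R) :
  (forall x, dot (xi k) x @[k --> \oo] --> (0:R)) ->
  char_wave mu (xi k) th @[k --> \oo] --> cos th.
Proof.
move=> xi0.
have [] := @dominated_convergence _ _ _ mu setT measurableT
  (fun k => EFin \o wave (xi k) th) (cst (cos th)%:E) (EFin \o cst 1).
- by move=> k; apply/measurable_EFinP; exact: measurable_wave.
- exact: measurable_cst.
- apply: aeW => x _; apply: cvg_EFin; first exact: nearW.
  rewrite /wave -[X in _ --> cos X]add0r.
  apply: (@cvg_comp _ _ _ (fun k => dot (xi k) x + th) cos); last exact: continuous_cos.
  by apply: cvgD; [exact: xi0|exact: cvg_cst].
- exact: finite_measure_integrable_cst.
- by apply: aeW => x k _ /=; rewrite lee_fin wave_le1.
move=> _ _; rewrite integral_cst// [X in (_ * X)%E](_ : _ = 1%E) ?mule1.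
  by move=> /fine_cvg.
exact: probability_setT.
Qed.

Lemma quad_formZ (R : realType) (n : nat) (A : 'M[R]_n) (a : R) (x : 'cV[R]_n) :
  quad_form A (a *: x) = a ^+ 2 * quad_form A x.
Proof. by rewrite !quad_form_dot -scalemxAr dotZl dotZr; ring. Qed.

Lemma ou_cov_bounded (R : realType) (n : nat) (Q B : 'M[R]_n)
    (mu : probability 'cV[R]_n R) (xi : 'cV[R]_n) :
  psd Q -> invariant_measure Q B mu ->
  exists K : R, forall t : R, 0 < t -> quad_form (ou_cov Q B t) xi <= K.
Proof.
move=> Q0 muI.
have cg : char_wave mu (k.+1%:R^-1 *: xi) 0 @[k --> \oo] --> cos (0 : R).
  apply: cvg_char_wave => x.
  rewrite [X in X @ _ --> _](_ : _ = fun k : nat => k.+1%:R^-1 * dot xi x); last first.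
    by apply/funext => k; rewrite /= dotZl.
  have : (k.+1%:R^-1 * dot xi x) @[k --> \oo] --> 0 * dot xi x.
    by apply: cvgMl; exact: cvg_harmonic.
  by rewrite mul0r.
rewrite cos0 in cg.
have [m gm] : exists m : nat, 2^-1 <= char_wave mu (m.+1%:R^-1 *: xi) 0.
  have h1 : (2^-1 : R) < 1 by lra.
  have [m _ /(_ m (leqnn m)) H] := cvgr_ge _ cg _ h1.
  by exists m.
(* The index m depends on xi only. For y = <xi, Q_t xi> / (2 (m+1)^2), invariance and |[char_wave]|
   <= 1 give 1/2 <= e^{-y}, so 1 + y <= e^y <= 2 and y <= 1. *)
exists (2 * m.+1%:R ^+ 2) => t t0.
have E := char_wave_invariant _ _ _ _ _ _ (m.+1%:R^-1 *: xi) 0 Q0 muI t0.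
move: gm; rewrite E quad_formZ => gm.
set y := 2^-1 * (m.+1%:R^-1 ^+ 2 * quad_form (ou_cov Q B t) xi).
have gy : 2^-1 <= expR (- y).
  apply: (le_trans gm); rewrite [leRHS](_ : _ = expR (- y) * 1); last by rewrite mulr1.
  rewrite /y mulNr ler_wpM2l ?expR_ge0// (le_trans (ler_norm _))//.
  exact: char_wave_le1.
have : expR y <= 2.
  by rewrite -[y]opprK expRN -[leRHS]invrK lef_pV2 ?posrE ?expR_gt0 ?invr_gt0.
move=> /(le_trans (expR_ge1Dx y)) y1; have {}y1 : y <= 1 by lra.
have m0 : (m.+1%:R : R) != 0 by rewrite pnatr_eq0.
rewrite (_ : quad_form _ _ = 2 * m.+1%:R ^+ 2 * y); last by rewrite /y; field.
by rewrite ler_piMr// mulr_ge0// sqr_ge0.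
Qed.

(** The row a + i b is an eigenvector for al + i be. In the proof F + i G is e^{-(al + i be) s} (a +
    i b) e^{sB}, whose derivative vanishes. *)
Lemma expmx_eigen_rotation (R : realType) (n : nat) (B : 'M[R]_n) (a b : 'rV[R]_n) (al be s : R) :
  a *m B = al *: a - be *: b -> b *m B = be *: a + al *: b ->
  a *m expmx (s *: B) = expR (al * s) *: (cos (be * s) *: a - sin (be * s) *: b) /\
  b *m expmx (s *: B) = expR (al * s) *: (sin (be * s) *: a + cos (be * s) *: b).
Proof.
move=> aB bB.
pose p j (s : R) := (a *m expmx (s *: B)) 0 j.
pose q j (s : R) := (b *m expmx (s *: B)) 0 j.
have dp j (t : R) : is_derive t 1 (p j) (al * p j t - be * q j t).
  apply: is_derive_eq (is_derive_mul_expmx _ _ _ _ _ _ _ _) _.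
  by rewrite aB mulmxBl -!scalemxAl /p /q; move: (a *m _) (b *m _) => u v; rewrite !mxE.
have dq j (t : R) : is_derive t 1 (q j) (be * p j t + al * q j t).
  apply: is_derive_eq (is_derive_mul_expmx _ _ _ _ _ _ _ _) _.
  by rewrite bB mulmxDl -!scalemxAl /p /q; move: (a *m _) (b *m _) => u v; rewrite !mxE.
pose F j (s : R) := expR (- (al * s)) * (cos (be * s) * p j s + sin (be * s) * q j s).
pose G j (s : R) := expR (- (al * s)) * (cos (be * s) * q j s - sin (be * s) * p j s).
have FE j : F j s = a 0 j.
  have -> : F j s = F j 0.
    apply: is_derive_0_is_cst => t.
    have := dp j t => ?; have := dq j t => ?.
    by apply: is_derive_eq; rewrite /GRing.scale /=; ring.
  by rewrite /F !mulr0 oppr0 expR0 cos0 sin0 mul0r addr0 !mul1r /p expmx0 mulmx1.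
have GE j : G j s = b 0 j.
  have -> : G j s = G j 0.
    apply: is_derive_0_is_cst => t.
    have := dp j t => ?; have := dq j t => ?.
    by apply: is_derive_eq; rewrite /GRing.scale /=; ring.
  by rewrite /G !mulr0 oppr0 expR0 cos0 sin0 mul0r subr0 !mul1r /q expmx0 mulmx1.
have E : expR (al * s) * expR (- (al * s)) = 1 by rewrite -expRD subrr expR0.
have CS := cos2Dsin2 (be * s).
split; apply/rowP => j.
- rewrite -[LHS]/(p j s) !mxE -FE -GE /F /G.
  transitivity ((expR (al * s) * expR (- (al * s))) * (cos (be * s) ^+ 2 + sin (be * s) ^+ 2) * p j s).
    by rewrite E CS !mul1r.
  ring.
- rewrite -[LHS]/(q j s) !mxE -FE -GE /F /G.
  transitivity ((expR (al * s) * expR (- (al * s))) * (cos (be * s) ^+ 2 + sin (be * s) ^+ 2) * q j s).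
    by rewrite E CS !mul1r.
  ring.
Qed.

(** In the sum of the forms of Q_t at the real and imaginary parts of the eigenvector, the rotation
    drops out and the integrand is c e^{2 Re(l) s}. If Re l >= 0 the sum is at least c t; being
    bounded, it forces c = 0. Then Q_1 vanishes on both parts, which contradicts its
    invertibility. *)
Lemma spectrum_Re_lt0 (R : realType) (n : nat) (Q B : 'M[R]_n)
    (mu : probability 'cV[R]_n R) (l : R[i]) :
  psd Q -> invariant_measure Q B mu -> spectrum B l -> complex.Re l < 0.
Proof.
move=> Q0 muI /eigenvalueP[v vB v0].
pose a := map_mx (@complex.Re R) v; pose b := map_mx (@complex.Im R) v.
have aB : a *m B = complex.Re l *: a - complex.Im l *: b.
  rewrite /a -map_Re_mulmx vB; apply/matrixP => i j; rewrite !mxE.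
  by case: l {vB} => x y; case: (v i j) => z w.
have bB : b *m B = complex.Im l *: a + complex.Re l *: b.
  rewrite /b -map_Im_mulmx vB; apply/matrixP => i j; rewrite !mxE.
  by case: l {vB aB} => x y; case: (v i j) => z w /=; ring.
pose c := quad_form Q a^T + quad_form Q b^T.
have [Qs Q1] := Q0.
have intE t : quad_form (ou_cov Q B t) a^T + quad_form (ou_cov Q B t) b^T =
    \int[lebesgue_measure]_(s in `[0, t]) (expR (2 * complex.Re l * s) * c).
  rewrite !quad_form_ou_cov -RintegralD//; last 2 first.
  - by apply: integrable_itv_continuous; exact: continuous_quad_form_expmx.
  - by apply: integrable_itv_continuous; exact: continuous_quad_form_expmx.
  apply: eq_Rintegral => s _; rewrite -!trmx_mul.
  have [-> ->] := expmx_eigen_rotation _ _ _ _ _ _ _ s aB bB.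
  have tB (e c1 s1 : R) : (e *: (c1 *: a - s1 *: b))^T = e *: (c1 *: a^T - s1 *: b^T).
    by apply/matrixP => i j; rewrite !mxE.
  have tD (e c1 s1 : R) : (e *: (c1 *: a + s1 *: b))^T = e *: (c1 *: a^T + s1 *: b^T).
    by apply/matrixP => i j; rewrite !mxE.
  rewrite tB tD !quad_formZ.
  have CS := cos2Dsin2 (complex.Im l * s).
  rewrite (_ : expR (2 * complex.Re l * s) = expR (complex.Re l * s) ^+ 2); last first.
    by rewrite expr2 -expRD; congr expR; ring.
  rewrite -mulrDr; congr (_ * _); rewrite /c.
  rewrite -[LHS]mul1r.
  transitivity ((cos (complex.Im l * s) ^+ 2 + sin (complex.Im l * s) ^+ 2) *
     (quad_form Q a^T + quad_form Q b^T)); last by rewrite CS mul1r.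
  rewrite !quad_form_dot mulmxBr mulmxDr -!scalemxAr !dotDl !dotDr.
  rewrite -!scaleNr !dotZl !dotZr [dot b^T (Q *m a^T)]dot_mulmx Qs (dotC _ _ (Q *m b^T)).
  ring.
rewrite ltNge; apply/negP => l0.
have c0 : 0 <= c by rewrite addr_ge0.
have lbt t : 0 <= t -> t * c <= quad_form (ou_cov Q B t) a^T + quad_form (ou_cov Q B t) b^T.
  rewrite le_eqVlt => /predU1P[<-|t0].
    by rewrite mul0r addr_ge0//; have [] := psd_ou_cov _ _ Q B 0 Q0.
  rewrite intE (_ : t * c = \int[lebesgue_measure]_(s in `[0, t]) c); last first.
    by rewrite Rintegral_cst// /= lebesgue_measure_itv /= lte_fin t0 /= subr0 mulrC.
  apply: le_Rintegral => //.
  - by apply: integrable_itv_continuous; exact: cst_continuous.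
  - apply: integrable_itv_continuous => s; apply: cvgMl.
    apply: (@continuous_comp _ _ _ (fun s => 2 * complex.Re l * s) expR); last exact: continuous_expR.
    exact: mulrl_continuous.
  - move=> s /=; rewrite in_itv /= => /andP[s0 _].
    by rewrite ler_peMl// -expR0 ler_expR !mulr_ge0.
have [Ka HKa] := ou_cov_bounded _ _ _ _ _ a^T Q0 muI.
have [Kb HKb] := ou_cov_bounded _ _ _ _ _ b^T Q0 muI.
have cE : c = 0.
  apply/eqP; rewrite eq_le c0 andbT leNgt; apply/negP => cp.
  pose t := (`|Ka + Kb| + 1) / c.
  have t0 : 0 < t by rewrite divr_gt0// ltr_wpDl.
  have := lbt t (ltW t0); have := HKa t t0; have := HKb t t0.
  rewrite /t divfK ?gt_eqF//; have := ler_norm (Ka + Kb); lra.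
have [det0 _ _] := invariant_normalization _ _ _ _ _ _ muI (@ltr01 R).
have Qu : ou_cov Q B 1 \in unitmx by rewrite unitmxE unitfE gt_eqF.
have [K K0 HK] := psd_unit_coercive _ _ _ (psd_ou_cov _ _ Q B 1 Q0) Qu.
have ab0 : dot a^T a^T + dot b^T b^T <= 0.
  apply: (@le_trans _ _ (K * (quad_form (ou_cov Q B 1) a^T + quad_form (ou_cov Q B 1) b^T))).
    by rewrite mulrDr lerD.
  rewrite intE; under eq_Rintegral do rewrite cE mulr0.
  by rewrite Rintegral_cst// mul0r mulr0.
have a0 : a = 0.
  apply: trmx_inj; rewrite trmx0; apply: dot_eq0.
  by have := dot_ge0 _ _ a^T; have := dot_ge0 _ _ b^T; lra.
have b0 : b = 0.
  apply: trmx_inj; rewrite trmx0; apply: dot_eq0.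
  by have := dot_ge0 _ _ a^T; have := dot_ge0 _ _ b^T; lra.
move/negP: v0; apply; apply/eqP/matrixP => i j; apply/eqP.
have := congr1 (fun M : 'rV[R]_n => M i j) a0; have := congr1 (fun M : 'rV[R]_n => M i j) b0.
by rewrite !mxE; case: (v i j) => x y /= -> ->.
Qed.

(** [inf] is meaningful only on a nonempty set bounded below. The spectrum is the list of roots of a
    polynomial of degree n >= 1, hence nonempty, and its finiteness gives a positive lower bound. *)
Lemma spectral_gapP (R : realType) (n : nat) (B : 'M[R]_n) :
  (1 <= n)%N -> (forall l, spectrum B l -> complex.Re l < 0) ->
  0 < spectral_gap B /\ forall l, spectrum B l -> spectral_gap B <= - complex.Re l.
Proof.
case: n B => // n B _ sB.
pose Bc := map_mx (real_complex R) B.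
have [r pr] := closed_field_poly_normal (char_poly Bc).
have rB l : spectrum B l <-> l \in r.
  rewrite /spectrum /= eigenvalue_root_char pr.
  by rewrite (monicP (char_poly_monic Bc)) scale1r root_prod_XsubC.
have [l0 l0r] : exists l, l \in r.
  case: r pr {rB} => [|l r _]; last by exists l; rewrite inE eqxx.
  rewrite big_nil => /(congr1 (fun p : {poly R[i]} => size p)).
  by rewrite size_char_poly (monicP (char_poly_monic Bc)) scale1r size_poly1.
have ReN (l : R[i]) : complex.Re (- l) = - complex.Re l by case: l.
have [e e0 He] : exists2 e : R, 0 < e & forall l, l \in r -> e <= - complex.Re l.
  have : forall l, l \in r -> complex.Re l < 0 by move=> l /rB /sB.
  elim: r {pr rB l0r} => [|l r IH] rlt; first by exists 1.
  have [e e0 He] := IH (fun k kr => rlt k (mem_behead (s := l :: r) kr)).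
  exists (Num.min e (- complex.Re l)).
    by rewrite lt_min e0 oppr_gt0 rlt// inE eqxx.
  move=> k; rewrite inE => /predU1P[->|kr]; first by rewrite ge_min lexx orbT.
  by rewrite ge_min He.
have hlb : has_lbound [set complex.Re (- l) | l in spectrum B].
  by exists e => _ [l /rB lr <-]; rewrite ReN He.
split.
- apply: (lt_le_trans e0); apply: lb_le_inf.
    by exists (complex.Re (- l0)); exists l0 => //; exact/rB.
  by move=> _ [l /rB lr <-]; rewrite ReN He.
- by move=> l lB; apply: ge_inf => //; exists l.
Qed.

Lemma cvg_dot_expmx (R : realType) (n : nat) (B : 'M[R]_n) (tau C : R) (xi x : 'cV[R]_n) :
  0 < tau -> (forall t i j, 0 <= t -> expmx (t *: B) i j ^+ 2 <= C * expR (- 2 * tau * t)) ->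
  dot ((expmx (k.+1%:R *: B))^T *m xi) x @[k --> \oo] --> (0 : R).
Proof.
move=> tau0 EC.
pose u (k : nat) := dot ((expmx (k.+1%:R *: B))^T *m xi) x.
pose K := n%:R * n%:R * C * dot xi xi * dot x x.
have uK k : u k ^+ 2 <= K * expR (- 2 * tau) ^+ k.+1.
  rewrite (le_trans (dot_cauchy_schwarz _ _ _ _))//.
  have H : dot ((expmx (k.+1%:R *: B))^T *m xi) ((expmx (k.+1%:R *: B))^T *m xi) <=
     n%:R * n%:R * (C * expR (- 2 * tau) ^+ k.+1) * dot xi xi.
    apply: dot_mulmx_le => i j; rewrite mxE (le_trans (EC _ _ _ _))//.
    by rewrite -expRM_natr.
  rewrite (le_trans (ler_wpM2r (dot_ge0 _ _ x) H))// /K.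
  by rewrite le_eqVlt; apply/orP; left; apply/eqP; ring.
have u2 : u k ^+ 2 @[k --> \oo] --> (0 : R).
  apply: (@squeeze_cvgr _ _ _ _ (fun _ => 0) (fun k => K * expR (- 2 * tau) ^+ k.+1)).
  - by apply: nearW => k; rewrite sqr_ge0 uK.
  - exact: cvg_cst.
  - have : (K * expR (- 2 * tau) ^+ k.+1) @[k --> \oo] --> K * 0.
      apply: cvgMr; rewrite (cvg_shiftS (fun k => expR (- 2 * tau) ^+ k)).
      apply: cvg_expr; rewrite ger0_norm ?expR_ge0// -expR0 ltr_expR.
      by rewrite mulNr oppr_lt0 mulr_gt0.
    by rewrite mulr0.
apply: norm_cvg0.
rewrite (_ : (fun k => _) = fun k => Num.sqrt (u k ^+ 2)); last first.
  by apply/funext => k; rewrite sqrtr_sqr.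
have : Num.sqrt (u k ^+ 2) @[k --> \oo] --> Num.sqrt (0 : R).
  by apply: (@cvg_comp _ _ _ (fun k => u k ^+ 2) Num.sqrt); [exact: u2|exact: sqrt_continuous].
by rewrite sqrtr0.
Qed.

Lemma dot_delta_mx (R : realType) (n : nat) (M : 'M[R]_n) i j :
  dot (delta_mx i 0) (M *m delta_mx j 0) = M i j.
Proof. by rewrite /dot trmx_delta -rowE -colE !mxE. Qed.

(** As t grows, e^{tB^T} xi tends to 0, so invariance shows that <xi, Q_t xi> converges to -2 ln of
    the characteristic function. S is thus obtained as a limit of matrices Q_t, not as an integral
    over the half-line. *)
Lemma stationary_covariance (R : realType) (n : nat) (Q B : 'M[R]_n)
    (mu : probability 'cV[R]_n R) :
  (1 <= n)%N -> psd Q -> invariant_measure Q B mu ->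
  exists2 S : 'M[R]_n, psd S & forall xi th,
    char_wave mu xi th = expR (- 2^-1 * quad_form S xi) * cos th.
Proof.
move=> n1 Q0 muI.
have sB l : spectrum B l -> complex.Re l < 0 by exact: (spectrum_Re_lt0 _ _ _ _ _ _ Q0 muI).
have [g0 gl] := spectral_gapP _ _ _ n1 sB.
set g := spectral_gap B in g0 gl.
have [C C0 EC] : exists2 C : R, 0 <= C & forall t i j, 0 <= t ->
    expmx (t *: B) i j ^+ 2 <= C * expR (- 2 * (g / 2) * t).
  apply: expmx_decay => // l /gl; lra.
have g20 : 0 < g / 2 by rewrite divr_gt0.
(* Times k + 1 suffice for the limit, and they stay positive as the invariance relation for
   [char_wave] requires. *)
pose E k := expmx (k.+1%:R *: B).
have cE xi th : char_wave mu ((E k)^T *m xi) th @[k --> \oo] --> cos th.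
  by apply: cvg_char_wave => x; exact: cvg_dot_expmx g20 EC.
pose G xi := char_wave mu xi 0.
have GE xi k : G xi = expR (- 2^-1 * quad_form (ou_cov Q B k.+1%:R) xi) * G ((E k)^T *m xi).
  exact: char_wave_invariant.
have cG xi : G ((E k)^T *m xi) @[k --> \oo] --> (1 : R) by have := cE xi 0; rewrite cos0; exact.
(* Needed for the logarithm: G(xi) is an exponential times a value of G that is close to 1 for large
   k. *)
have G0 xi : 0 < G xi.
  have [k _ /(_ k (leqnn k)) H] := cvgr_gt _ (cG xi) _ (@ltr01 R).
  by rewrite (GE xi k) mulr_gt0 ?expR_gt0.
pose q xi := - 2 * ln (G xi).
have cq xi : quad_form (ou_cov Q B k.+1%:R) xi @[k --> \oo] --> q xi.
  rewrite (_ : (fun k => _) = fun k => - 2 * (ln (G xi) - ln (G ((E k)^T *m xi)))); last first.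
    apply/funext => k; rewrite [in ln (G xi)](GE xi k) lnM ?posrE ?expR_gt0//.
    by rewrite expRK; field.
  have : (- 2 * (ln (G xi) - ln (G ((E k)^T *m xi)))) @[k --> \oo] --> - 2 * (ln (G xi) - ln 1).
    apply: cvgMr; apply: cvgB; first exact: cvg_cst.
    apply: (@cvg_comp _ _ _ (fun k => G ((E k)^T *m xi)) (@ln R)); first exact: cG.
    exact: continuous_ln.
  by rewrite ln1 subr0.
pose e i : 'cV[R]_n := delta_mx i 0.
(* Polarisation, since only the limits of the quadratic forms are known so far. *)
pose S : 'M[R]_n := \matrix_(i, j) (2^-1 * (q (e i + e j) - q (e i) - q (e j))).
have cS i j : ou_cov Q B k.+1%:R i j @[k --> \oo] --> S i j.
  rewrite mxE (_ : (fun k => _) = fun k => 2^-1 *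
    (quad_form (ou_cov Q B k.+1%:R) (e i + e j) - quad_form (ou_cov Q B k.+1%:R) (e i)
     - quad_form (ou_cov Q B k.+1%:R) (e j))); last first.
    apply/funext => k; have [/matrixP/(_ i j) + _] := psd_ou_cov _ _ Q B k.+1%:R Q0.
    rewrite [LHS]mxE; move: (ou_cov Q B k.+1%:R) => M Mij.
    rewrite !quad_form_dot mulmxDr !dotDl !dotDr /e !dot_delta_mx Mij.
    by field.
  by apply: cvgMr; apply: cvgB => //; apply: cvgB.
have SE xi : quad_form S xi = q xi.
  apply: (cvg_unique _ _ (cq xi)) => //.
  rewrite quad_formE (_ : (fun k => _) = fun k => \sum_i \sum_j xi i 0 * xi j 0 * ou_cov Q B k.+1%:R i j); last first.
    by apply/funext => k; rewrite quad_formE.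
  apply: cvg_sum_ord => i; apply: cvg_sum_ord => j; apply: cvgMr; exact: cS.
have GS xi : expR (- 2^-1 * quad_form S xi) = G xi.
  by rewrite SE /q mulrA (_ : - 2^-1 * - 2 = 1) ?mul1r ?lnK ?posrE//; field.
exists S.
  split; first by apply/matrixP => i j; rewrite !mxE [e j + _]addrC [X in _ * X = _]addrAC.
  move=> xi; rewrite SE /q mulNr oppr_ge0 pmulr_rle0// ln_le0//.
  by rewrite (le_trans (ler_norm _))// char_wave_le1.
move=> xi th; rewrite GS.
(* Dividing the invariance relation for the phase th by that for the phase 0 eliminates Q_t. *)
have c1 : char_wave mu xi th @[k --> \oo] --> G xi * cos th.
  rewrite (_ : (fun k => _) = fun k => G xi / G ((E k)^T *m xi) * char_wave mu ((E k)^T *m xi) th); last first.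
    apply/funext => k; rewrite (char_wave_invariant _ _ Q B _ k.+1%:R _ _ Q0 muI)//.
    by rewrite {1}(GE xi k) mulfK// gt_eqF.
  apply: cvgM; last exact: cE.
  have : (G xi * (G ((E k)^T *m xi))^-1) @[k --> \oo] --> G xi * 1^-1.
    by apply: cvgMr; apply: cvgV => //; exact: cG.
  by rewrite invr1 mulr1.
by apply: (cvg_unique _ _ c1) => //; exact: cvg_cst.
Qed.

(** * Contraction on sums of cosines *)

Lemma stationary_covariance_split (R : realType) (n : nat) (Q B : 'M[R]_n)
    (mu : probability 'cV[R]_n R) (S : 'M[R]_n) (t : R) (xi : 'cV[R]_n) :
  psd Q -> invariant_measure Q B mu ->
  (forall xi th, char_wave mu xi th = expR (- 2^-1 * quad_form S xi) * cos th) -> 0 < t ->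
  quad_form S xi = quad_form (ou_cov Q B t) xi + quad_form S ((expmx (t *: B))^T *m xi).
Proof.
move=> Q0 muI muS t0.
have := char_wave_invariant _ _ _ _ _ _ xi 0 Q0 muI t0.
rewrite !muS cos0 !mulr1 -expRD => /expR_inj; lra.
Qed.

Lemma transported_covariance (R : realType) (n : nat) (Q B : 'M[R]_n)
    (mu : probability 'cV[R]_n R) (S : 'M[R]_n) (tau : R) :
  (1 <= n)%N -> psd Q -> invariant_measure Q B mu -> psd S ->
  (forall xi th, char_wave mu xi th = expR (- 2^-1 * quad_form S xi) * cos th) ->
  tau < spectral_gap B ->
  exists2 K : R, 0 < K & forall t, 0 < t ->
    let A := expmx (t *: B) *m S *m (expmx (t *: B))^T in
    [/\ psd A, psd (S - A) & psd ((K * expR (- 2 * tau * t)) *: S - A)].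
Proof.
move=> n1 Q0 muI S0 muS tauB.
have sB l : spectrum B l -> complex.Re l < 0 by exact: (spectrum_Re_lt0 _ _ _ _ _ _ Q0 muI).
have [g0 gl] := spectral_gapP _ _ _ n1 sB.
have [C C0 EC] : exists2 C : R, 0 <= C & forall t i j, 0 <= t ->
    expmx (t *: B) i j ^+ 2 <= C * expR (- 2 * tau * t).
  apply: expmx_decay => // l /gl; lra.
have [det0 _ _] := invariant_normalization _ _ _ _ _ _ muI (@ltr01 R).
have Qu : ou_cov Q B 1 \in unitmx by rewrite unitmxE unitfE gt_eqF.
have [K1 K10 HK1] := psd_unit_coercive _ _ _ (psd_ou_cov _ _ Q B 1 Q0) Qu.
have [K2 K20 HK2] := psd_bounded _ _ _ S0.
have [Ss S1] := S0.
have SK1 xi : dot xi xi <= K1 * quad_form S xi.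
  rewrite (le_trans (HK1 xi))// ler_wpM2l ?(ltW K10)//.
  by rewrite (stationary_covariance_split _ _ _ _ _ _ _ xi Q0 muI muS (@ltr01 R)) lerDl.
(* The product of the upper bound of S, the decay of e^{tB^T} and the coercivity of S inherited from
   Q_1; the added 1 makes it positive. *)
exists (K2 * (n%:R * n%:R * C) * K1 + 1).
  by rewrite ltr_wpDl// !mulr_ge0// ltW.
move=> t t0 A.
have As : A^T = A by rewrite /A !trmx_mul trmxK Ss mulmxA.
have AE xi : quad_form A xi = quad_form S ((expmx (t *: B))^T *m xi).
  by rewrite !quad_form_dot /A -!mulmxA [LHS]dot_mulmx.
have BE (k : R) xi : quad_form (k *: S - A) xi = k * quad_form S xi - quad_form A xi.
  by rewrite !quad_form_dot mulmxBl dotDr dotNr -scalemxAl dotZr.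
split.
- by split => // xi; rewrite AE.
- split; first by rewrite linearB /= Ss As.
  move=> xi; rewrite -[S]scale1r BE mul1r AE.
  rewrite (stationary_covariance_split _ _ _ _ _ _ _ xi Q0 muI muS t0) addrK.
  by have [] := psd_ou_cov _ _ Q B t Q0.
- split; first by rewrite linearB linearZ /= Ss As.
  move=> xi; rewrite BE AE subr_ge0 (le_trans (HK2 _))//.
  have H : dot ((expmx (t *: B))^T *m xi) ((expmx (t *: B))^T *m xi) <=
     n%:R * n%:R * (C * expR (- 2 * tau * t)) * dot xi xi.
    by apply: dot_mulmx_le => i j; rewrite mxE; apply: EC; exact: ltW.
  have e0 := expR_ge0 (- 2 * tau * t).
  apply: (le_trans (ler_wpM2l (ltW K20) H)).
  apply: (@le_trans _ _ (K2 * (n%:R * n%:R * (C * expR (- 2 * tau * t)) * (K1 * quad_form S xi)))).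
    by rewrite ler_wpM2l ?(ltW K20)// ler_wpM2l// ?mulr_ge0.
  rewrite -subr_ge0 [X in 0 <= X](_ : _ = expR (- 2 * tau * t) * quad_form S xi).
    by rewrite mulr_ge0.
  ring.
Qed.

(* A triple lists amplitude, frequency and phase. *)
Definition trig {R : realType} {n : nat} (s : seq (R * 'cV[R]_n * R)) (x : 'cV[R]_n) : R :=
  \sum_(p <- s) p.1.1 * wave p.1.2 p.2 x.

Lemma measurable_trig (R : realType) (n : nat) (s : seq (R * 'cV[R]_n * R)) :
  measurable_fun setT (trig s).
Proof.
apply: measurable_sum => p; apply: measurable_funM => //; exact: measurable_wave.
Qed.

Lemma Rintegral_trig (R : realType) (n : nat) (mu : probability 'cV[R]_n R)
    (s : seq (R * 'cV[R]_n * R)) :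
  mu.-integrable setT (EFin \o trig s) /\
  \int[mu]_x trig s x = \sum_(p <- s) p.1.1 * char_wave mu p.1.2 p.2.
Proof.
have int1 (p : R * 'cV[R]_n * R) :
    mu.-integrable setT (EFin \o (fun x => p.1.1 * wave p.1.2 p.2 x)).
  apply: (bounded_integrable _ _ _ _ _ `|p.1.1|) => [|x].
    by apply: measurable_funM => //; exact: measurable_wave.
  by rewrite normrM ler_piMr// wave_le1.
have [H1 H2] := Rintegral_sum _ _ _ mu setT _ s
  (fun (p : R * 'cV[R]_n * R) x => p.1.1 * wave p.1.2 p.2 x) measurableT int1.
split => //; rewrite H2; apply: eq_bigr => p _.
by rewrite RintegralZl//; exact: integrable_wave.
Qed.

Lemma wave_mul (R : realType) (n : nat) (xi eta : 'cV[R]_n) (th ph : R) x :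
  wave xi th x * wave eta ph x =
  2^-1 * wave (xi + eta) (th + ph) x + 2^-1 * wave (xi - eta) (th - ph) x.
Proof.
rewrite /wave !dotDl dotNl.
rewrite (_ : _ + dot eta x + _ = (dot xi x + th) + (dot eta x + ph)); last by ring.
rewrite (_ : _ - dot eta x + _ = (dot xi x + th) - (dot eta x + ph)); last by ring.
by move: (dot xi x + th) (dot eta x + ph) => X Y; rewrite cosB cosD; field.
Qed.

Lemma wave_variance_integral (R : realType) (n : nat) (mu : probability 'cV[R]_n R)
    (S : 'M[R]_n) (N : nat) (a th : 'I_N -> R) (xi : 'I_N -> 'cV[R]_n) (m : R) :
  psd S -> (forall xi th, char_wave mu xi th = expR (- 2^-1 * quad_form S xi) * cos th) ->
  let d j := a j * expR (- 2^-1 * quad_form S (xi j)) in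
  m = \sum_j d j * cos (th j) ->
  \int[mu]_x (\sum_j a j * wave (xi j) (th j) x - m) ^+ 2 =
  wave_variance d th (fun j k => dot (xi j) (S *m xi k)).
Proof.
move=> [Ss _] muS d mE.
pose e j := expR (- 2^-1 * quad_form S (xi j)).
pose mm j := e j * cos (th j).
pose z j k := a j * a k.
(* The (j, k) summand of the squared centred sum, as a list of waves: two for the product of
   cosines, two cross terms with the means, and a constant written as the wave of frequency 0. *)
pose s j k : seq (R * 'cV[R]_n * R) :=
  [:: (z j k * 2^-1, xi j + xi k, th j + th k); (z j k * 2^-1, xi j - xi k, th j - th k);
      (- z j k * mm k, xi j, th j); (- z j k * mm j, xi k, th k); (z j k * mm j * mm k, 0, 0)].
have wave0 x : wave (0 : 'cV[R]_n) 0 x = 1.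
  by rewrite /wave /dot trmx0 mul0mx mxE addr0 cos0.
transitivity (\int[mu]_x \sum_j \sum_k trig (s j k) x).
  apply: eq_Rintegral => x _.
  rewrite mE -sumrB expr2 mulr_suml; apply: eq_bigr => j _.
  rewrite mulr_sumr; apply: eq_bigr => k _.
  rewrite /trig !big_cons big_nil /= wave0.
  have -> : z j k * 2^-1 * wave (xi j + xi k) (th j + th k) x = z j k * (wave (xi j) (th j) x * wave (xi k) (th k) x) -
     z j k * 2^-1 * wave (xi j - xi k) (th j - th k) x by rewrite wave_mul; ring.
  by rewrite /z /d /mm /e; ring.
have int1 j := Rintegral_sum _ _ _ mu setT _ (index_enum 'I_N) (fun k => trig (s j k))
   measurableT (fun k => (Rintegral_trig _ _ mu (s j k)).1).
have int2 := Rintegral_sum _ _ _ mu setT _ (index_enum 'I_N) (fun j x => \sum_k trig (s j k) x)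
   measurableT (fun j => (int1 j).1).
rewrite int2.2; apply: eq_bigr => j _; rewrite (int1 j).2; apply: eq_bigr => k _.
rewrite (Rintegral_trig _ _ mu (s j k)).2 !big_cons big_nil /= !muS.
have qD : quad_form S (xi j + xi k) = quad_form S (xi j) + quad_form S (xi k) + 2 * dot (xi j) (S *m xi k).
  rewrite !quad_form_dot mulmxDr !dotDl !dotDr [dot (xi k) (S *m xi j)]dot_mulmx Ss [dot (S *m _) _]dotC; ring.
have qB : quad_form S (xi j - xi k) = quad_form S (xi j) + quad_form S (xi k) - 2 * dot (xi j) (S *m xi k).
  rewrite !quad_form_dot mulmxBr dotDl dotNl !dotDr !dotNr.
  rewrite [dot (xi k) (S *m xi j)]dot_mulmx Ss [dot (S *m _) _]dotC; ring.
have eD : expR (- 2^-1 * quad_form S (xi j + xi k)) = e j * e k * expR (- dot (xi j) (S *m xi k)).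
  by rewrite qD /e -!expRD; congr expR; field.
have eB : expR (- 2^-1 * quad_form S (xi j - xi k)) = e j * e k * expR (dot (xi j) (S *m xi k)).
  by rewrite qB /e -!expRD; congr expR; field.
have e0 : expR (- 2^-1 * quad_form S (0 : 'cV[R]_n)) = 1.
  by rewrite quad_form_dot mulmx0 /dot mulmx0 mxE mulr0 expR0.
have cc : cos (th j) * cos (th k) = 2^-1 * (cos (th j - th k) + cos (th j + th k)).
  by rewrite cosB cosD; field.
rewrite eD eB e0 cos0 -!/(e j) -!/(e k).
have -> : z j k * mm j * mm k * (1 * 1) = z j k * e j * e k * (cos (th j) * cos (th k)).
  by rewrite /mm; ring.
have -> : - z j k * mm k * (e j * cos (th j)) = - z j k * e j * e k * (cos (th j) * cos (th k)).
  by rewrite /mm; ring.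
have -> : - z j k * mm j * (e k * cos (th k)) = - z j k * e j * e k * (cos (th j) * cos (th k)).
  by rewrite /mm; ring.
rewrite cc /d -!/(e j) -!/(e k) /z; ring.
Qed.

Definition ou_trig {R : realType} {n : nat} (Q B : 'M[R]_n) (t : R)
    (s : seq (R * 'cV[R]_n * R)) : seq (R * 'cV[R]_n * R) :=
  [seq (p.1.1 * expR (- 2^-1 * quad_form (ou_cov Q B t) p.1.2), (expmx (t *: B))^T *m p.1.2, p.2)
  | p <- s].

Lemma trig_bounded (R : realType) (n : nat) (s : seq (R * 'cV[R]_n * R)) (x : 'cV[R]_n) :
  `|trig s x| <= \sum_(p <- s) `|p.1.1|.
Proof.
rewrite (le_trans (ler_norm_sum _ _ _))//; apply: ler_sum => p _.
by rewrite normrM ler_piMr// wave_le1.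
Qed.

Lemma Rintegral_centered_sqr d (T : measurableType d) (R : realType) (mu : probability T R)
    (f : T -> R) :
  mu.-integrable setT (EFin \o f) -> mu.-integrable setT (EFin \o (fun x => f x ^+ 2)) ->
  \int[mu]_x (f x - \int[mu]_y f y) ^+ 2 = \int[mu]_x f x ^+ 2 - (\int[mu]_x f x) ^+ 2.
Proof.
move=> if1 if2; set m := \int[mu]_y f y.
have if3 : mu.-integrable setT (EFin \o (fun x => (2 * m) * f x)).
  rewrite (_ : _ \o _ = fun x => (2 * m)%:E * (EFin \o f) x)%E; first exact: integrableZl.
  by apply/funext => x /=; rewrite EFinM.
have if4 : mu.-integrable setT (EFin \o cst (m ^+ 2)) by exact: finite_measure_integrable_cst.
have if5 : mu.-integrable setT (EFin \o (fun x => f x ^+ 2 - 2 * m * f x)).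
  rewrite (_ : _ \o _ = (EFin \o (fun x => f x ^+ 2)%R) \- (EFin \o (fun x => 2 * m * f x)%R))%E; last first.
    by apply/funext => x /=; rewrite EFinB.
  exact: integrableB.
rewrite (_ : (\int[mu]_x (f x - m) ^+ 2) = \int[mu]_x ((f x ^+ 2 - 2 * m * f x) + cst (m ^+ 2) x)); last first.
  by apply: eq_Rintegral => x _ /=; ring.
rewrite RintegralD// RintegralB// RintegralZl// Rintegral_cst_probability -/m.
ring.
Qed.

Lemma Rintegral_sqr_le d (T : measurableType d) (R : realType) (mu : probability T R)
    (f : T -> R) :
  mu.-integrable setT (EFin \o f) -> mu.-integrable setT (EFin \o (fun x => f x ^+ 2)) ->
  (\int[mu]_x f x) ^+ 2 <= \int[mu]_x f x ^+ 2.
Proof.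
move=> if1 if2; rewrite -subr_ge0 -Rintegral_centered_sqr//.
by apply: Rintegral_ge0 => x _; rewrite sqr_ge0.
Qed.

Lemma ou_trig_contraction (R : realType) (n : nat) (Q B : 'M[R]_n)
    (mu : probability 'cV[R]_n R) (tau : R) :
  (1 <= n)%N -> psd Q -> invariant_measure Q B mu -> tau < spectral_gap B ->
  exists2 K : R, 0 < K & forall t s, 0 < t ->
    \int[mu]_x (trig (ou_trig Q B t s) x - \int[mu]_y trig s y) ^+ 2 <=
    K * expR (- 2 * tau * t) * \int[mu]_x trig s x ^+ 2.
Proof.
move=> n1 Q0 muI tauB.
have [S S0 muS] := stationary_covariance _ _ _ _ _ n1 Q0 muI.
have [K K0 HK] := transported_covariance _ _ _ _ _ _ _ n1 Q0 muI S0 muS tauB.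
exists K => // t s t0.
have [A0 SA KA] := HK t t0.
set A := _ *m _ *m _ in A0 SA KA.
pose N := size s; pose p (j : 'I_N) := tnth (in_tuple s) j.
pose a j := (p j).1.1; pose xi j := (p j).1.2; pose th j := (p j).2.
pose m := \int[mu]_y trig s y.
pose d j := a j * expR (- 2^-1 * quad_form S (xi j)).
have mE : m = \sum_j d j * cos (th j).
  rewrite /m (Rintegral_trig _ _ _ _).2 (big_tnth _ _ s); apply: eq_bigr => j _.
  by rewrite muS mulrA.
have V1 : \int[mu]_x (trig s x - m) ^+ 2 = wave_variance d th (fun j k => dot (xi j) (S *m xi k)).
  rewrite -(wave_variance_integral _ _ _ _ _ _ _ _ _ S0 muS mE).
  by apply: eq_Rintegral => x _; rewrite /trig (big_tnth _ _ s).
pose b j := a j * expR (- 2^-1 * quad_form (ou_cov Q B t) (xi j)).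
pose eta j := (expmx (t *: B))^T *m xi j.
(* The damping by Q_t and the Gaussian factor at the transported frequency multiply to the original
   Gaussian factor. T(t) therefore keeps the mean and the weights [d], and changes only the kernel,
   from S to A. *)
have dE j : d j = b j * expR (- 2^-1 * quad_form S (eta j)).
  rewrite /d /b (stationary_covariance_split _ _ _ _ _ _ _ (xi j) Q0 muI muS t0).
  by rewrite mulrDr expRD mulrA.
have V2 : \int[mu]_x (trig (ou_trig Q B t s) x - m) ^+ 2 =
    wave_variance d th (fun j k => dot (xi j) (A *m xi k)).
  have mE' : m = \sum_j (b j * expR (- 2^-1 * quad_form S (eta j))) * cos (th j).
    by rewrite mE; apply: eq_bigr => j _; rewrite dE.
  transitivity (\int[mu]_x (\sum_j b j * wave (eta j) (th j) x - m) ^+ 2).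
    by apply: eq_Rintegral => x _; rewrite /trig big_map (big_tnth _ _ s).
  rewrite (wave_variance_integral _ _ _ _ _ _ _ _ _ S0 muS mE').
  apply: eq_bigr => j _; apply: eq_bigr => k _; rewrite -!dE.
  by rewrite /eta /A -dot_mulmx -!mulmxA.
rewrite -/m V2; apply: (le_trans (le_wave_variance _ _ _ _ _ _ xi d th A0 S0 SA KA)).
rewrite -V1 ler_wpM2l ?mulr_ge0 ?expR_ge0 ?(ltW K0)//.
(* The variance of the sum is at most its second moment. *)
rewrite Rintegral_centered_sqr ?gerBl ?sqr_ge0//; first exact: (Rintegral_trig _ _ _ _).1.
apply: (bounded_integrable _ _ _ _ _ ((\sum_(p <- s) `|p.1.1|) ^+ 2)).
  by apply: measurable_funX; exact: measurable_trig.
move=> x; rewrite normrX lerXn2r ?nnegrE ?trig_bounded//.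
by rewrite sumr_ge0.
Qed.

Lemma ou_markov_trig (R : realType) (n : nat) (Q B : 'M[R]_n)
    (mu : probability 'cV[R]_n R) (t : R) (s : seq (R * 'cV[R]_n * R)) :
  psd Q -> invariant_measure Q B mu -> 0 < t ->
  ou_markov Q B t (trig s) = trig (ou_trig Q B t s).
Proof.
move=> Q0 muI t0; apply/funext => x.
have [_ intG _] := invariant_normalization _ _ _ _ _ _ muI t0.
pose g (p : R * 'cV[R]_n * R) y :=
  gauss (invmx (ou_cov Q B t)) y * wave p.1.2 p.2 (expmx (t *: B) *m x - y).
have intg p : (lebesgue n).-integrable setT (EFin \o g p).
  apply: (integrable_le_EFin _ _ _ _ _ _ _ _ intG).
    apply: measurable_funM; first exact: measurable_gauss.
    rewrite (_ : (fun y => _) = wave (- p.1.2) (dot p.1.2 (expmx (t *: B) *m x) + p.2)).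
      exact: measurable_wave.
    by apply/funext => y; rewrite /wave dotDr dotNr dotNl; congr cos; ring.
  move=> y; rewrite normrM (ger0_norm (expR_ge0 _)) ler_piMr ?expR_ge0//.
  exact: wave_le1.
have intg' (p : R * 'cV[R]_n * R) : (lebesgue n).-integrable setT (EFin \o (fun y => p.1.1 * g p y)).
  rewrite (_ : _ \o _ = fun y => p.1.1%:E * (EFin \o g p) y)%E; first exact: integrableZl.
  by apply/funext => y /=; rewrite EFinM.
have [_ H] := Rintegral_sum _ _ _ (lebesgue n) setT _ s
  (fun p y => p.1.1 * g p y) measurableT intg'.
transitivity (\sum_(p <- s) p.1.1 * ou_markov Q B t (wave p.1.2 p.2) x); last first.
  rewrite /trig big_map; apply: eq_bigr => p _.
  by rewrite (ou_markov_wave _ _ _ _ _ _ _ _ Q0 muI t0) mulrA.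
rewrite /ou_markov t0 (_ : Rintegral _ _ _ = \int[lebesgue n]_y \sum_(p <- s) p.1.1 * g p y).
  rewrite H mulr_sumr; apply: eq_bigr => p _.
  by rewrite RintegralZl// mulrCA.
apply: eq_Rintegral => y _; rewrite /trig mulr_sumr; apply: eq_bigr => p _.
by rewrite /g /gauss; ring.
Qed.

Lemma continuous_trig (R : realType) (n : nat) (s : seq (R * 'cV[R]_n * R)) :
  continuous (trig s).
Proof.
rewrite (_ : trig s = fun x => \sum_(j < size s) (tnth (in_tuple s) j).1.1 *
   wave (tnth (in_tuple s) j).1.2 (tnth (in_tuple s) j).2 x); last first.
  by apply/funext => x; rewrite /trig (big_tnth _ _ s).
apply: continuous_sum_ord => j x; apply: (@continuousM R _ (cst _) (wave _ _)).
  exact: cst_continuous.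
exact: continuous_wave.
Qed.

(** [rho] agrees almost everywhere with the Radon-Nikodym derivative, for which the change of
    measure is known. *)
Lemma Rintegral_density (R : realType) (n : nat) (mu : probability 'cV[R]_n R)
    (rho f : 'cV[R]_n -> R) :
  has_density mu rho -> mu.-integrable setT (EFin \o f) ->
  \int[lebesgue n]_x (f x * rho x) = \int[mu]_x f x.
Proof.
move=> [mrho rho0 muE] intf.
have mulam : mu `<< lebesgue n.
  apply/null_content_dominatesP => A mA lA0; rewrite muE//.
  apply/null_set_integral => //.
  by apply/measurable_EFinP; exact: measurable_funTS.
have ae : ae_eq (lebesgue n) setT (Radon_Nikodym (charge_of_finite_measure mu) (lebesgue n)) (EFin \o rho).
  apply: integral_ae_eq => //.
  - exact: Radon_Nikodym_integrable.
  - exact/measurable_EFinP.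
  - by move=> E _ mE; rewrite -Radon_Nikodym_integral//; exact: muE.
rewrite /Rintegral -(Radon_Nikodym_change_of_variables mulam measurableT intf); congr fine.
have mRN : measurable_fun setT (Radon_Nikodym (charge_of_finite_measure mu) (lebesgue n)).
  by apply: (measurable_int (lebesgue n)); exact: Radon_Nikodym_integrable.
have mf := measurable_int _ intf.
apply: ae_eq_integral => //.
- by apply/measurable_EFinP; apply: measurable_funM => //; exact/measurable_EFinP.
- exact: emeasurable_funM.
- apply: filterS ae => x H _; rewrite EFinM; congr (_ * _)%E.
  by rewrite H.
Qed.

(** * Density of sums of cosines *)

(** Stands in for the triangle inequality without square roots; the accuracies e / 4 below
    compensate its factors 2. *)
Lemma integral_sqrD_le d (T : measurableType d) (R : realType) (mu : {measure set T -> \bar R})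
    (f g : T -> R) :
  measurable_fun setT f -> measurable_fun setT g ->
  (\int[mu]_x ((f x + g x) ^+ 2)%:E <=
   2%:E * \int[mu]_x (f x ^+ 2)%:E + 2%:E * \int[mu]_x (g x ^+ 2)%:E)%E.
Proof.
move=> mf mg.
have mX (h : T -> R) : measurable_fun setT h -> measurable_fun setT (fun x => (h x ^+ 2)%:E).
  by move=> mh; apply/measurable_EFinP; exact: measurable_funX.
rewrite -!ge0_integralZl_EFin//; last 4 first.
- by move=> x _; rewrite lee_fin sqr_ge0.
- exact: mX.
- by move=> x _; rewrite lee_fin sqr_ge0.
- exact: mX.
have mZ (h : T -> R) : measurable_fun setT h -> measurable_fun setT (fun x => 2%:E * (h x ^+ 2)%:E)%E.
  by move=> mh; apply: measurable_funeM; exact: mX.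
rewrite -ge0_integralD//; last 4 first.
- by move=> x _; rewrite mule_ge0// lee_fin sqr_ge0.
- exact: mZ.
- by move=> x _; rewrite mule_ge0// lee_fin sqr_ge0.
- exact: mZ.
apply: ge0_le_integral => //.
- by move=> x _; rewrite lee_fin sqr_ge0.
- apply: mX; exact: measurable_funD.
- by apply: emeasurable_funD; exact: mZ.
- move=> x _; rewrite -!EFinM -EFinD lee_fin -subr_ge0.
  by rewrite (_ : _ - _ = (f x - g x) ^+ 2) ?sqr_ge0//; ring.
Qed.

(** The integral is taken in the extended reals, so integrability of the squared difference need not
    be known beforehand: it follows from the bound. *)
Definition l2_trig_limit {R : realType} {n : nat} (mu : probability 'cV[R]_n R)
    (f : 'cV[R]_n -> R) : Prop :=
  measurable_fun setT f /\ forall e : R, 0 < e ->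
    exists s, (\int[mu]_x ((f x - trig s x) ^+ 2)%:E <= e%:E)%E.

Lemma l2_trig_limit_closed (R : realType) (n : nat) (mu : probability 'cV[R]_n R)
    (f : 'cV[R]_n -> R) :
  measurable_fun setT f ->
  (forall e : R, 0 < e -> exists2 g, l2_trig_limit mu g &
     (\int[mu]_x ((f x - g x) ^+ 2)%:E <= e%:E)%E) ->
  l2_trig_limit mu f.
Proof.
move=> mf H; split=> // e e0.
have e40 : 0 < e / 4 by rewrite divr_gt0.
have [g [mg /(_ _ e40)[s gs]] fg] := H _ e40.
exists s; rewrite (_ : (fun x => _) = fun x => (((f x - g x) + (g x - trig s x)) ^+ 2)%:E); last first.
  by apply/funext => x; congr (_ ^+ 2)%:E; ring.
apply: (le_trans (integral_sqrD_le _ _ _ _ _ _ _ _)).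
- exact: measurable_funB.
- by apply: measurable_funB => //; exact: measurable_trig.
apply: (@le_trans _ _ (2%:E * (e / 4)%:E + 2%:E * (e / 4)%:E)%E).
  by apply: leeD; rewrite lee_pmul2l.
by rewrite -!EFinM -EFinD lee_fin; lra.
Qed.

Lemma l2_trig_limit_dominated (R : realType) (n : nat) (mu : probability 'cV[R]_n R)
    (f_ : nat -> 'cV[R]_n -> R) (f G : 'cV[R]_n -> R) :
  (forall k, l2_trig_limit mu (f_ k)) ->
  (forall x, f_ k x @[k --> \oo] --> f x) ->
  mu.-integrable setT (EFin \o G) -> (forall k x, (f x - f_ k x) ^+ 2 <= G x) ->
  l2_trig_limit mu f.
Proof.
move=> Hf cf iG fG.
have mf : measurable_fun setT f.
  by apply: (measurable_fun_cvg (fun k => (Hf k).1)) => x _; exact: cf.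
apply: l2_trig_limit_closed => // e e0.
have [] := @dominated_convergence _ _ _ mu setT measurableT
  (fun k x => ((f x - f_ k x) ^+ 2)%:E) (cst 0%E) (EFin \o G).
- move=> k; apply/measurable_EFinP; apply: measurable_funX; apply: measurable_funB => //.
  exact: (Hf k).1.
- exact: measurable_cst.
- apply: aeW => x _; apply: cvg_EFin; first exact: nearW.
  have : (f x - f_ k x) ^+ 2 @[k --> \oo] --> (f x - f x) ^+ 2.
    have c1 : f x - f_ k x @[k --> \oo] --> f x - f x.
      by apply: cvgB; [exact: cvg_cst|exact: cf].
    by rewrite expr2; under eq_fun do rewrite expr2; exact: cvgM.
  by rewrite subrr expr0n.
- exact: iG.
- by apply: aeW => x k _; rewrite gee0_abs lee_fin ?sqr_ge0//; exact: fG.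
move=> _ _; rewrite integral0 => /fine_cvgP[[K1 _ HK1] H2].
have [K2 _ HK2] := cvgr_le _ H2 _ e0.
pose k := maxn K1 K2.
exists (f_ k); first exact: Hf.
have := HK2 k (leq_maxr _ _); rewrite /= -lee_fin fineK//.
by apply: HK1; rewrite /= leq_maxl.
Qed.

Lemma l2_trig_limit_trig (R : realType) (n : nat) (mu : probability 'cV[R]_n R) s :
  l2_trig_limit mu (trig s).
Proof.
split; first exact: measurable_trig.
move=> e e0; exists s; under eq_integral do rewrite subrr expr0n.
by rewrite integral0 lee_fin ltW.
Qed.

Lemma l2_trig_limit_bounded (R : realType) (n : nat) (mu : probability 'cV[R]_n R)
    (f_ : nat -> 'cV[R]_n -> R) (f : 'cV[R]_n -> R) (M : R) :
  (forall k, l2_trig_limit mu (f_ k)) ->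
  (forall x, f_ k x @[k --> \oo] --> f x) ->
  (forall k x, `|f_ k x| <= M) -> l2_trig_limit mu f.
Proof.
move=> Hf cf fM.
have fM' x : `|f x| <= M.
  have c : `|f_ k x| @[k --> \oo] --> `|f x| by apply: cvg_norm; exact: cf.
  apply: (ler_cvg_to c (cvg_cst M)); exact: nearW.
apply: (l2_trig_limit_dominated _ _ _ f_ _ (cst ((M + M) ^+ 2))) => //.
  exact: finite_measure_integrable_cst.
move=> k x; rewrite /= -ler_sqrt ?sqr_ge0// !sqrtr_sqr.
rewrite (le_trans (ler_normB _ _))// (le_trans _ (ler_norm _))// lerD//.
Qed.

Lemma trigD (R : realType) (n : nat) (s1 s2 : seq (R * 'cV[R]_n * R)) x :
  trig (s1 ++ s2) x = trig s1 x + trig s2 x.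
Proof. by rewrite /trig big_cat. Qed.

Lemma trigZ (R : realType) (n : nat) (c : R) (s : seq (R * 'cV[R]_n * R)) x :
  trig [seq (c * p.1.1, p.1.2, p.2) | p <- s] x = c * trig s x.
Proof. by rewrite /trig big_map mulr_sumr; apply: eq_bigr => p _; rewrite mulrA. Qed.

Lemma trigM (R : realType) (n : nat) (s1 s2 : seq (R * 'cV[R]_n * R)) :
  exists s, forall x, trig s x = trig s1 x * trig s2 x.
Proof.
exists (flatten [seq flatten [seq
  [:: (p.1.1 * q.1.1 * 2^-1, p.1.2 + q.1.2, p.2 + q.2); (p.1.1 * q.1.1 * 2^-1, p.1.2 - q.1.2, p.2 - q.2)]
  | q <- s2] | p <- s1]) => x.
rewrite /trig big_flatten big_map mulr_suml; apply: eq_bigr => p _.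
rewrite big_flatten big_map mulr_sumr; apply: eq_bigr => q _.
rewrite !big_cons big_nil /=.
transitivity (p.1.1 * q.1.1 * (wave p.1.2 p.2 x * wave q.1.2 q.2 x)); last by ring.
by rewrite wave_mul; ring.
Qed.

Lemma l2_trig_limitD (R : realType) (n : nat) (mu : probability 'cV[R]_n R) f g :
  l2_trig_limit mu f -> l2_trig_limit mu g -> l2_trig_limit mu (fun x => f x + g x).
Proof.
move=> [mf Hf] [mg Hg]; split; first exact: measurable_funD.
move=> e e0; have e40 : 0 < e / 4 by rewrite divr_gt0.
have [s fs] := Hf _ e40; have [r gr] := Hg _ e40.
exists (s ++ r); rewrite (_ : (fun x => _) = fun x => (((f x - trig s x) + (g x - trig r x)) ^+ 2)%:E); last first.
  by apply/funext => x; rewrite trigD; congr (_ ^+ 2)%:E; ring.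
apply: (le_trans (integral_sqrD_le _ _ _ _ _ _ _ _)).
- by apply: measurable_funB => //; exact: measurable_trig.
- by apply: measurable_funB => //; exact: measurable_trig.
apply: (@le_trans _ _ (2%:E * (e / 4)%:E + 2%:E * (e / 4)%:E)%E).
  by apply: leeD; rewrite lee_pmul2l.
by rewrite -!EFinM -EFinD lee_fin; lra.
Qed.

Lemma integral_sqrM_le d (T : measurableType d) (R : realType) (mu : {measure set T -> \bar R})
    (f g : T -> R) (M : R) :
  measurable_fun setT f -> measurable_fun setT g -> (forall x, `|g x| <= M) ->
  (\int[mu]_x ((f x * g x) ^+ 2)%:E <= (M ^+ 2)%:E * \int[mu]_x (f x ^+ 2)%:E)%E.
Proof.
move=> mf mg gM.
have mX (h : T -> R) : measurable_fun setT h -> measurable_fun setT (fun x => (h x ^+ 2)%:E).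
  by move=> mh; apply/measurable_EFinP; exact: measurable_funX.
rewrite -ge0_integralZl_EFin ?sqr_ge0//; last 2 first.
- by move=> x _; rewrite lee_fin sqr_ge0.
- exact: mX.
apply: ge0_le_integral => //.
- by move=> x _; rewrite lee_fin sqr_ge0.
- apply: mX; exact: measurable_funM.
- by apply: measurable_funeM; exact: mX.
- move=> x _; rewrite -EFinM lee_fin exprMn mulrC ler_wpM2r ?sqr_ge0//.
  rewrite -real_normK ?num_real// lerXn2r// nnegrE//.
  exact: le_trans (gM x).
Qed.

(** One factor is approximated at a time, the other being bounded: first by a sum of cosines, then
    by the given bound. Approximating both at once would leave an uncontrolled product of errors.
    The 1 in K^2 + 1 avoids a division by zero. *)
Lemma l2_trig_limitM (R : realType) (n : nat) (mu : probability 'cV[R]_n R) f g (M N : R) :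
  l2_trig_limit mu f -> l2_trig_limit mu g ->
  (forall x, `|f x| <= M) -> (forall x, `|g x| <= N) ->
  l2_trig_limit mu (fun x => f x * g x).
Proof.
have scale (e K : R) : 0 < e -> K ^+ 2 * (e / (K ^+ 2 + 1)) <= e.
  move=> e0; rewrite mulrA ler_pdivrMr ?ltr_wpDl ?sqr_ge0//.
  by rewrite mulrC ler_wpM2l ?(ltW e0)// lerDl.
have tM h s : l2_trig_limit mu h -> l2_trig_limit mu (fun x => h x * trig s x).
  move=> [mh Hh]; split; first by apply: measurable_funM => //; exact: measurable_trig.
  move=> e e0; pose K := \sum_(p <- s) `|p.1.1|.
  have eK : 0 < e / (K ^+ 2 + 1) by rewrite divr_gt0// ltr_wpDl ?sqr_ge0.
  have [r hr] := Hh _ eK; have [q qE] := trigM _ _ r s.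
  exists q; rewrite (_ : (fun x => _) = fun x => (((h x - trig r x) * trig s x) ^+ 2)%:E); last first.
    by apply/funext => x; rewrite qE; congr (_ ^+ 2)%:E; ring.
  apply: (le_trans (integral_sqrM_le _ _ _ _ _ _ K _ _ _)).
  - by apply: measurable_funB => //; exact: measurable_trig.
  - exact: measurable_trig.
  - exact: trig_bounded.
  apply: (@le_trans _ _ ((K ^+ 2)%:E * (e / (K ^+ 2 + 1))%:E)%E).
    by rewrite lee_wpmul2l// lee_fin sqr_ge0.
  by rewrite -EFinM lee_fin scale.
move=> lf [mg Hg] fM gN; apply: l2_trig_limit_closed.
  by apply: measurable_funM => //; exact: lf.1.
move=> e e0.
have eM : 0 < e / (M ^+ 2 + 1) by rewrite divr_gt0// ltr_wpDl ?sqr_ge0.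
have [s gs] := Hg _ eM.
exists (fun x => f x * trig s x); first exact: tM.
rewrite (_ : (fun x => _) = fun x => (((g x - trig s x) * f x) ^+ 2)%:E); last first.
  by apply/funext => x; congr (_ ^+ 2)%:E; ring.
apply: (le_trans (integral_sqrM_le _ _ _ _ _ _ M _ _ _)) => //.
- by apply: measurable_funB => //; exact: measurable_trig.
- exact: lf.1.
apply: (@le_trans _ _ ((M ^+ 2)%:E * (e / (M ^+ 2 + 1))%:E)%E).
  by rewrite lee_wpmul2l// lee_fin sqr_ge0.
by rewrite -EFinM lee_fin scale.
Qed.

(* s |-> (3 s - s^3)/2 has super-attracting fixed points -1 and 1 and repels 0,
   so its iterates are polynomials converging to the sign on [-1, 1]. *)
Definition sign_step {R : realType} (s : R) : R := 3 / 2 * s + - 2^-1 * (s * (s * s)).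

Lemma sign_step_itv (R : realType) (s : R) : `|s| <= 1 -> `|sign_step s| <= 1.
Proof.
rewrite !ler_norml => /andP[s1 s2]; rewrite /sign_step; apply/andP; split; rewrite -subr_ge0.
  rewrite (_ : _ - _ = (1 + s) ^+ 2 * (2 - s) / 2); last by field.
  by rewrite !mulr_ge0 ?sqr_ge0//; lra.
rewrite (_ : _ - _ = (1 - s) ^+ 2 * (2 + s) / 2); last by field.
by rewrite !mulr_ge0 ?sqr_ge0//; lra.
Qed.

(** A step from r multiplies the distance to 1 by (1 - r)(2 + r) / 2, which is at most 1 - s / 2
    because the iterates stay above s. *)
Lemma iter_sign_step_gt0 (R : realType) (s : R) k : 0 < s -> s <= 1 ->
  s <= iter k sign_step s <= 1 /\ 1 - iter k sign_step s <= (1 - s / 2) ^+ k.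
Proof.
move=> s0 s1; elim: k => [|k [/andP[IH1 IH2] IH3]] /=.
  by rewrite lexx s1 expr0; split => //; lra.
set r := iter k sign_step s in IH1 IH2 IH3 *.
have r0 : 0 < r by apply: lt_le_trans IH1.
split.
  apply/andP; split.
    apply: (le_trans IH1); rewrite -subr_ge0 /sign_step.
    rewrite (_ : _ - _ = r * ((1 - r) * (1 + r)) / 2); last by field.
    by rewrite !mulr_ge0//; lra.
  have := @sign_step_itv _ r; rewrite !ler_norml IH2 andbT => /(_ _)/andP[]//.
  by rewrite (le_trans _ (ltW r0))// lerN10.
rewrite exprSr (_ : 1 - sign_step r = (1 - r) * ((1 - r) * (2 + r) / 2)); last first.
  by rewrite /sign_step; field.
apply: ler_pM => //; first by lra.
  by rewrite !mulr_ge0//; lra.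
rewrite -subr_ge0 (_ : _ - _ = (r - s + r ^+ 2) / 2); last by field.
by rewrite divr_ge0// addr_ge0 ?sqr_ge0// subr_ge0.
Qed.

Lemma iter_sign_stepN (R : realType) (s : R) k :
  iter k sign_step (- s) = - iter k sign_step s.
Proof. by elim: k => //= k ->; rewrite /sign_step; ring. Qed.

Lemma cvg_iter_sign_step (R : realType) (s : R) : `|s| <= 1 ->
  iter k sign_step s @[k --> \oo] --> Num.sg s.
Proof.
have pos (r : R) : 0 < r -> r <= 1 -> iter k sign_step r @[k --> \oo] --> (1 : R).
  move=> r0 r1.
  have c1 : 1 - (1 - r / 2) ^+ k @[k --> \oo] --> (1 : R).
    have : 1 - (1 - r / 2) ^+ k @[k --> \oo] --> 1 - (0 : R).
      apply: cvgB; [exact: cvg_cst|apply: cvg_expr].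
      by rewrite ger0_norm; lra.
    by rewrite subr0.
  apply: (@squeeze_cvgr _ _ _ _ (fun k => 1 - (1 - r / 2) ^+ k) (fun=> 1)) => //; last exact: cvg_cst.
  apply: nearW => k; have [/andP[_ ->] H] := iter_sign_step_gt0 _ _ k r0 r1.
  by rewrite andbT; lra.
rewrite ler_norml => /andP[s1 s2]; have [s0|s0|<-] := ltgtP 0 s.
- by rewrite gtr0_sg//; exact: pos.
- rewrite ltr0_sg// (_ : (fun k => _) = fun k => - iter k sign_step (- s)); last first.
    by apply/funext => k; rewrite iter_sign_stepN opprK.
  by apply: cvgN; apply: pos; lra.
- rewrite sgr0 (_ : (fun k => _) = fun=> 0); first exact: cvg_cst.
  by apply/funext; elim => //= k ->; rewrite /sign_step; ring.
Qed.

Lemma iter_sign_step_itv (R : realType) (s : R) k : `|s| <= 1 -> `|iter k sign_step s| <= 1.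
Proof. by move=> s1; elim: k => //= k; exact: sign_step_itv. Qed.

Lemma l2_trig_limitZ (R : realType) (n : nat) (mu : probability 'cV[R]_n R) (c : R) f :
  l2_trig_limit mu f -> l2_trig_limit mu (fun x => c * f x).
Proof.
move=> [mf Hf]; split; first exact: measurable_funM.
move=> e e0; have eM : 0 < e / (c ^+ 2 + 1) by rewrite divr_gt0// ltr_wpDl ?sqr_ge0.
have [s fs] := Hf _ eM; exists [seq (c * p.1.1, p.1.2, p.2) | p <- s].
rewrite (_ : (fun x => _) = fun x => (((f x - trig s x) * cst c x) ^+ 2)%:E); last first.
  by apply/funext => x; rewrite trigZ /=; congr (_ ^+ 2)%:E; ring.
apply: (le_trans (integral_sqrM_le _ _ _ _ _ (cst c) `|c| _ _ _)) => //.
  by apply: measurable_funB => //; exact: measurable_trig.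
apply: (@le_trans _ _ ((c ^+ 2)%:E * (e / (c ^+ 2 + 1))%:E)%E).
  by rewrite real_normK ?num_real// lee_wpmul2l// lee_fin sqr_ge0.
rewrite -EFinM lee_fin mulrA ler_pdivrMr ?ltr_wpDl ?sqr_ge0//.
by rewrite mulrC ler_wpM2l ?(ltW e0)// lerDl.
Qed.

(** The iterates are polynomials in f, hence in the closure by stability under bounded products, and
    they converge to the sign while bounded by 1. *)
Lemma l2_trig_limit_sg (R : realType) (n : nat) (mu : probability 'cV[R]_n R) f :
  l2_trig_limit mu f -> (forall x, `|f x| <= 1) -> l2_trig_limit mu (fun x => Num.sg (f x)).
Proof.
move=> lf f1.
apply: (l2_trig_limit_bounded _ _ _ (fun k x => iter k sign_step (f x)) _ 1).
- elim=> // k IH /=.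
  have I1 x : `|iter k sign_step (f x)| <= 1 by exact: iter_sign_step_itv.
  have mul1 g h : (forall x, `|g x| <= (1:R)) -> (forall x, `|h x| <= (1:R)) ->
      forall x : 'cV[R]_n, `|g x * h x| <= 1.
    by move=> g1 h1 x; rewrite normrM mulr_ile1.
  apply: l2_trig_limitD; first exact: l2_trig_limitZ IH.
  apply: l2_trig_limitZ.
  apply: (l2_trig_limitM _ _ _ _ _ 1 1) => //; last by apply: (mul1).
  exact: (l2_trig_limitM _ _ _ _ _ 1 1).
- by move=> x; exact: cvg_iter_sign_step.
- by move=> k x; exact: iter_sign_step_itv.
Qed.

(** A sine of low frequency has the sign of x_i - a once |x_i - a| / (m+1) < 2 <= pi, so the signs
    of these sines converge pointwise to that of x_i - a. *)
Lemma l2_trig_limit_halfspace (R : realType) (n : nat) (mu : probability 'cV[R]_n R)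
    (i : 'I_n) (a : R) :
  l2_trig_limit mu (\1_[set x : 'cV[R]_n | a < x i 0]).
Proof.
pose f (m : nat) (x : 'cV[R]_n) := sin ((x i 0 - a) / m.+1%:R).
have fE m : f m = trig [:: (1, m.+1%:R^-1 *: delta_mx i 0, - (a / m.+1%:R) - pi / 2)].
  apply/funext => x; rewrite /trig big_seq1 mul1r /wave /= dotZl.
  have -> : dot (delta_mx i 0) x = x i 0 by rewrite /dot trmx_delta -rowE mxE.
  rewrite /f -cosBpihalf; congr cos; ring.
have fsg x : Num.sg (f m x) @[m --> \oo] --> Num.sg (x i 0 - a).
  set y := x i 0 - a.
  have sgpos (z : R) : 0 < z -> z < 2 -> 0 < sin z.
    by move=> z0 z2; apply: sin_gt0_pi; rewrite z0 (lt_le_trans z2)// pi_ge2.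
  have c0 : `|y| * m.+1%:R^-1 @[m --> \oo] --> `|y| * 0.
    by apply: cvgMr; exact: cvg_harmonic.
  rewrite mulr0 in c0.
  apply: cvg_near_cst; near=> m.
  have ym : `|y| / m.+1%:R < 2.
    by near: m; apply: (cvgr_lt _ c0).
  have m0 : 0 < m.+1%:R^-1 :> R by rewrite invr_gt0.
  rewrite /f -/y; case: (ltgtP 0 y) ym => [y0|y0|<-] ym.
  - rewrite !gtr0_sg//; apply: sgpos; first by rewrite mulr_gt0.
    by rewrite (le_lt_trans _ ym)// ler_wpM2r ?ler_norm// ltW.
  - rewrite !ltr0_sg// -[y]opprK mulNr sinN oppr_lt0; apply: sgpos.
      by rewrite mulr_gt0// oppr_gt0.
    by rewrite (le_lt_trans _ ym)// ler_wpM2r ?(ltW m0)// -normrN ler_norm.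
  - by rewrite mul0r sin0.
pose g (x : 'cV[R]_n) := Num.sg (x i 0 - a).
have norm_sg1 (y : R) : `|Num.sg y| <= 1.
  by rewrite normr_sg; case: (y != 0).
have lg : l2_trig_limit mu g.
  apply: (l2_trig_limit_bounded _ _ _ (fun m x => Num.sg (f m x)) _ 1) => // m.
  apply: l2_trig_limit_sg; first by rewrite fE; exact: l2_trig_limit_trig.
  by move=> x; rewrite ler_norml sin_geN1 sin_le1.
have g1 x : `|g x| <= 1 by exact: norm_sg1.
(* For a sign g, (g + g^2) / 2 is 1 if g = 1 and 0 if g is 0 or -1, which keeps the half-space
   open. *)
rewrite (_ : \1__ = fun x => 2^-1 * g x + 2^-1 * (g x * g x)); last first.
  apply/funext => x; rewrite indicE /g; have [ax|xa|xa] := ltgtP a (x i 0).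
  - rewrite (mem_set (_ : [set x : 'cV[R]_n | a < x i 0] x))//.
    by rewrite gtr0_sg ?subr_gt0//=; field.
  - rewrite (memNset (_ : ~ [set x : 'cV[R]_n | a < x i 0] x)) /= ?ltNge ?(ltW xa)//.
    by rewrite ltr0_sg ?subr_lt0//; ring.
  - rewrite (memNset (_ : ~ [set x : 'cV[R]_n | a < x i 0] x)) /= -?xa ?ltxx//.
    by rewrite subrr sgr0; ring.
apply: l2_trig_limitD; first exact: l2_trig_limitZ lg.
apply: l2_trig_limitZ; exact: (l2_trig_limitM _ _ _ _ _ 1 1).
Unshelve. all: by end_near. Qed.

Lemma norm_indic_le1 (R : realType) (T : Type) (A : set T) (x : T) : `|\1_A x| <= 1 :> R.
Proof. by rewrite indicE; case: (x \in A); rewrite ?normr1 ?normr0. Qed.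

(** The sets whose indicator lies in the closure form a sigma-algebra, by bounded products and
    bounded pointwise limits, and they contain the half-spaces, which generate. *)
Lemma l2_trig_limit_indic (R : realType) (n : nat) (mu : probability 'cV[R]_n R)
    (A : set 'cV[R]_n) :
  measurable A -> l2_trig_limit mu (\1_A).
Proof.
have cst1 (c : R) : l2_trig_limit mu (cst c).
  rewrite (_ : cst c = trig [:: (c, 0 : 'cV[R]_n, 0)]); first exact: l2_trig_limit_trig.
  apply/funext => x.
  by rewrite /trig big_seq1 /wave /dot /= trmx0 mul0mx mxE addr0 cos0 mulr1.
pose D : set (set 'cV[R]_n) := [set A | l2_trig_limit mu (\1_A)].
have D0 : D set0.
  by rewrite /D /= (_ : \1__ = cst 0)//; apply/funext => x; rewrite indic0.
have DC B : D B -> D (~` B).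
  move=> DB; rewrite /D /= (_ : \1__ = fun x => cst 1 x + (-1) * \1_B x); last first.
    apply/funext => x; rewrite !indicE in_setC /=.
    by case: (x \in B) => /=; ring.
  by apply: l2_trig_limitD => //; exact: l2_trig_limitZ.
have DI B C : D B -> D C -> D (B `&` C).
  move=> DB DC'; rewrite /D /= indicI.
  by apply: (l2_trig_limitM _ _ _ _ _ 1 1) => //; exact: norm_indic_le1.
have DU B C : D B -> D C -> D (B `|` C).
  by move=> DB DC'; rewrite -[_ `|` _]setCK setCU; apply/DC/DI; exact: DC.
have Dbig (F : nat -> set 'cV[R]_n) : (forall k, D (F k)) -> D (\bigcup_k F k).
  move=> DF; apply: (l2_trig_limit_bounded _ _ _ (fun k => \1_(\big[setU/set0]_(j < k) F j)) _ 1).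
  - by elim=> [|k IH]; [rewrite big_ord0|rewrite big_ord_recr; exact: DU].
  - move=> x; apply: cvg_near_cst; rewrite !indicE.
    have [[j _ Fj]|nF] := pselect ((\bigcup_k F k) x).
      exists j.+1 => // k /= jk; rewrite indicE !mem_set//; first by exists j.
      by rewrite -bigcup_mkord; exists j.
    apply: nearW => k; rewrite indicE !memNset// -bigcup_mkord => -[j _ Fj].
    by apply: nF; exists j.
  - by move=> k x; exact: norm_indic_le1.
have DS : sigma_algebra setT D.
  by split => // B DB; rewrite setTD; exact: DC.
suff : measurable `<=` D by exact.
apply: smallest_sub => // C; rewrite -bigcup_seq => -[i _ [B mB <-]]; rewrite setTI.
suff : (@measurable _ (measurableTypeR R)) `<=` [set B | D ((fun x : 'cV[R]_n => x i 0) @^-1` B)] by exact.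
have -> : @measurable _ (measurableTypeR R) = (@RGenOInfty.G R).-sigma.-measurable.
  exact: RGenOInfty.measurableE.
apply: smallest_sub.
  split => [|E DE|F DF] /=.
  - by rewrite preimage_set0.
  - by rewrite setTD -preimage_setC; exact: DC.
  - by rewrite preimage_bigcup; exact: Dbig.
move=> _ [a ->] /=; rewrite /D /= (_ : _ @^-1` _ = [set x : 'cV[R]_n | a < x i 0]).
  exact: l2_trig_limit_halfspace.
by apply/seteqP; split => x /=; rewrite in_itv /= andbT.
Qed.

Lemma l2_trig_limit_simple (R : realType) (n : nat) (mu : probability 'cV[R]_n R)
    (f : {nnsfun 'cV[R]_n >-> R}) : l2_trig_limit mu f.
Proof.
rewrite (_ : (f : 'cV[R]_n -> R) = fun x => \sum_(y <- finmap.enum_fset (fset_set (range f))) (y * \1_(f @^-1` [set y]) x)); last first.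
  by apply/funext => x; rewrite fimfunE fsbig_finite.
elim: (finmap.enum_fset _) => [|y r IH].
  rewrite (_ : (fun x => _) = trig [::]); first exact: l2_trig_limit_trig.
  by apply/funext => x; rewrite /trig !big_nil.
rewrite (_ : (fun x => _) = fun x => y * \1_(f @^-1` [set y]) x +
   \sum_(z <- r) (z * \1_(f @^-1` [set z]) x)); last first.
  by apply/funext => x; rewrite big_cons.
apply: l2_trig_limitD => //; apply: l2_trig_limitZ; exact: l2_trig_limit_indic.
Qed.

(** Increasing simple approximations h_k satisfy 0 <= f - h_k <= f, so G dominates the squared
    errors. *)
Lemma l2_trig_limit_ge0 (R : realType) (n : nat) (mu : probability 'cV[R]_n R)
    (f G : 'cV[R]_n -> R) :
  measurable_fun setT f -> (forall x, 0 <= f x) -> (forall x, f x ^+ 2 <= G x) ->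
  mu.-integrable setT (EFin \o G) -> l2_trig_limit mu f.
Proof.
move=> mf f0 fG iG.
have mf' : measurable_fun setT (EFin \o f) by exact/measurable_EFinP.
pose h := nnsfun_approx measurableT mf'.
have f0' x : setT x -> (0 <= (EFin \o f) x)%E by rewrite lee_fin.
have hf k x : h k x <= f x.
  rewrite /h nnsfun_approxE -lee_fin.
  exact: (le_approx k f0' I).
apply: (l2_trig_limit_dominated _ _ _ (fun k => h k : 'cV[R]_n -> R) f G) => //.
- by move=> k; exact: l2_trig_limit_simple.
- move=> x; have := cvg_nnsfun_approx measurableT mf' f0' (x := x) I.
  by move/fine_cvg.
- move=> k x; apply: le_trans (fG x); rewrite lerXn2r// ?nnegrE ?subr_ge0//.
  by rewrite gerBl; exact: fun_ge0.
Qed.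

Lemma l2_trig_dense (R : realType) (n : nat) (mu : probability 'cV[R]_n R) (f : 'cV[R]_n -> R) :
  measurable_fun setT f -> mu.-integrable setT (EFin \o (fun x => f x ^+ 2)) ->
  l2_trig_limit mu f.
Proof.
move=> mf if2.
rewrite (_ : f = fun x => Num.max (f x) 0 + (-1) * Num.max (- f x) 0); last first.
  apply/funext => x; have [f0|] := boolP (0 <= f x).
    by rewrite (max_idPl f0) (max_idPr _) ?oppr_le0// mulr0 addr0.
  rewrite -ltNge => f0; rewrite (max_idPr (ltW f0)) (max_idPl _) ?oppr_ge0 ?ltW//.
  by rewrite mulN1r opprK add0r.
apply: l2_trig_limitD; last apply: l2_trig_limitZ.
- apply: (l2_trig_limit_ge0 _ _ _ _ _ _ _ _ if2).
  + exact: measurable_maxr.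
  + by move=> x; rewrite le_max lexx orbT.
  + by move=> x; case: (lerP (f x) 0) => // _; rewrite expr0n sqr_ge0.
- apply: (l2_trig_limit_ge0 _ _ _ _ _ _ _ _ if2).
  + by apply: measurable_maxr => //; exact: measurableT_comp.
  + by move=> x; rewrite le_max lexx orbT.
  + by move=> x; case: (lerP (- f x) 0) => _; rewrite ?expr0n ?sqr_ge0// sqrrN.
Qed.

(** * Complex-valued functions *)

(** Estimates are made on the squared norm, which splits into real and imaginary parts; roots return
    only at the end. *)
Definition sqnorm {R : realType} {n : nat} (mu : probability 'cV[R]_n R)
    (v : 'cV[R]_n -> R[i]) : \bar R :=
  (\int[mu]_x (complex.Re (v x) ^+ 2 + complex.Im (v x) ^+ 2)%:E)%E.

Definition cmeasurable {R : realType} {n : nat} (v : 'cV[R]_n -> R[i]) : Prop :=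
  measurable_fun setT (fun x => complex.Re (v x)) /\
  measurable_fun setT (fun x => complex.Im (v x)).

Lemma sqnorm_ge0 (R : realType) (n : nat) (mu : probability 'cV[R]_n R) v : (0 <= sqnorm mu v)%E.
Proof. by apply: integral_ge0 => x _; rewrite lee_fin addr_ge0 ?sqr_ge0. Qed.

Lemma L2normE (R : realType) (n : nat) (mu : probability 'cV[R]_n R) v :
  L2norm mu v = (sqnorm mu v `^ 2^-1)%E.
Proof.
rewrite /L2norm unlock; congr (_ `^ _)%E; apply: eq_integral => x _.
case: (v x) => a b /=; rewrite ger0_norm ?sqrtr_ge0//.
rewrite -[2]/(2%:R) powR_mulrn ?sqrtr_ge0// sqr_sqrtr// addr_ge0 ?sqr_ge0//.
Qed.

Lemma L2norm_fin (R : realType) (n : nat) (mu : probability 'cV[R]_n R) v (a : R) :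
  sqnorm mu v = a%:E -> L2norm mu v = (Num.sqrt a)%:E.
Proof.
move=> va; have a0 : 0 <= a by rewrite -lee_fin -va sqnorm_ge0.
by rewrite L2normE va poweR_EFin powR12_sqrt.
Qed.

Lemma sqnorm_fin (R : realType) (n : nat) (mu : probability 'cV[R]_n R) v :
  L2 mu v -> exists2 a : R, 0 <= a & sqnorm mu v = a%:E.
Proof.
move=> [_ _]; rewrite L2normE; have := sqnorm_ge0 _ _ mu v.
case: (sqnorm mu v) => [a| |]//; first by rewrite lee_fin; exists a.
by rewrite poweRyr ?invr_eq0.
Qed.

Lemma L2_sqnorm (R : realType) (n : nat) (mu : probability 'cV[R]_n R) v (a : R) :
  cmeasurable v -> (sqnorm mu v <= a%:E)%E -> L2 mu v.
Proof.
move=> [mR mI] va; split => //.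
have [b vb] : exists b : R, sqnorm mu v = b%:E.
  have := sqnorm_ge0 _ _ mu v; move: va.
  by case: (sqnorm mu v) => [b| |]//; exists b.
by rewrite (L2norm_fin _ _ _ _ _ vb) ltry.
Qed.

Lemma measurable_sqmod (R : realType) (n : nat) (v : 'cV[R]_n -> R[i]) :
  cmeasurable v -> measurable_fun setT (fun x => (complex.Re (v x) ^+ 2 + complex.Im (v x) ^+ 2)%:E).
Proof.
by move=> [mR mI]; apply/measurable_EFinP; apply: measurable_funD; exact: measurable_funX.
Qed.

Lemma cmeasurableD (R : realType) (n : nat) (v w : 'cV[R]_n -> R[i]) :
  cmeasurable v -> cmeasurable w -> cmeasurable (fun x => v x + w x).
Proof.
move=> [vR vI] [wR wI]; split.
- by under eq_fun do rewrite ReD; exact: measurable_funD.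
- by under eq_fun do rewrite ImD; exact: measurable_funD.
Qed.

Lemma cmeasurableN (R : realType) (n : nat) (v : 'cV[R]_n -> R[i]) :
  cmeasurable v -> cmeasurable (fun x => - v x).
Proof.
move=> [vR vI]; split.
- rewrite (_ : (fun x => _) = fun x => - complex.Re (v x)); last first.
    by apply/funext => x; case: (v x).
  exact: measurableT_comp.
- rewrite (_ : (fun x => _) = fun x => - complex.Im (v x)); last first.
    by apply/funext => x; case: (v x).
  exact: measurableT_comp.
Qed.

Lemma cmeasurable_cst (R : realType) (n : nat) (c : R[i]) :
  cmeasurable (fun _ : 'cV[R]_n => c).
Proof. by split; exact: measurable_cst. Qed.

Lemma sqnormN (R : realType) (n : nat) (mu : probability 'cV[R]_n R) v :
  sqnorm mu (fun x => - v x) = sqnorm mu v.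
Proof. by apply: eq_integral => x _; case: (v x) => a b /=; rewrite !sqrrN. Qed.

Lemma sqnorm_cst (R : realType) (n : nat) (mu : probability 'cV[R]_n R) (c : R[i]) :
  sqnorm mu (fun=> c) = (complex.Re c ^+ 2 + complex.Im c ^+ 2)%:E.
Proof.
by rewrite /sqnorm integral_cst// [X in (_ * X)%E](_ : _ = 1%E) ?mule1//; exact: probability_setT.
Qed.

Lemma sqnormE (R : realType) (n : nat) (mu : probability 'cV[R]_n R) v :
  cmeasurable v -> sqnorm mu v = (\int[mu]_x (complex.Re (v x) ^+ 2)%:E +
    \int[mu]_x (complex.Im (v x) ^+ 2)%:E)%E.
Proof.
move=> [mR mI]; rewrite -ge0_integralD//.
- by move=> x _; rewrite lee_fin sqr_ge0.
- by apply/measurable_EFinP; exact: measurable_funX.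
- by move=> x _; rewrite lee_fin sqr_ge0.
- by apply/measurable_EFinP; exact: measurable_funX.
Qed.

Lemma sqnormD_le (R : realType) (n : nat) (mu : probability 'cV[R]_n R) v w :
  cmeasurable v -> cmeasurable w ->
  (sqnorm mu (fun x => v x + w x)%R <= 2%:E * sqnorm mu v + 2%:E * sqnorm mu w)%E.
Proof.
move=> mv mw; rewrite !sqnormE//; last exact: cmeasurableD.
have I0 (f : 'cV[R]_n -> R) : (0 <= \int[mu]_x (f x ^+ 2)%:E)%E.
  by apply: integral_ge0 => x _; rewrite lee_fin sqr_ge0.
have vR := I0 (fun x => complex.Re (v x)); have vI := I0 (fun x => complex.Im (v x)).
have wR := I0 (fun x => complex.Re (w x)); have wI := I0 (fun x => complex.Im (w x)).
have D4 (a b c d : \bar R) : (0 <= a -> 0 <= b -> 0 <= c -> 0 <= d ->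
    2%:E * (a + b) + 2%:E * (c + d) = (2%:E * a + 2%:E * c) + (2%:E * b + 2%:E * d))%E.
  by move=> a0 b0 c0 d0; rewrite !ge0_muleDr// addeACA.
rewrite D4//; apply: leeD.
- under eq_integral do rewrite ReD.
  by apply: integral_sqrD_le; [exact: mv.1|exact: mw.1].
- under eq_integral do rewrite ImD.
  by apply: integral_sqrD_le; [exact: mv.2|exact: mw.2].
Qed.

Lemma ae_eq_sqnorm (R : realType) (n : nat) (mu : probability 'cV[R]_n R) v w :
  cmeasurable v -> cmeasurable w -> v = w %[ae mu] -> sqnorm mu v = sqnorm mu w.
Proof.
move=> mv mw vw; apply: ae_eq_integral => //; try exact: measurable_sqmod.
by apply: filterS vw => x H _; rewrite H.
Qed.

Definition cmean {R : realType} {n : nat} (mu : probability 'cV[R]_n R)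
    (v : 'cV[R]_n -> R[i]) : R[i] :=
  Complex (\int[mu]_x complex.Re (v x)) (\int[mu]_x complex.Im (v x)).

Lemma L2_integrable (R : realType) (n : nat) (mu : probability 'cV[R]_n R) v :
  L2 mu v ->
  [/\ mu.-integrable setT (EFin \o (fun x => complex.Re (v x))),
      mu.-integrable setT (EFin \o (fun x => complex.Im (v x))),
      mu.-integrable setT (EFin \o (fun x => complex.Re (v x) ^+ 2)) &
      mu.-integrable setT (EFin \o (fun x => complex.Im (v x) ^+ 2))].
Proof.
move=> vL; have [mR mI _] := vL; have [a a0 va] := sqnorm_fin _ _ _ _ vL.
have I2 : mu.-integrable setT (EFin \o (fun x => complex.Re (v x) ^+ 2 + complex.Im (v x) ^+ 2)).
  apply/integrableP; split; first exact: measurable_sqmod.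
  rewrite (_ : integral _ _ _ = sqnorm mu v); first by rewrite va ltry.
  rewrite /sqnorm; apply: eq_integral => x _ /=.
  by rewrite ger0_norm// addr_ge0 ?sqr_ge0.
have I3 : mu.-integrable setT (EFin \o (fun x => 1 + (complex.Re (v x) ^+ 2 + complex.Im (v x) ^+ 2))).
  rewrite (_ : _ \o _ = (EFin \o cst 1%R) \+ (EFin \o (fun x => complex.Re (v x) ^+ 2 + complex.Im (v x) ^+ 2)%R))%E; last first.
    by apply/funext => x /=; rewrite EFinD.
  by apply: integrableD => //; exact: finite_measure_integrable_cst.
(* Square integrable functions are integrable because mu is finite. *)
have le1 (r s : R) : `|r| <= 1 + (r ^+ 2 + s ^+ 2).
  rewrite -[r ^+ 2]real_normK ?num_real//.
  have := sqr_ge0 (`|r| - 1); have := sqr_ge0 s; rewrite sqrrB expr1n mulr1; nra.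
split.
- by apply: integrable_le_EFin I3.
- by apply: integrable_le_EFin I3 => // x; rewrite [X in 1 + X]addrC.
- apply: integrable_le_EFin I2; first exact: measurable_funX.
  by move=> x; rewrite ger0_norm ?sqr_ge0// lerDl sqr_ge0.
- apply: integrable_le_EFin I2; first exact: measurable_funX.
  by move=> x; rewrite ger0_norm ?sqr_ge0// lerDr sqr_ge0.
Qed.

Lemma sqnorm_cmean_le (R : realType) (n : nat) (mu : probability 'cV[R]_n R) v :
  L2 mu v -> (sqnorm mu (fun=> cmean mu v) <= sqnorm mu v)%E.
Proof.
move=> vL; have [iR iI iR2 iI2] := L2_integrable _ _ _ _ vL; have [mR mI _] := vL.
rewrite sqnorm_cst sqnormE// EFinD /=; apply: leeD.
- rewrite -[leRHS]fineK; last exact: integrable_fin_num.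
  by rewrite lee_fin; exact: Rintegral_sqr_le.
- rewrite -[leRHS]fineK; last exact: integrable_fin_num.
  by rewrite lee_fin; exact: Rintegral_sqr_le.
Qed.

Lemma cmeanD (R : realType) (n : nat) (mu : probability 'cV[R]_n R) v w :
  L2 mu v -> L2 mu w -> cmean mu (fun x => v x + w x) = cmean mu v + cmean mu w.
Proof.
move=> vL wL; have [vR vI _ _] := L2_integrable _ _ _ _ vL.
have [wR wI _ _] := L2_integrable _ _ _ _ wL.
rewrite /cmean; under [X in Complex X _]eq_Rintegral do rewrite ReD.
under [X in Complex _ X]eq_Rintegral do rewrite ImD.
by rewrite !RintegralD.
Qed.

Lemma cintegral_density (R : realType) (n : nat) (mu : probability 'cV[R]_n R) rho v :
  has_density mu rho -> L2 mu v ->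
  cintegral (lebesgue n) (fun y => v y * (rho y)%:C%C) = cmean mu v.
Proof.
move=> murho vL; have [vR vI _ _] := L2_integrable _ _ _ _ vL.
rewrite /cintegral /cmean -!(Rintegral_density _ _ _ _ _ murho)//.
by congr Complex; apply: eq_Rintegral => x _; case: (v x) => a b /=; ring.
Qed.

Lemma le_L2norm_sqnorm (R : realType) (n : nat) (mu : probability 'cV[R]_n R) v w (M : R) :
  L2 mu v -> L2 mu w -> (L2norm mu v <= M%:E * L2norm mu w)%E ->
  (sqnorm mu v <= (M ^+ 2)%:E * sqnorm mu w)%E.
Proof.
move=> /sqnorm_fin[a a0 va] /sqnorm_fin[b b0 wb].
rewrite (L2norm_fin _ _ _ _ _ va) (L2norm_fin _ _ _ _ _ wb) va wb -!EFinM !lee_fin => ab.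
rewrite -(sqr_sqrtr a0) -(sqr_sqrtr b0) -exprMn lerXn2r// nnegrE ?sqrtr_ge0//.
exact: le_trans (sqrtr_ge0 _) ab.
Qed.

Lemma sqnorm_le_L2norm (R : realType) (n : nat) (mu : probability 'cV[R]_n R) v w (M : R) :
  L2 mu v -> L2 mu w -> 0 <= M -> (sqnorm mu v <= (M ^+ 2)%:E * sqnorm mu w)%E ->
  (L2norm mu v <= M%:E * L2norm mu w)%E.
Proof.
move=> /sqnorm_fin[a a0 va] /sqnorm_fin[b b0 wb] M0.
rewrite (L2norm_fin _ _ _ _ _ va) (L2norm_fin _ _ _ _ _ wb) va wb -!EFinM !lee_fin => ab.
by rewrite -[M in leRHS](ger0_norm M0) -sqrtr_sqr -sqrtrM ?sqr_ge0// ler_sqrt// mulr_ge0 ?sqr_ge0.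
Qed.

Lemma L2_cmeasurable (R : realType) (n : nat) (mu : probability 'cV[R]_n R) v :
  L2 mu v -> cmeasurable v.
Proof. by case. Qed.

(** The shape i v + w is that of the linearity clause of [ou_semigroup], which then applies as it
    stands. *)
Definition ctrig {R : realType} {n : nat} (s1 s2 : seq (R * 'cV[R]_n * R)) (x : 'cV[R]_n) : R[i] :=
  'i%C * (trig s2 x)%:C%C + (trig s1 x)%:C%C.

Lemma ctrigE (R : realType) (n : nat) (s1 s2 : seq (R * 'cV[R]_n * R)) x :
  ctrig s1 s2 x = Complex (trig s1 x) (trig s2 x).
Proof. by rewrite /ctrig; apply/eqP; rewrite eq_complex /=; apply/andP; split; apply/eqP; ring. Qed.

Lemma cmeasurable_ctrig (R : realType) (n : nat) (s1 s2 : seq (R * 'cV[R]_n * R)) :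
  cmeasurable (ctrig s1 s2).
Proof.
split.
- by under eq_fun do rewrite ctrigE; exact: measurable_trig.
- by under eq_fun do rewrite ctrigE; exact: measurable_trig.
Qed.

Lemma integral_sqr_bounded (R : realType) (n : nat) (mu : probability 'cV[R]_n R)
    (f : 'cV[R]_n -> R) (M : R) :
  measurable_fun setT f -> (forall x, `|f x| <= M) ->
  (\int[mu]_x (f x ^+ 2)%:E)%E = (\int[mu]_x f x ^+ 2)%:E.
Proof.
move=> mf fM; rewrite fineK//; apply: integrable_fin_num => //.
apply: (bounded_integrable _ _ _ _ _ (M ^+ 2)); first exact: measurable_funX.
move=> x; rewrite normrX lerXn2r ?nnegrE ?fM//.
exact: le_trans (fM x).
Qed.

Lemma L2_ctrig (R : realType) (n : nat) (mu : probability 'cV[R]_n R)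
    (s1 s2 : seq (R * 'cV[R]_n * R)) : L2 mu (ctrig s1 s2).
Proof.
have m12 := cmeasurable_ctrig _ _ s1 s2.
apply: (L2_sqnorm _ _ _ _ (\int[mu]_x trig s1 x ^+ 2 + \int[mu]_x trig s2 x ^+ 2)) => //.
rewrite sqnormE//; under eq_integral do rewrite ctrigE.
under [X in (_ + X)%E]eq_integral do rewrite ctrigE.
by rewrite /= !(integral_sqr_bounded _ _ _ _ _ (measurable_trig _ _ _) (trig_bounded _ _ _)).
Qed.

(** Real and imaginary parts contract separately with the same factor, so passing to complex values
    costs nothing. *)
Lemma sqnorm_ctrig_decay (R : realType) (n : nat) (mu : probability 'cV[R]_n R)
    (k : R) (s1 s2 r1 r2 : seq (R * 'cV[R]_n * R)) :
  \int[mu]_x (trig r1 x - \int[mu]_y trig s1 y) ^+ 2 <= k * \int[mu]_x trig s1 x ^+ 2 ->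
  \int[mu]_x (trig r2 x - \int[mu]_y trig s2 y) ^+ 2 <= k * \int[mu]_x trig s2 x ^+ 2 ->
  (sqnorm mu (fun x => ctrig r1 r2 x - cmean mu (ctrig s1 s2))%R <=
   k%:E * sqnorm mu (ctrig s1 s2))%E.
Proof.
move=> H1 H2.
have m12 := cmeasurable_ctrig _ _ s1 s2.
have bd (r : seq (R * 'cV[R]_n * R)) (c : R) x : `|trig r x - c| <= \sum_(p <- r) `|p.1.1| + `|c|.
  by rewrite (le_trans (ler_normB _ _))// lerD2r trig_bounded.
have mB (r : seq (R * 'cV[R]_n * R)) (c : R) : measurable_fun setT (fun x => trig r x - c).
  by apply: measurable_funB => //; exact: measurable_trig.
have cm : cmean mu (ctrig s1 s2) = Complex (\int[mu]_y trig s1 y) (\int[mu]_y trig s2 y).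
  by rewrite /cmean; congr Complex; apply: eq_Rintegral => x _; rewrite ctrigE.
rewrite cm [X in (_ <= _ * X)%E]sqnormE//.
rewrite sqnormE; last first.
  apply: cmeasurableD; first exact: cmeasurable_ctrig.
  exact: cmeasurable_cst.
under eq_integral do rewrite ctrigE.
under [X in (_ + X <= _)%E]eq_integral do rewrite ctrigE.
under [X in (_ <= _ * (X + _))%E]eq_integral do rewrite ctrigE.
under [X in (_ <= _ * (_ + X))%E]eq_integral do rewrite ctrigE.
rewrite /= !(integral_sqr_bounded _ _ _ _ _ (measurable_trig _ _ _) (trig_bounded _ _ _)).
rewrite !(integral_sqr_bounded _ _ _ _ _ (mB _ _) (bd _ _)).
by rewrite -!EFinD -EFinM lee_fin mulrDr lerD.
Qed.

Lemma L2_dense_ctrig (R : realType) (n : nat) (mu : probability 'cV[R]_n R) v (e : R) :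
  L2 mu v -> 0 < e ->
  exists s1 s2, (sqnorm mu (fun x => v x - ctrig s1 s2 x)%R <= e%:E)%E.
Proof.
move=> vL e0; have [mR mI _] := vL; have [_ _ iR iI] := L2_integrable _ _ _ _ vL.
have e20 : 0 < e / 2 by rewrite divr_gt0.
have [_ /(_ _ e20)[s1 H1]] := l2_trig_dense _ _ _ _ mR iR.
have [_ /(_ _ e20)[s2 H2]] := l2_trig_dense _ _ _ _ mI iI.
exists s1, s2; rewrite sqnormE; last first.
  by apply: cmeasurableD => //; apply: cmeasurableN; exact: cmeasurable_ctrig.
have -> : e%:E = ((e / 2)%:E + (e / 2)%:E)%E by rewrite -EFinD -splitr.
apply: leeD.
- rewrite (eq_integral (fun x => ((complex.Re (v x) - trig s1 x) ^+ 2)%:E))// => x _.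
  by rewrite ctrigE; case: (v x).
- rewrite (eq_integral (fun x => ((complex.Im (v x) - trig s2 x) ^+ 2)%:E))// => x _.
  by rewrite ctrigE; case: (v x).
Qed.

(** * Decay of the semigroup on L^2(mu) *)

Lemma ou_semigroup_ctrig (R : realType) (n : nat) (Q B : 'M[R]_n)
    (mu : probability 'cV[R]_n R) S (t : R) s1 s2 :
  psd Q -> invariant_measure Q B mu -> ou_semigroup Q B mu S -> 0 < t ->
  S t (ctrig s1 s2) = ctrig (ou_trig Q B t s1) (ou_trig Q B t s2) %[ae mu].
Proof.
move=> Q0 muI [_ Slin _ _ _ _ _ Smark] t0.
have t1 := ltW t0.
have LC s : L2 mu (fun x => (trig s x)%:C%C).
  rewrite (_ : (fun x => _) = ctrig s [::]); first exact: L2_ctrig.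
  by apply/funext => x; rewrite ctrigE /trig big_nil.
have SC s : S t (fun x => (trig s x)%:C%C) = (fun x => (trig (ou_trig Q B t s) x)%:C%C) %[ae mu].
  rewrite -(ou_markov_trig _ _ _ _ _ _ _ Q0 muI t0); apply: Smark => //.
    exact: continuous_trig.
  by eexists => x; exact: trig_bounded.
have := Slin t 'i%C _ _ t1 (LC s2) (LC s1).
apply: filterS3 (SC s1) (SC s2) => x H1 H2 H3 _.
by rewrite [LHS]H3// H1// H2.
Qed.

(** Split v = z + w with w a sum of cosines and z small. The part w contracts, while z is only
    bounded, with a norm M that may depend on t; M disappears when z tends to 0 at fixed t. *)
Lemma ou_semigroup_sqnorm_decay (R : realType) (n : nat) (Q B : 'M[R]_n)
    (mu : probability 'cV[R]_n R) S (tau : R) :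
  (1 <= n)%N -> psd Q -> invariant_measure Q B mu -> ou_semigroup Q B mu S ->
  tau < spectral_gap B ->
  exists2 K : R, 0 < K & forall t v, 0 < t -> L2 mu v ->
    (sqnorm mu (fun x => S t v x - cmean mu v)%R <=
      (4 * K * expR (- 2 * tau * t))%:E * sqnorm mu v)%E.
Proof.
move=> n1 Q0 muI Sg tauB.
have [K K0 HK] := ou_trig_contraction _ _ _ _ _ _ n1 Q0 muI tauB.
exists K => // t v t0 vL.
have t1 := ltW t0.
pose k := K * expR (- 2 * tau * t).
have k0 : 0 <= k by rewrite mulr_ge0 ?expR_ge0// ltW.
have SL2 w (wL : L2 mu w) : L2 mu (S t w) := ou_semigroup_L2 Sg t1 wL.
have [M HM] := ou_semigroup_bounded Sg t1.
have [a a0 va] := sqnorm_fin _ _ _ _ vL.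
rewrite va -EFinM; apply/lee_addgt0Pr => e e0.
(* With a, b, c, d the squared norms of v, z, w and S t z, the final bound is 2 k c + 2 (2 d + 2 b),
   where c <= 2 a + 2 b and d <= M^2 b. It is at most 4 k a + H b, so b <= e / H is the accuracy to
   ask for. *)
pose H := 4 * k + 4 * M ^+ 2 + 4.
have H0 : 0 < H by rewrite ltr_wpDl// addr_ge0// mulr_ge0// sqr_ge0.
have eH : 0 < e / H by rewrite divr_gt0.
have [s1 [s2 vs]] := L2_dense_ctrig _ _ _ _ _ vL eH.
pose w := ctrig s1 s2; pose z x := v x - w x.
have wL : L2 mu w := L2_ctrig _ _ _ _ _.
have mz : cmeasurable z.
  by apply: cmeasurableD; [exact: L2_cmeasurable vL|apply: cmeasurableN; exact: L2_cmeasurable wL].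
have zL : L2 mu z := L2_sqnorm _ _ _ _ _ mz vs.
have vE : v = (fun x => 1 * z x + w x) by apply/funext => x; rewrite mul1r subrK.
have [b b0 zb] := sqnorm_fin _ _ _ _ zL.
have be : b <= e / H by rewrite -lee_fin -zb.
have [c c0 wc] := sqnorm_fin _ _ _ _ wL.
have [d d0 Szd] := sqnorm_fin _ _ _ _ (SL2 _ zL).
have db : d <= M ^+ 2 * b.
  rewrite -lee_fin EFinM -Szd -zb; apply: le_L2norm_sqnorm => //; first exact: SL2.
  exact: HM.
have mwv : (fun x => - z x + v x) = w by apply/funext => x; rewrite opprB subrK.
have cab : c <= 2 * a + 2 * b.
  rewrite -lee_fin EFinD !EFinM -wc -va -zb -[X in sqnorm mu X]mwv addeC.
  rewrite -(sqnormN _ _ _ z).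
  by apply: sqnormD_le; [exact: cmeasurableN|exact: L2_cmeasurable vL].
pose Tw := ctrig (ou_trig Q B t s1) (ou_trig Q B t s2).
have mv : cmean mu v = cmean mu w + cmean mu z.
  rewrite {1}vE; under [X in cmean _ X]eq_fun do rewrite mul1r.
  by rewrite (cmeanD _ _ _ _ _ zL wL) addrC.
have Sv : (fun x => S t v x - cmean mu v) =
    (fun x => (Tw x - cmean mu w) + (S t z x - cmean mu z)) %[ae mu].
  have h1 := ou_semigroup_linear Sg 1 t1 zL wL; rewrite -vE in h1.
  have h2 := ou_semigroup_ctrig _ _ _ _ _ _ _ s1 s2 Q0 muI Sg t0.
  apply: filterS2 h1 h2 => x h1 h2 _.
  by rewrite h1// h2// mul1r mv /Tw; ring.
have mT : cmeasurable (fun x => Tw x - cmean mu w).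
  by apply: cmeasurableD; [exact: cmeasurable_ctrig|exact: cmeasurable_cst].
have mS : cmeasurable (fun x => S t z x - cmean mu z).
  by apply: cmeasurableD; [exact: L2_cmeasurable (SL2 _ zL)|exact: cmeasurable_cst].
rewrite (ae_eq_sqnorm _ _ _ _ _ _ _ Sv); last 2 first.
- by apply: cmeasurableD; [exact: L2_cmeasurable (SL2 _ vL)|exact: cmeasurable_cst].
- exact: cmeasurableD.
apply: (le_trans (sqnormD_le _ _ _ _ _ mT mS)).
have T1 : (sqnorm mu (fun x => Tw x - cmean mu w)%R <= (k * c)%:E)%E.
  by rewrite EFinM -wc; apply: sqnorm_ctrig_decay; exact: HK.
have T2 : (sqnorm mu (fun x => S t z x - cmean mu z)%R <= (2 * d + 2 * b)%:E)%E.
  apply: le_trans (sqnormD_le _ _ _ _ _ _ _) _.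
  - exact: L2_cmeasurable (SL2 _ zL).
  - exact: cmeasurable_cst.
  have -> : ((2 * d + 2 * b)%:E = 2%:E * sqnorm mu (S t z) + 2%:E * sqnorm mu z)%E.
    by rewrite Szd zb -!EFinM -EFinD.
  apply: leeD => //; rewrite lee_pmul2l// (sqnormN _ _ _ (fun=> cmean mu z)).
  exact: sqnorm_cmean_le.
apply: (@le_trans _ _ (2%:E * (k * c)%:E + 2%:E * (2 * d + 2 * b)%:E)%E).
  by apply: leeD; rewrite lee_pmul2l.
rewrite -!EFinM -!EFinD lee_fin.
have kc : k * c <= k * (2 * a + 2 * b) by rewrite ler_wpM2l.
have Hb : H * b <= e by rewrite mulrC -ler_pdivlMr.
rewrite (_ : 4 * K * expR (- 2 * tau * t) = 4 * k); last by rewrite /k; ring.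
move: Hb; rewrite /H !mulrDl => Hb; lra.
Qed.

Theorem theorem2p7 (R : realType) (n : nat) (Q B : 'M[R]_n)
    (mu : probability 'cV[R]_n R) (rho : 'cV[R]_n -> R)
    (S : R -> ('cV[R]_n -> R[i]) -> 'cV[R]_n -> R[i])
    (n_ge1 : (1 <= n)%N)
    (Q_sym : Q^T = Q)
    (Q_psd : forall x : 'cV[R]_n, 0 <= quad_form Q x)
    (P_hypoelliptic : hypoelliptic Q B)
    (mu_invariant : invariant_measure Q B mu)
    (mu_rho : has_density mu rho)
    (S_semigroup : ou_semigroup Q B mu S) :
  0 < spectral_gap B /\
  forall tau : R, 0 <= tau -> tau < spectral_gap B ->
    exists C : R, 0 < C /\
      forall (t : R) (v : 'cV[R]_n -> R[i]), 0 <= t -> L2 mu v ->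
        (L2norm mu (fun x => S t v x -
            cintegral (lebesgue n) (fun y => v y * (rho y)%:C%C))%R
         <= (C * expR (- tau * t))%:E * L2norm mu v)%E.
Proof.
have Q0 : psd Q by [].
have sB l : spectrum B l -> complex.Re l < 0 by exact: (spectrum_Re_lt0 _ _ _ _ _ _ Q0 mu_invariant).
split; first exact: (spectral_gapP _ _ _ n_ge1 sB).1.
move=> tau tau0 tauB.
have [K K0 HK] := ou_semigroup_sqnorm_decay _ _ _ _ _ _ _ n_ge1 Q0 mu_invariant S_semigroup tauB.
have K40 : 0 <= 4 * K + 4 by rewrite addr_ge0// mulr_ge0// ltW.
(* 4 K serves t > 0. The added 4 serves t = 0, where S 0 v = v almost everywhere and |v - m|^2 <= 2
   |v|^2 + 2 |m|^2 with |m| <= |v| in norm. *)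
exists (Num.sqrt (4 * K + 4)); split.
  by rewrite sqrtr_gt0 ltr_wpDl// mulr_ge0// ltW.
move=> t v t0 vL; rewrite (cintegral_density _ _ _ _ _ mu_rho vL).
have [a a0 va] := sqnorm_fin _ _ _ _ vL.
have SvL : L2 mu (S t v) := ou_semigroup_L2 S_semigroup t0 vL.
have e2 : (Num.sqrt (4 * K + 4) * expR (- tau * t)) ^+ 2 = (4 * K + 4) * expR (- 2 * tau * t).
  by rewrite exprMn sqr_sqrtr// -expRM_natl; congr (_ * expR _); ring.
have mSm : cmeasurable (fun x => S t v x - cmean mu v).
  by apply: cmeasurableD; [exact: L2_cmeasurable SvL|exact: cmeasurable_cst].
have main : (sqnorm mu (fun x => S t v x - cmean mu v)%R <=
   ((4 * K + 4) * expR (- 2 * tau * t))%:E * sqnorm mu v)%E.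
  move: t0; rewrite le_eqVlt => /predU1P[t0|t0]; last first.
    apply: (le_trans (HK t v t0 vL)); rewrite lee_wpmul2r ?sqnorm_ge0// lee_fin.
    by rewrite ler_wpM2r ?expR_ge0// lerDl.
  rewrite -t0 mulr0 expR0 mulr1.
  have S0 : (fun x => S 0 v x - cmean mu v) = (fun x => v x - cmean mu v) %[ae mu].
    by apply: filterS (ou_semigroup0 S_semigroup vL) => x H _; rewrite H.
  rewrite -t0 in mSm; rewrite (ae_eq_sqnorm _ _ _ _ _ mSm _ S0); last first.
    by apply: cmeasurableD; [exact: L2_cmeasurable vL|exact: cmeasurable_cst].
  apply: le_trans (sqnormD_le _ _ _ _ _ _ _) _; [exact: L2_cmeasurable vL|exact: cmeasurable_cst|].
  rewrite (sqnormN _ _ _ (fun=> cmean mu v)).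
  apply: (@le_trans _ _ (2%:E * sqnorm mu v + 2%:E * sqnorm mu v)%E).
    by apply: leeD => //; rewrite lee_pmul2l// sqnorm_cmean_le.
  by rewrite va -!EFinM -EFinD lee_fin -mulrDl ler_wpM2r//; lra.
apply: sqnorm_le_L2norm => //.
- by apply: (L2_sqnorm _ _ _ _ _ mSm); rewrite va -EFinM in main; exact: main.
- by rewrite e2.
Qed.
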